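(* Let $\kappa$ be a strong limit cardinal which is the limit of the fixed $\Sigma$-sequence $\langle\kappa_n:n<\omega\rangle$, and let $\lambda>\kappa$ be inaccessible. Let $\mathbb P_\infty$ be a $(\kappa,\lambda)$-nice weak $\Sigma$-system, and let $G\subseteq\mathbb P_\infty$ be a generic filter over $V$. Then $L(V_{\kappa+1})^{V[G]}$ is a $\kappa$-Solovay model over $V$.
   Context: Standing assumption. A $\Sigma$-sequence is a non-decreasing sequence $\langle\kappa_n:n<\omega\rangle$ of regular uncountable cardinals converging to a strong limit cardinal $\kappa$. One such sequence is fixed (in the ground model $V$). For a model $N$, $L(V_{\kappa+1})^N$ is the inner model $L(V_{\kappa+1})$ as computed in $N$. $\Sigma$-Příkrý forcing. A forcing poset $\langle\mathbb P,\le,\mathbb 1\rangle$ (with maximum $\mathbb 1$) is $\Sigma$-Příkrý if there are a surjective map $\ell:\mathbb P\to\omega$ (the length), a cardinal $\mu$ and a map $c:\mathbb P\to\mu$ such that: (1) if $q\le p$ then $\ell(q)\ge\ell(p)$; (2) for all $p$ there is $q\le p$ with $\ell(q)=\ell(p)+1$; (3) for each $n$, the subposet $\ell^{-1}(\{n\})\cup\{\mathbb 1\}$ is $\kappa_n$-directed-closed, meaning that if $L\subseteq\mathbb P$ is a set of pairwise compatible elements with $|L|<\kappa_n$ and $\ell(p)=n$ for all $p\in L$, there is $r$ with $\ell(r)=n$ and $r\le p$ for all $p\in L$; (4) $\mathbb 1\Vdash\check\mu=\check\kappa^+$; (5) if $c(p)=c(q)$ there is $r\le p,q$ with $\ell(r)=\ell(p)=\ell(q)$;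 (6) if $q\le p$ and $\ell(q)=\ell(p)+n+m$, the set $\{r\le p:q\le r,\ \ell(r)=\ell(p)+n\}$ has a greatest element, denoted $m(p,q)$; for $m=0$ it is written $w(p,q)$; (7) for all $p$, the set $W(p):=\{w(p,q):q\le p\}$ has size ${<}\mu$; (8) for $p'\le p$, the map $q\mapsto w(p,q)$ is order-preserving from $W(p')$ to $W(p)$; (9) if $U\subseteq\mathbb P$ is such that for all $r\in U$ and $q\le r$ with $\ell(q)=\ell(r)$ we have $q\in U$, then for all $p\in\mathbb P$ and $n<\omega$ there is $q\le p$ with $\ell(q)=\ell(p)$ such that $\{r\le q:\ell(r)=\ell(q)+n\}$ is either contained in $U$ or disjoint from $U$. $\kappa$-Solovay models. Let $V\subseteq M$ be models of $\mathsf{ZFC}$. $L(V_{\kappa+1})^M$ is a $\kappa$-Solovay model over $V$ if: (i) for all $x\subseteq\kappa$ in $M$, the ordinal $(\kappa^+)^M$ is an inaccessible cardinal in $V[x]$; (ii) for all $x\subseteq\kappa$ in $M$ there are a $\Sigma$-Příkrý forcing $\mathbb P\in V$ with $|\mathbb P|^M\le\kappa$ and a filter $g\subseteq\mathbb P$ in $M$, generic over $V$, with $V[x]\subseteq V[g]$ and $\mathrm{cof}(\kappa)^{V[g]}=\omega$. Weak projections. A map $\pi:\mathbb P\to\mathbb Q$ between forcing posets is a weak projection if it is order-preserving and for all $p\in\mathbb P$ there is $p^*\le p$ such that for all $q\le\pi(p^* )$ in $\mathbb Q$ there is $p'\le p$ with $\pi(p')\le q$. If $G\subseteq\mathbb P$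 is a generic filter, $\pi''G$ is identified with its upward closure in $\mathbb Q$, which is $\mathbb Q$-generic. Weak ($\Sigma$-)systems. Let $\mathsf D$ be a downwards directed posetal category (at most one arrow between two objects; for any objects $d,e$ there are an object $f$ and arrows $f\to d$, $f\to e$). A weak system consists of: a poset $\mathbb P_d$ and $p_d\in\mathbb P_d$ for each object $d$; weak projections $\pi_{d,e}:\mathbb P_d\to\mathbb P_e$ with $\pi_{d,e}(p_d)=p_e$ for each arrow $d\to e$, with $\pi_{d,d}=\mathrm{id}$ and $\pi_{e,f}\circ\pi_{d,e}=\pi_{d,f}$ whenever $d\to e\to f$; a poset $\mathbb P_\infty$, an element $p_\infty\in\mathbb P_\infty$, and weak projections $\pi_{\infty,d}:\mathbb P_\infty\to\mathbb P_d$ with $\pi_{\infty,d}(p_\infty)=p_d$ and $\pi_{d,e}\circ\pi_{\infty,d}=\pi_{\infty,e}$ for $d\to e$. One says just ''the weak system $\mathbb P_\infty$'', with $p_\infty=\mathbb 1_{\mathbb P_\infty}$ understood. It is a weak $\Sigma$-system if $\mathbb P_\infty$ and all $\mathbb P_d$ are $\Sigma$-Příkrý. Niceness. For $\lambda>\kappa$ inaccessible, a weak system $\mathbb P_\infty$ is $(\kappa,\lambda)$-nice if: ($\kappa$-capturing) for every $\mathbb P_\infty$-generic $G$ over $V$, every $x\subseteq\kappa$ in $V[G]$ and every object $d$ there is an arrow $e\to d$ with $x\in V[\pi_{\infty,e}''G]$; ($\lambda$-bounded) $\mathbb P_d\in H(\lambda)$ for all objects $d$; (amenable to interpolation) for every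 $\mathbb P_\infty$-generic $G$ over $V$, $\lambda=(\kappa^+)^{V[G]}$ and $\mathrm{cof}(\kappa)^{V[G]}=\omega$. *)

(* Defs.v *)
From Stdlib Require Import ClassicalEpsilon FunctionalExtensionality
  PropExtensionality ProofIrrelevance Wellfounded Relations.

Set Implicit Arguments.

(** * The background universe of sets

    The forcing theory is carried out over a transitive model [V] of ZFC (a
    set or a proper class) living in the universe [set] below, which also
    contains the generic filters.  [set] is Aczel's type of well-founded trees
    modulo bisimulation, so that extensionality holds for Leibniz equality. *)

Inductive tree : Type := sup (A : Type) (f : A -> tree).

Fixpoint bisim (x y : tree) : Prop :=
  match x, y with
  | sup f, sup g =>
      (forall a, exists b, bisim (f a) (g b)) /\
      (forall b, exists a, bisim (f a) (g b))
  end.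

Lemma bisim_refl x : bisim x x.
Proof. induction x as [A f IH]; split; intros a; exists a; apply IH. Qed.

Lemma bisim_sym x y : bisim x y -> bisim y x.
Proof.
  revert y; induction x as [A f IH]; intros [B g] [H1 H2]; split.
  - intros b; destruct (H2 b) as [a Ha]; exists a; auto.
  - intros a; destruct (H1 a) as [b Hb]; exists b; auto.
Qed.

Lemma bisim_trans x y z : bisim x y -> bisim y z -> bisim x z.
Proof.
  revert y z; induction x as [A f IH]; intros [B g] [C h] [H1 H2] [K1 K2]; split.
  - intros a; destruct (H1 a) as [b Hb]; destruct (K1 b) as [c Hc]; exists c; eauto.
  - intros c; destruct (K2 c) as [b Hb]; destruct (H2 b) as [a Ha]; exists a; eauto.
Qed.

Definition set : Type := {C : tree -> Prop | exists x, C = bisim x}.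

Definition cls (x : tree) : set := exist _ (bisim x) (ex_intro _ x eq_refl).

Definition tree_mem (x y : tree) : Prop :=
  match y with sup g => exists b, bisim x (g b) end.

Definition mem (x y : set) : Prop :=
  exists s t, x = cls s /\ y = cls t /\ tree_mem s t.

Declare Scope st_scope.
Open Scope st_scope.
Infix "∈" := mem (at level 70) : st_scope.
Definition subset (x y : set) : Prop := forall z, z ∈ x -> z ∈ y.
Infix "⊆" := subset (at level 70) : st_scope.

Lemma cls_surj (x : set) : exists t, x = cls t.
Proof.
  destruct x as [C [t Ht]]; exists t; unfold cls; subst C; reflexivity.
Qed.

Lemma cls_eq s t : cls s = cls t <-> bisim s t.
Proof.
  split.
  - intros H; apply (f_equal (@proj1_sig _ _)) in H; cbn in H.
    rewrite H; apply bisim_refl.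
  - intros H; unfold cls.
    assert (E : bisim s = bisim t).
    { apply functional_extensionality; intros u; apply propositional_extensionality.
      split; intros K; [apply bisim_trans with s | apply bisim_trans with t];
        auto using bisim_sym. }
    assert (P : forall C D (p : exists x, C = bisim x) (q : exists x, D = bisim x),
      C = D -> exist (fun C => exists x, C = bisim x) C p = exist _ D q).
    { intros C D p q e; subst D; f_equal; apply proof_irrelevance. }
    apply P, E.
Qed.

Lemma mem_sup x (A : Type) (f : A -> tree) :
  x ∈ cls (sup f) <-> exists a, x = cls (f a).
Proof.
  split.
  - intros (s & [B g] & Hs & Ht & b & Hb); subst x.
    apply cls_eq in Ht; destruct Ht as [_ H2]; destruct (H2 b) as [a Ha].
    exists a; apply cls_eq; apply bisim_trans with (g b); auto using bisim_sym.
  - intros [a Ha]; exists (f a), (sup f); repeat split; auto.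
    exists a; apply bisim_refl.
Qed.

Lemma set_ext x y : (forall z, z ∈ x <-> z ∈ y) -> x = y.
Proof.
  destruct (cls_surj x) as [[A f] Hx], (cls_surj y) as [[B g] Hy]; subst.
  intros H; apply cls_eq; split.
  - intros a.
    assert (K : cls (f a) ∈ cls (sup g)) by (apply H, mem_sup; eauto).
    apply mem_sup in K; destruct K as [b Hb]; exists b; apply cls_eq, Hb.
  - intros b.
    assert (K : cls (g b) ∈ cls (sup f)) by (apply H, mem_sup; eauto).
    apply mem_sup in K; destruct K as [a Ha]; exists a.
    apply bisim_sym, cls_eq, Ha.
Qed.

Lemma mem_wf : well_founded mem.
Proof.
  intros x; destruct (cls_surj x) as [t Ht]; subst x.
  induction t as [A f IH]; constructor; intros y Hy.
  apply mem_sup in Hy; destruct Hy as [a Ha]; subst y; apply IH.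
Qed.

Definition tc : set -> set -> Prop := clos_trans set mem.

Lemma tc_wf : well_founded tc.
Proof. exact (wf_clos_trans _ _ mem_wf). Qed.

(** ** Set abstraction

    [setof C] is the set of all [z] with [C z] if there is one, and is
    unspecified otherwise.  It is only applied below to classes that are sets. *)

Definition setof (C : set -> Prop) : set :=
  epsilon (inhabits (cls (sup (fun e : False => match e with end))))
    (fun s => forall z, z ∈ s <-> C z).

Lemma mem_setof (C : set -> Prop) :
  (exists s, forall z, z ∈ s <-> C z) -> forall z, z ∈ setof C <-> C z.
Proof. intros H; exact (epsilon_spec _ _ H). Qed.

Lemma mem_setof_range (A : Type) (f : A -> set) z :
  z ∈ setof (fun z => exists a, z = f a) <-> exists a, z = f a.
Proof.
  revert z; apply mem_setof.
  pose (h := fun a =>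
    proj1_sig (constructive_indefinite_description _ (cls_surj (f a)))).
  assert (Hh : forall a, cls (h a) = f a).
  { intros a; symmetry.
    exact (proj2_sig (constructive_indefinite_description _ (cls_surj (f a)))). }
  exists (cls (sup h)); intros z; rewrite mem_sup.
  split; intros [a E]; exists a; rewrite E, ?Hh; reflexivity.
Qed.

Lemma mem_setof_image (a : set) (R : set -> set -> Prop) :
  (forall x y y', x ∈ a -> R x y -> R x y' -> y = y') ->
  forall y, y ∈ setof (fun y => exists x, x ∈ a /\ R x y) <->
            exists x, x ∈ a /\ R x y.
Proof.
  intros HR; apply mem_setof.
  destruct (cls_surj a) as [[A f] Ha]; subst a.
  pose (h := fun i : {i : A | exists y, R (cls (f i)) y} =>
    proj1_sig (constructive_indefinite_description _ (proj2_sig i))).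
  assert (Hh : forall i, R (cls (f (proj1_sig i))) (h i)).
  { intros i; exact (proj2_sig (constructive_indefinite_description _ (proj2_sig i))). }
  exists (setof (fun z => exists i, z = h i)); intros y; rewrite mem_setof_range; split.
  - intros [i Hi]; subst y; exists (cls (f (proj1_sig i))); split; auto.
    apply mem_sup; eauto.
  - intros (x & Hx & Hxy).
    assert (Hx' := Hx); apply mem_sup in Hx; destruct Hx as [i Hi]; subst x.
    pose (j := exist (fun i => exists y, R (cls (f i)) y) i (ex_intro _ y Hxy)).
    exists j; exact (HR _ _ _ Hx' Hxy (Hh j)).
Qed.

Lemma mem_setof_sub (a : set) (C : set -> Prop) :
  (forall z, C z -> z ∈ a) -> forall z, z ∈ setof C <-> C z.
Proof.
  intros H; apply mem_setof.
  exists (setof (fun y => exists x, x ∈ a /\ (x = y /\ C y))); intros z.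
  rewrite (mem_setof_image (a := a) (fun x y => x = y /\ C y)).
  - split; [intros (x & _ & _ & K); exact K | intros K; exists z; auto].
  - intros x y y' _ [E _] [E' _]; congruence.
Qed.

Lemma mem_setof_Pow (a : set) (C : set -> Prop) :
  (forall z, C z -> z ⊆ a) -> forall z, z ∈ setof C <-> C z.
Proof.
  intros H; apply mem_setof.
  destruct (cls_surj a) as [[A f] Ha]; subst a.
  pose (part := fun S : A -> Prop => sup (fun i : {i | S i} => f (proj1_sig i))).
  exists (cls (sup (fun S : {S | C (cls (part S))} => part (proj1_sig S)))).
  intros z; rewrite mem_sup; split.
  - intros [[S HS] E]; subst z; exact HS.
  - intros Hz.
    assert (E : z = cls (part (fun i => cls (f i) ∈ z))).
    { apply set_ext; intros y; unfold part; rewrite mem_sup; split.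
      - intros Hy; assert (K := H z Hz y Hy); apply mem_sup in K.
        destruct K as [i Hi]; subst y; exists (exist _ i Hy); reflexivity.
      - intros [[i Hi] K]; subst y; exact Hi. }
    rewrite E in Hz.
      exists (exist (fun S => C (cls (part S))) (fun i => cls (f i) ∈ z) Hz); exact E.
Qed.

(** ** Basic set constructions *)

Definition empty : set := setof (fun _ => False).
Definition pair (x y : set) : set := setof (fun z => z = x \/ z = y).
Definition op (x y : set) : set := pair (pair x x) (pair x y).
Definition bigcup (a : set) : set := setof (fun z => exists y, y ∈ a /\ z ∈ y).
Definition succ (x : set) : set := setof (fun z => z ∈ x \/ z = x).
Fixpoint num (n : nat) : set :=
  match n with O => empty | S m => succ (num m) end.
Definition omega : set := setof (fun z => exists n, z = num n).
Definition trcl (x : set) : set := setof (fun z => tc z x).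

(** The set function with domain [A] given by [F]; saying that it belongs to
    [V] is how a function on [A] is required to be in the model [V]. *)
Definition graph (A : set) (F : set -> set) : set :=
  setof (fun z => exists x, x ∈ A /\ z = op x (F x)).

Lemma mem_pair x y z : z ∈ pair x y <-> z = x \/ z = y.
Proof.
  unfold pair; apply mem_setof.
  exists (setof (fun z => exists b : bool, z = if b then x else y)); intros u.
  rewrite mem_setof_range; split.
  - intros [[|] E]; auto.
  - intros [E|E]; [exists true | exists false]; auto.
Qed.

Lemma mem_bigcup a z : z ∈ bigcup a <-> exists y, y ∈ a /\ z ∈ y.
Proof.
  unfold bigcup; apply mem_setof.
  destruct (cls_surj a) as [[A f] Ha]; subst a.
  pose (B := fun t : tree => match t with @sup B _ => B end).
  pose (br := fun t : tree => match t return B t -> tree with sup g => g end).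
  exists (cls (sup (fun i : {i : A & B (f i)} => br (f (projT1 i)) (projT2 i)))).
  intros u; rewrite mem_sup; split.
  - intros [[i b] E]; exists (cls (f i)); split; [apply mem_sup; eauto|].
    cbn in E; destruct (f i) as [C g] eqn:Ef; apply mem_sup; exists b; exact E.
  - intros (y & Hy & Hu); apply mem_sup in Hy; destruct Hy as [i Hi]; subst y.
    destruct (f i) as [C g] eqn:Ef; apply mem_sup in Hu; destruct Hu as [b E].
    assert (K : exists b : B (f i), u = cls (br (f i) b)).
    { rewrite Ef; exists b; exact E. }
    destruct K as [b' K]; exists (existT _ i b'); exact K.
Qed.

Lemma mem_op_l s p t : op s p ∈ t -> s ∈ bigcup (bigcup t).
Proof.
  intros H; apply mem_bigcup; exists (pair s s); split; [|apply mem_pair; auto].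
  apply mem_bigcup; exists (op s p); split; auto; apply mem_pair; auto.
Qed.

Lemma mem_succ x z : z ∈ succ x <-> z ∈ x \/ z = x.
Proof.
  unfold succ; apply mem_setof; exists (bigcup (pair x (pair x x))); intros u.
  rewrite mem_bigcup; split.
  - intros (y & Hy & Hu); apply mem_pair in Hy; destruct Hy; subst y; auto.
    apply mem_pair in Hu; tauto.
  - intros [H|H]; [exists x | exists (pair x x)]; rewrite ?mem_pair; auto.
Qed.

Lemma mem_omega z : z ∈ omega <-> exists n, z = num n.
Proof. apply mem_setof_range. Qed.

Lemma mem_graph A F z : z ∈ graph A F <-> exists x, x ∈ A /\ z = op x (F x).
Proof. apply (mem_setof_image (fun x z => z = op x (F x))); congruence. Qed.

Lemma mem_trcl x z : z ∈ trcl x <-> tc z x.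
Proof.
  revert z; induction x as [x IH] using (well_founded_ind mem_wf).
  unfold trcl; apply mem_setof.
  exists (bigcup (setof (fun w => exists y, y ∈ x /\
    w = bigcup (pair (trcl y) (pair y y))))).
  assert (K : forall y u, y ∈ x ->
    (u ∈ bigcup (pair (trcl y) (pair y y)) <-> tc u y \/ u = y)).
  { intros y u Hy; rewrite mem_bigcup; split.
    - intros (w & Hw & Hu); apply mem_pair in Hw; destruct Hw; subst w.
      + left; apply IH; auto.
      + apply mem_pair in Hu; tauto.
    - intros [H|H]; [exists (trcl y) | exists (pair y y)];
        rewrite ?mem_pair, ?(IH y Hy); auto. }
  intros u; rewrite mem_bigcup; split.
  - intros (w & Hw & Hu).
    apply (mem_setof_image (fun y w => w = bigcup (pair (trcl y) (pair y y)))) in Hw;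
      [|congruence].
    destruct Hw as (y & Hy & E); subst w; apply K in Hu; auto; destruct Hu as [Hu|Hu].
    + apply t_trans with y; auto; apply t_step; auto.
    + subst u; apply t_step; auto.
  - intros Hu; apply clos_trans_tn1 in Hu.
    assert (Hy : exists y, y ∈ x /\ (tc u y \/ u = y)).
    { destruct Hu as [Hu | y x Hy Hu]; [eauto|].
      exists y; split; auto; left; apply clos_tn1_trans; auto. }
    destruct Hy as (y & Hy & H); exists (bigcup (pair (trcl y) (pair y y))); split.
    + apply (mem_setof_image (fun y w => w = bigcup (pair (trcl y) (pair y y))));
        [congruence | eauto].
    + apply K; auto.
Qed.

Lemma tc_op {s p t} : op s p ∈ t -> tc s t.
Proof.
  intros H; apply t_trans with (op s p); [apply t_trans with (pair s s) |];
    apply t_step; auto; apply mem_pair; auto.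
Qed.

Definition ordinal (a : set) : Prop :=
  (forall x, x ∈ a -> x ⊆ a) /\
  (forall x, x ∈ a -> forall y, y ∈ x -> y ⊆ x).

Definition maps (f A B : set) : Prop :=
  (forall z, z ∈ f -> exists x y, (x ∈ A /\ y ∈ B) /\ z = op x y) /\
  (forall x, x ∈ A -> exists y, op x y ∈ f /\ forall y', op x y' ∈ f -> y' = y).

Definition injects (f A B : set) : Prop :=
  maps f A B /\
  forall x x' y, op x y ∈ f -> op x' y ∈ f -> x = x'.

(** * First-order formulas and transitive models of ZFC *)

(** Variables are de Bruijn indices. *)
Inductive fm : Type :=
  | Mem (i j : nat)
  | Eq (i j : nat)
  | Bot
  | Imp (a b : fm)
  | All (a : fm).

Definition scons (x : set) (e : nat -> set) (n : nat) : set :=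
  match n with O => x | S m => e m end.

Fixpoint sat (M : set -> Prop) (e : nat -> set) (a : fm) : Prop :=
  match a with
  | Mem i j => e i ∈ e j
  | Eq i j => e i = e j
  | Bot => False
  | Imp a b => sat M e a -> sat M e b
  | All a => forall x, M x -> sat M (scons x e) a
  end.

(** [Pow M a] is the power set of [a] as computed in [M]. *)
Definition Pow (M : set -> Prop) (a : set) : set :=
  setof (fun z => M z /\ z ⊆ a).

(** Extensionality and foundation hold in every transitive class.  Quantifiers
    bounded by an element of [M] need no relativization, by transitivity. *)
Record transitive_model (M : set -> Prop) : Prop := {
  tm_trans : forall x y, M x -> y ∈ x -> M y;
  tm_infinity : M omega;
  tm_pairing : forall x y, M x -> M y -> M (pair x y);
  tm_union : forall a, M a -> M (bigcup a);
  tm_power : forall a, M a -> M (Pow M a);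
  tm_separation : forall (phi : fm) (e : nat -> set) (a : set),
    (forall n, M (e n)) -> M a ->
    M (setof (fun x => x ∈ a /\ sat M (scons x e) phi));
  tm_replacement : forall (phi : fm) (e : nat -> set) (a : set),
    (forall n, M (e n)) -> M a ->
    (forall x, x ∈ a ->
       exists! y, M y /\ sat M (scons x (scons y e)) phi) ->
    exists b, M b /\
      forall x, x ∈ a -> exists y, y ∈ b /\ sat M (scons x (scons y e)) phi;
  tm_choice : forall a, M a ->
    (forall x, x ∈ a -> exists z, z ∈ x) ->
    (forall x y z, x ∈ a -> y ∈ a -> z ∈ x -> z ∈ y -> x = y) ->
    exists c, M c /\ forall x, x ∈ a -> exists! z, z ∈ x /\ z ∈ c
}.

(** * Cardinal notions, as computed in a model [M] *)

Definition card_le (M : set -> Prop) (A B : set) : Prop :=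
  exists f, M f /\ injects f A B.
Definition card_lt (M : set -> Prop) (A B : set) : Prop :=
  ~ card_le M B A.

Definition cardinal (M : set -> Prop) (k : set) : Prop :=
  M k /\ ordinal k /\ forall a, a ∈ k -> card_lt M a k.

Definition cofinal_map (M : set -> Prop) (b k : set) : Prop :=
  exists f, M f /\ maps f b k /\
    forall a, a ∈ k -> exists x y, op x y ∈ f /\ a ⊆ y.

(** [cof(k) = d] in [M]. *)
Definition cofinality (M : set -> Prop) (k d : set) : Prop :=
  M d /\ ordinal d /\ cofinal_map M d k /\
  forall b, b ∈ d -> ~ cofinal_map M b k.

Definition regular (M : set -> Prop) (k : set) : Prop :=
  cardinal M k /\ omega ⊆ k /\ cofinality M k k.

Definition strong_limit (M : set -> Prop) (k : set) : Prop :=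
  cardinal M k /\ forall a, a ∈ k -> card_lt M (Pow M a) k.

Definition inaccessible (M : set -> Prop) (k : set) : Prop :=
  omega ∈ k /\ regular M k /\ strong_limit M k.

(** [s = k^+] in [M], for an infinite cardinal [k]. *)
Definition succ_card (M : set -> Prop) (k s : set) : Prop :=
  M s /\ ordinal s /\ k ∈ s /\ card_lt M k s /\
  forall a, a ∈ s -> card_le M a k.

Definition in_H (M : set -> Prop) (l x : set) : Prop :=
  M x /\ card_lt M (trcl x) l.

Definition Sigma_sequence (V : set -> Prop) (ks : nat -> set) (k : set) : Prop :=
  V (setof (fun z => exists n, z = op (num n) (ks n))) /\
  (forall n, regular V (ks n) /\ omega ∈ ks n) /\
  (forall n, ks n ⊆ ks (S n)) /\
  (forall a, a ∈ k <-> exists n, a ∈ ks n) /\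
  strong_limit V k.

(** * Posets, generic filters, generic extensions *)

Record poset : Type := Poset { car : set; leq : set; one : set }.

Definition code (P : poset) : set := op (car P) (op (leq P) (one P)).
Definition le (P : poset) (p q : set) : Prop := op p q ∈ leq P.

Record is_poset (P : poset) : Prop := {
  po_dom : forall z, z ∈ leq P -> exists p q, p ∈ car P /\ q ∈ car P /\ z = op p q;
  po_refl : forall p, p ∈ car P -> le P p p;
  po_trans : forall p q r, le P p q -> le P q r -> le P p r;
  po_antisym : forall p q, le P p q -> le P q p -> p = q;
  po_one : one P ∈ car P;
  po_max : forall p, p ∈ car P -> le P p (one P)
}.

Record filter (P : poset) (G : set) : Prop := {
  fi_sub : G ⊆ car P;
  fi_one : one P ∈ G;
  fi_up : forall p q, p ∈ G -> le P p q -> q ∈ G;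
  fi_dir : forall p q, p ∈ G -> q ∈ G -> exists r, r ∈ G /\ le P r p /\ le P r q
}.

Definition dense (P : poset) (D : set) : Prop :=
  D ⊆ car P /\ forall p, p ∈ car P -> exists q, q ∈ D /\ le P q p.

Definition generic (V : set -> Prop) (P : poset) (G : set) : Prop :=
  filter P G /\ forall D, V D -> dense P D -> exists p, p ∈ G /\ p ∈ D.

(** The value of a name: [val G t = {val G s | exists p in G, (s,p) in t}], see
    [val_eq].  As every set is evaluated, every element of [V] serves as a name;
    elements of [t] not of the form [(s,p)] with [p] a condition are ignored. *)
Definition val (G : set) : set -> set :=
  Fix tc_wf (fun _ => set) (fun t rec =>
    setof (fun z => exists s p (h : tc s t), p ∈ G /\ op s p ∈ t /\ z = rec s h)).

Lemma val_eq G t :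
  val G t = setof (fun z => exists s p, p ∈ G /\ op s p ∈ t /\ z = val G s).
Proof.
  unfold val at 1; rewrite Fix_eq.
  - f_equal; apply functional_extensionality; intros z.
    apply propositional_extensionality; split.
    + intros (s & p & h & Hp & K & E); eauto 6.
    + intros (s & p & Hp & K & E); exists s, p, (tc_op K); auto.
  - intros x f g H.
    assert (E : f = g).
    { apply functional_extensionality_dep; intros y.
      apply functional_extensionality_dep; intros h; apply H. }
    rewrite E; reflexivity.
Qed.

Lemma mem_val G t z :
  z ∈ val G t <-> exists s p, p ∈ G /\ op s p ∈ t /\ z = val G s.
Proof.
  rewrite val_eq; apply mem_setof.
  exists (setof (fun z => exists s, s ∈ bigcup (bigcup t) /\
    (z = val G s /\ exists p, p ∈ G /\ op s p ∈ t))).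
  intros u.
  rewrite (mem_setof_image (fun s z => z = val G s /\ exists p, p ∈ G /\ op s p ∈ t)).
  - split.
    + intros (s & _ & E & p & Hp & K); exists s, p; auto.
    + intros (s & p & Hp & K & E); exists s; split; eauto using mem_op_l.
  - intros x y y' _ [E _] [E' _]; congruence.
Qed.

(** [V[G]] for a generic filter [G]. *)
Definition gen_ext (V : set -> Prop) (G : set) (y : set) : Prop :=
  exists t, V t /\ y = val G t.

(** [V[x]] for a set [x]: the least transitive model of ZFC that includes [V]
    and contains [x]. *)
Definition adjoin (V : set -> Prop) (x : set) (y : set) : Prop :=
  forall W : set -> Prop,
    transitive_model W -> (forall z, V z -> W z) -> W x -> W y.

(** * The forcing relation *)

(** [feq P s t p] is [p ||- s = t]; see [feq_eq] for the recursion. *)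
Definition feq (P : poset) : set -> set -> set -> Prop :=
  Fix tc_wf (fun _ => set -> set -> Prop) (fun s rec t p =>
    (forall s' a (h : tc s' s), op s' a ∈ s ->
       forall q, le P q p -> le P q a ->
       exists r t' b, le P r q /\ op t' b ∈ t /\ le P r b /\ rec s' h t' r) /\
    (forall t' b, op t' b ∈ t ->
       forall q, le P q p -> le P q b ->
       exists r s' a (h : tc s' s),
         le P r q /\ op s' a ∈ s /\ le P r a /\ rec s' h t' r)).

Lemma feq_eq P s t p :
  feq P s t p <->
    (forall s' a, op s' a ∈ s ->
       forall q, le P q p -> le P q a ->
       exists r t' b, le P r q /\ op t' b ∈ t /\ le P r b /\ feq P s' t' r) /\
    (forall t' b, op t' b ∈ t ->
       forall q, le P q p -> le P q b ->
       exists r s' a, le P r q /\ op s' a ∈ s /\ le P r a /\ feq P s' t' r).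
Proof.
  unfold feq at 1; rewrite Fix_eq.
  - fold (feq P); split; intros [H1 H2]; split.
    + intros s' a Ha; exact (H1 s' a (tc_op Ha) Ha).
    + intros t' b Hb q Hq Hqb.
      destruct (H2 t' b Hb q Hq Hqb) as (r & s' & a & h & K); eauto.
    + intros s' a h Ha; exact (H1 s' a Ha).
    + intros t' b Hb q Hq Hqb.
      destruct (H2 t' b Hb q Hq Hqb) as (r & s' & a & K1 & K2 & K3).
      exists r, s', a, (tc_op K2); auto.
  - intros x f g H.
    assert (E : f = g).
    { apply functional_extensionality_dep; intros y.
      apply functional_extensionality_dep; intros h; apply H. }
    rewrite E; reflexivity.
Qed.

(** [forces V P e a p] is [p ||- a], over [V], for the names assigned to the
    free variables by [e]. *)
Fixpoint forces (V : set -> Prop) (P : poset) (e : nat -> set) (a : fm)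
    (p : set) : Prop :=
  match a with
  | Mem i j => forall q, le P q p -> exists r t b,
      le P r q /\ op t b ∈ e j /\ le P r b /\ feq P (e i) t r
  | Eq i j => feq P (e i) (e j) p
  | Bot => False
  | Imp a b => forall q, le P q p -> forces V P e a q -> forces V P e b q
  | All a => forall t, V t -> forces V P (scons t e) a p
  end.

Definition check (P : poset) : set -> set :=
  Fix tc_wf (fun _ => set) (fun x rec =>
    setof (fun z => exists y (h : tc y x), y ∈ x /\ z = op (rec y h) (one P))).

Lemma check_eq P x :
  check P x = setof (fun z => exists y, y ∈ x /\ z = op (check P y) (one P)).
Proof.
  unfold check at 1; rewrite Fix_eq.
  - fold (check P); f_equal; apply functional_extensionality; intros z.
    apply propositional_extensionality; split.
    + intros (y & h & K); eauto.
    + intros (y & Hy & E); exists y, (t_step _ _ _ _ Hy); auto.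
  - intros y f g H.
    assert (E : f = g).
    { apply functional_extensionality_dep; intros z.
      apply functional_extensionality_dep; intros h; apply H. }
    rewrite E; reflexivity.
Qed.

Lemma mem_check P x z :
  z ∈ check P x <-> exists y, y ∈ x /\ z = op (check P y) (one P).
Proof.
  rewrite check_eq.
  apply (mem_setof_image (fun y z => z = op (check P y) (one P))); congruence.
Qed.

(** ** The formula expressing [s = k^+] *)

Definition Not a := Imp a Bot.
Definition And a b := Not (Imp a (Not b)).
Definition Or a b := Imp (Not a) b.
Definition Iff a b := And (Imp a b) (Imp b a).
Definition Ex a := Not (All (Not a)).

Definition fm_pair z x y :=
  All (Iff (Mem 0 (S z)) (Or (Eq 0 (S x)) (Eq 0 (S y)))).
Definition fm_op z x y :=
  Ex (Ex (And (fm_pair 1 (2 + x) (2 + x))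
         (And (fm_pair 0 (2 + x) (2 + y)) (fm_pair (2 + z) 1 0)))).
Definition fm_app f x y := Ex (And (Mem 0 (S f)) (fm_op 0 (S x) (S y))).
Definition fm_maps f a b :=
  And (All (Imp (Mem 0 (S f))
         (Ex (Ex (And (And (Mem 1 (3 + a)) (Mem 0 (3 + b))) (fm_op 2 1 0))))))
      (All (Imp (Mem 0 (S a))
         (Ex (And (fm_app (2 + f) 1 0)
                  (All (Imp (fm_app (3 + f) 2 0) (Eq 0 1))))))).
Definition fm_injects f a b :=
  And (fm_maps f a b)
      (All (All (All (Imp (fm_app (3 + f) 2 0)
                     (Imp (fm_app (3 + f) 1 0) (Eq 2 1)))))).
Definition fm_card_le a b := Ex (fm_injects 0 (S a) (S b)).

Definition fm_succ_card k s :=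
  And (Mem k s) (And (Not (fm_card_le s k))
      (All (Imp (Mem 0 (S s)) (fm_card_le 0 (S k))))).

Lemma sat_And M e a b : sat M e (And a b) <-> sat M e a /\ sat M e b.
Proof.
  cbn; destruct (classic (sat M e a)), (classic (sat M e b)); tauto.
Qed.

Lemma sat_Or M e a b : sat M e (Or a b) <-> sat M e a \/ sat M e b.
Proof. cbn; destruct (classic (sat M e a)); tauto. Qed.

Lemma sat_Ex M e a : sat M e (Ex a) <-> exists x, M x /\ sat M (scons x e) a.
Proof.
  cbn; split.
  - intros H; apply NNPP; intros K; apply H; intros x Hx Ha; eauto.
  - intros (x & Hx & Ha) K; exact (K x Hx Ha).
Qed.

Lemma sat_pair M (HM : transitive_model M) e z x y : M (e z) -> M (e x) -> M (e y) ->
  (sat M e (fm_pair z x y) <-> e z = pair (e x) (e y)).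
Proof.
  intros Hz Hx Hy; unfold fm_pair, Iff; split.
  - intros H; apply set_ext; intros w; rewrite mem_pair; split.
    + intros Hw; assert (Mw := tm_trans HM Hz Hw).
      specialize (H w Mw); apply sat_And in H; destruct H as [H _].
      apply H, sat_Or in Hw; exact Hw.
    + intros Hw; assert (Mw : M w) by (destruct Hw; subst w; auto).
      specialize (H w Mw); apply sat_And in H; destruct H as [_ H].
      apply H, sat_Or; exact Hw.
  - intros E w Mw; apply sat_And; split.
    + intros Hw; rewrite sat_Or; cbn [sat scons]; rewrite <- mem_pair, <- E; exact Hw.
    + intros Hw; rewrite sat_Or in Hw; cbn [sat scons] in Hw |- *.
      rewrite E; apply mem_pair; exact Hw.
Qed.

Lemma sat_op M (HM : transitive_model M) e z x y : M (e z) -> M (e x) -> M (e y) ->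
  (sat M e (fm_op z x y) <-> e z = op (e x) (e y)).
Proof.
  intros Hz Hx Hy; unfold fm_op; rewrite sat_Ex; assert (TP := tm_pairing HM); split.
  - intros (u & Hu & H); apply sat_Ex in H; destruct H as (v & Hv & H).
    rewrite !sat_And, !sat_pair in H by assumption; cbn in H.
    destruct H as (-> & -> & ->); reflexivity.
  - intros E; exists (pair (e x) (e x)); split; [apply HM; auto|].
    apply sat_Ex; exists (pair (e x) (e y)); split; [apply HM; auto|].
    rewrite !sat_And, !sat_pair by (cbn; auto).
    cbn; auto.
Qed.

Lemma sat_app M (HM : transitive_model M) e f x y : M (e f) -> M (e x) -> M (e y) ->
  (sat M e (fm_app f x y) <-> op (e x) (e y) ∈ e f).
Proof.
  intros Hf Hx Hy; unfold fm_app; rewrite sat_Ex; split.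
  - intros (z & Hz & H); rewrite sat_And, sat_op in H by assumption.
    cbn in H; destruct H as [H ->]; exact H.
  - intros H; assert (K := tm_trans HM Hf H); exists (op (e x) (e y)); split; auto.
    rewrite sat_And, sat_op by assumption; split; [exact H | reflexivity].
Qed.

Lemma sat_maps M (HM : transitive_model M) e f a b : M (e f) -> M (e a) -> M (e b) ->
  (sat M e (fm_maps f a b) <-> maps (e f) (e a) (e b)).
Proof.
  intros Hf Ha Hb; unfold fm_maps, maps; rewrite sat_And.
  assert (T := tm_trans HM).
  assert (P : forall x y, op x y ∈ e f -> M y).
  { intros x y K.
    apply T with (pair x y); [|apply mem_pair; auto].
    apply T with (op x y); [eauto | apply mem_pair; auto]. }
  split; intros [H1 H2]; split.
  - intros z Hz; specialize (H1 z (T _ _ Hf Hz) Hz).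
    apply sat_Ex in H1; destruct H1 as (x & Hx & H1).
    apply sat_Ex in H1; destruct H1 as (y & Hy & H1).
    rewrite !sat_And, sat_op in H1 by (cbn; eauto).
    exists x, y; exact H1.
  - intros x Hx; specialize (H2 x (T _ _ Ha Hx) Hx).
    apply sat_Ex in H2; destruct H2 as (y & Hy & H2).
    rewrite sat_And, sat_app in H2 by (cbn; eauto).
    exists y; split; [apply H2|]; intros y' Hy'.
    apply (proj2 H2 y' (P _ _ Hy')), sat_app; cbn; eauto.
  - intros z Mz Hz; destruct (H1 z Hz) as (x & y & [Hx Hy] & E).
    apply sat_Ex; exists x; split; [eauto|].
    apply sat_Ex; exists y; split; [eauto|].
    rewrite !sat_And, sat_op by (cbn; eauto); cbn; auto.
  - intros x Mx Hx; destruct (H2 x Hx) as (y & Hy & K).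
    apply sat_Ex; exists y; split; [eauto|].
    rewrite sat_And, sat_app by (cbn; eauto); split; [exact Hy|].
    intros y' My' Hy'; apply sat_app in Hy'; [exact (K y' Hy') | cbn; eauto ..].
Qed.

Lemma sat_card_le M (HM : transitive_model M) e a b : M (e a) -> M (e b) ->
  (sat M e (fm_card_le a b) <-> card_le M (e a) (e b)).
Proof.
  intros Ha Hb; unfold fm_card_le, card_le; rewrite sat_Ex.
  assert (T := tm_trans HM).
  split; intros (f & Hf & H); exists f; (split; [assumption|]);
    unfold fm_injects in *; rewrite sat_And, sat_maps in * by assumption;
    destruct H as [H K]; split; try exact H.
  - intros x x' y H1 H2.
    assert (P : forall u v, op u v ∈ f -> M u /\ M v).
    { intros u v L; split; (apply T with (pair u v); [|apply mem_pair; auto]);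
        (apply T with (op u v); [eauto | apply mem_pair; auto]). }
    destruct (P x y H1), (P x' y H2).
    apply (fun a b c => K x a x' b y c); auto; apply sat_app; cbn; auto.
  - intros x Mx x' Mx' y My H1 H2.
    apply sat_app in H1; [| cbn; auto ..]; apply sat_app in H2; [| cbn; auto ..].
    exact (K _ _ _ H1 H2).
Qed.

Lemma sat_succ_card M (HM : transitive_model M) e k s : M (e k) -> M (e s) -> ordinal (e s) ->
  (sat M e (fm_succ_card k s) <-> succ_card M (e k) (e s)).
Proof.
  intros Hk Hs Ho; unfold fm_succ_card, succ_card, card_lt.
  rewrite !sat_And; cbn [sat Not]; rewrite sat_card_le by assumption.
  assert (E : (forall x, M x -> x ∈ e s ->
                 sat M (scons x e) (fm_card_le 0 (S k))) <->
              (forall x, x ∈ e s -> card_le M x (e k))).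
  { split; intros H x.
    - intros Hx; assert (Mx := tm_trans HM Hs Hx).
      apply (sat_card_le HM (scons x e) 0 (S k)); auto.
    - intros Mx Hx; apply sat_card_le; cbn; auto. }
  cbn in E |- *; tauto.
Qed.

(** [p ||- check s = (check k)^+]; [check k] and [check s] are names for ordinals
    whenever [k] and [s] are ordinals. *)
Definition forces_succ_card (V : set -> Prop) (P : poset) (k s p : set) : Prop :=
  forces V P (scons (check P k) (scons (check P s) (fun _ => empty)))
    (fm_succ_card 0 1) p.

(** * Sigma-Prikry forcing *)

Definition compatible (P : poset) (p q : set) : Prop :=
  exists r, le P r p /\ le P r q.

Definition greatest (P : poset) (A : set -> Prop) (r : set) : Prop :=
  A r /\ forall s, A s -> le P s r.

(** [r = w(p,q)]. *)
Definition is_w (P : poset) (l : set -> nat) (p q r : set) : Prop :=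
  greatest P (fun r => le P r p /\ le P q r /\ l r = l q) r.

Definition W (P : poset) (l : set -> nat) (p : set) : set :=
  setof (fun r => exists q, le P q p /\ is_w P l p q r).

Record Sigma_Prikry_with (V : set -> Prop) (ks : nat -> set) (k : set)
    (P : poset) (l : set -> nat) (mu : set) (c : set -> set) : Prop := {
  sp_l_in : V (graph (car P) (fun p => num (l p)));
  sp_l_surj : forall n, exists p, p ∈ car P /\ l p = n;
  sp_mu : cardinal V mu;
  sp_c_in : V (graph (car P) c);
  sp_c : forall p, p ∈ car P -> c p ∈ mu;
  sp_1 : forall p q, le P q p -> l p <= l q;
  sp_2 : forall p, p ∈ car P -> exists q, le P q p /\ l q = S (l p);
  sp_3 : forall n L, V L -> L ⊆ car P ->
    (forall p q, p ∈ L -> q ∈ L -> compatible P p q) ->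
    card_lt V L (ks n) -> (forall p, p ∈ L -> l p = n) ->
    exists r, r ∈ car P /\ l r = n /\ forall p, p ∈ L -> le P r p;
  sp_4 : forces_succ_card V P k mu (one P);
  sp_5 : forall p q, p ∈ car P -> q ∈ car P -> c p = c q ->
    exists r, le P r p /\ le P r q /\ l r = l p /\ l r = l q;
  sp_6 : forall p q n m, le P q p -> l q = l p + n + m ->
    exists r, greatest P (fun r => le P r p /\ le P q r /\ l r = l p + n) r;
  sp_7 : forall p, p ∈ car P -> card_lt V (W P l p) mu;
  sp_8 : forall p p' q q' r r', le P p' p ->
    q ∈ W P l p' -> q' ∈ W P l p' -> le P q q' ->
    is_w P l p q r -> is_w P l p q' r' -> le P r r';
  sp_9 : forall U, V U -> U ⊆ car P ->
    (forall r q, r ∈ U -> le P q r -> l q = l r -> q ∈ U) ->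
    forall p n, p ∈ car P ->
    exists q, le P q p /\ l q = l p /\
      ((forall r, le P r q -> l r = l q + n -> r ∈ U) \/
       (forall r, le P r q -> l r = l q + n -> ~ r ∈ U))
}.

Definition Sigma_Prikry (V : set -> Prop) (ks : nat -> set) (k : set)
    (P : poset) : Prop :=
  is_poset P /\ V (code P) /\ exists l mu c, Sigma_Prikry_with V ks k P l mu c.

(** * Solovay models *)

(** [kappa_Solovay V ks k M]: [L(V_{k+1})^M] is a [k]-Solovay model over [V].
    The definition only speaks about [V], [M] and [k]. *)
Definition kappa_Solovay (V : set -> Prop) (ks : nat -> set) (k : set)
    (M : set -> Prop) : Prop :=
  transitive_model V /\ transitive_model M /\ (forall z, V z -> M z) /\
  (exists s, succ_card M k s /\
     forall x, M x -> x ⊆ k -> inaccessible (adjoin V x) s) /\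
  (forall x, M x -> x ⊆ k ->
     exists (P : poset) (g : set),
       Sigma_Prikry V ks k P /\ card_le M (car P) k /\
       M g /\ generic V P g /\
       (forall y, adjoin V x y -> gen_ext V g y) /\
       cofinality (gen_ext V g) k omega).

(** * Weak systems *)

Definition weak_projection (P Q : poset) (pi : set -> set) : Prop :=
  (forall p, p ∈ car P -> pi p ∈ car Q) /\
  (forall p p', le P p p' -> le Q (pi p) (pi p')) /\
  forall p, p ∈ car P -> exists p', le P p' p /\
    forall q, le Q q (pi p') -> exists p'', le P p'' p /\ le Q (pi p'') q.

(** The upward closure of the image of [G]. *)
Definition push (Q : poset) (pi : set -> set) (G : set) : set :=
  setof (fun q => q ∈ car Q /\ exists p, p ∈ G /\ le Q (pi p) q).

(** A posetal category is given by its set [ob] of objects and the relation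
    [arr d e], existence of an arrow from [d] to [e]. *)
Record weak_system : Type := {
  ob : set;
  arr : set -> set -> Prop;
  po : set -> poset;
  pt : set -> set;
  pr : set -> set -> set -> set;
  po_inf : poset;
  pt_inf : set;
  pr_inf : set -> set -> set
}.

Record is_category (S : weak_system) : Prop := {
  cat_ob : forall d e, arr S d e -> d ∈ ob S /\ e ∈ ob S;
  cat_id : forall d, d ∈ ob S -> arr S d d;
  cat_comp : forall d e f, arr S d e -> arr S e f -> arr S d f;
  cat_inhabited : exists d, d ∈ ob S;
  cat_directed : forall d e, d ∈ ob S -> e ∈ ob S ->
    exists f, arr S f d /\ arr S f e
}.

Record in_model (V : set -> Prop) (S : weak_system) : Prop := {
  in_ob : V (ob S);
  in_arr : V (setof (fun z => exists d e, arr S d e /\ z = op d e));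
  in_po : V (graph (ob S) (fun d => code (po S d)));
  in_pt : V (graph (ob S) (pt S));
  in_pr : V (setof (fun z => exists d e,
    arr S d e /\ z = op (op d e) (graph (car (po S d)) (pr S d e))));
  in_po_inf : V (code (po_inf S));
  in_pr_inf : V (graph (ob S) (fun d => graph (car (po_inf S)) (pr_inf S d)))
}.

Record is_weak_system (V : set -> Prop) (S : weak_system) : Prop := {
  ws_in : in_model V S;
  ws_cat : is_category S;
  ws_po : forall d, d ∈ ob S -> is_poset (po S d);
  ws_pt : forall d, d ∈ ob S -> pt S d ∈ car (po S d);
  ws_pr : forall d e, arr S d e -> weak_projection (po S d) (po S e) (pr S d e);
  ws_pr_pt : forall d e, arr S d e -> pr S d e (pt S d) = pt S e;
  ws_pr_id : forall d p, d ∈ ob S -> p ∈ car (po S d) -> pr S d d p = p;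
  ws_pr_comp : forall d e f p, arr S d e -> arr S e f -> p ∈ car (po S d) ->
    pr S e f (pr S d e p) = pr S d f p;
  ws_po_inf : is_poset (po_inf S);
  ws_pt_inf : pt_inf S ∈ car (po_inf S);
  ws_pr_inf : forall d, d ∈ ob S ->
    weak_projection (po_inf S) (po S d) (pr_inf S d);
  ws_pr_inf_pt : forall d, d ∈ ob S -> pr_inf S d (pt_inf S) = pt S d;
  ws_pr_inf_comp : forall d e p, arr S d e -> p ∈ car (po_inf S) ->
    pr S d e (pr_inf S d p) = pr_inf S e p
}.

Definition weak_Sigma_system (V : set -> Prop) (ks : nat -> set) (k : set)
    (S : weak_system) : Prop :=
  is_weak_system V S /\ Sigma_Prikry V ks k (po_inf S) /\
  forall d, d ∈ ob S -> Sigma_Prikry V ks k (po S d).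

Definition capturing (V : set -> Prop) (k : set) (S : weak_system) : Prop :=
  forall G, generic V (po_inf S) G ->
  forall x, gen_ext V G x -> x ⊆ k ->
  forall d, d ∈ ob S ->
  exists e, arr S e d /\ gen_ext V (push (po S e) (pr_inf S e) G) x.

Definition bounded (V : set -> Prop) (l : set) (S : weak_system) : Prop :=
  forall d, d ∈ ob S -> in_H V l (code (po S d)).

Definition amenable (V : set -> Prop) (k l : set) (S : weak_system) : Prop :=
  forall G, generic V (po_inf S) G ->
  succ_card (gen_ext V G) k l /\ cofinality (gen_ext V G) k omega.

Definition nice (V : set -> Prop) (k l : set) (S : weak_system) : Prop :=
  capturing V k S /\ bounded V l S /\ amenable V k l S.

(* Main.v *)
(** [V[G]] is a model of ZFC by the forcing theorem.  Every [x ⊆ kappa] of [V[G]]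
    lies in some [V[g]], where [g] is the projection of [G] to some [P_e].  As
    [P_e] has size less than [lambda], a relation of [V[g]] that is a function from
    a set of [V] of size less than [lambda] to [lambda] is covered by a relation of [V]
    on a set of that size, so it is bounded.  Hence [lambda] remains regular and, by
    nice names for subsets, strong limit in [V[g]]; these properties go down to
    [V[x]].  Since [lambda = kappa^+] in [V[G]], [P_e] has size at most [kappa] there.
    Finally, the records of a cofinal [f : omega -> kappa] of [V[G]] form a
    subset of [kappa] of order type [omega], which is captured as well; decreasing [e],
    one [V[g]] contains both this set and [x], so it sees [cof(kappa) = omega]. *)

From Stdlib Require Import Classical ClassicalEpsilon FunctionalExtensionality
  PropExtensionality Wellfounded Relations PeanoNat Lia.
Require Import Defs.

Set Implicit Arguments.

(** Two obstacles shape the proof. The axioms of a model are schemas over coded formulas, while the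
    forcing argument applies separation and replacement to concrete relations all the time.
    Definability is therefore treated semantically, by the predicate [Def]; formulas reappear only
    at the interface with the axioms and in the induction for the forcing theorem.

    The class [adjoin V x] is an intersection of models and is not shown to be a model.
    Inaccessibility of [lambda] is proved instead for every class between [V] and [V[g]]: apart from
    facts already witnessed in [V], such as the identity map, it denies that certain maps exist in
    the class, and such denials pass down from [V[g]].

    Capturing concerns subsets of [kappa], and a cofinal map is not one. Its set of records is,
    without any coding of pairs, and from this set alone a model recovers a cofinal map of length
    [omega] by enumerating it increasingly. *)

Lemma setof_ext (C D : set -> Prop) :
  (forall z, C z <-> D z) -> setof C = setof D.
Proof.
  intros H; f_equal; apply functional_extensionality; intros z.
  apply propositional_extensionality, H.
Qed.

Lemma pair_inj x y x' y' : pair x y = pair x' y' ->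
  (x = x' /\ y = y') \/ (x = y' /\ y = x').
Proof.
  intros E.
  assert (H : forall z, (z = x \/ z = y) <-> (z = x' \/ z = y')).
  { intros z; rewrite <- !mem_pair, E; tauto. }
  assert (H1 := proj1 (H x) (or_introl eq_refl)).
  assert (H2 := proj1 (H y) (or_intror eq_refl)).
  assert (H3 := proj2 (H x') (or_introl eq_refl)).
  assert (H4 := proj2 (H y') (or_intror eq_refl)).
  destruct H1, H2, H3, H4; subst; auto.
Qed.

Lemma op_inj x y x' y' : op x y = op x' y' -> x = x' /\ y = y'.
Proof.
  intros E; apply pair_inj in E; destruct E as [[E1 E2]|[E1 E2]];
    apply pair_inj in E1; apply pair_inj in E2;
    destruct E1 as [[]|[]], E2 as [[]|[]]; subst; auto.
Qed.

Lemma empty_spec z : ~ z ∈ empty.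
Proof.
  intros H; apply (mem_setof_sub (a := omega) (fun _ => False)) in H; tauto.
Qed.

Lemma mem_irrefl x : ~ x ∈ x.
Proof.
  induction x as [x IH] using (well_founded_ind mem_wf); intros H; exact (IH x H H).
Qed.

Lemma mem_asym x y : x ∈ y -> ~ y ∈ x.
Proof.
  revert y; induction x as [x IH] using (well_founded_ind mem_wf); intros y H K.
  exact (IH y K x K H).
Qed.

Lemma op_l_tc s p : tc s (op s p).
Proof. apply t_trans with (pair s s); apply t_step; apply mem_pair; auto. Qed.

(** * Relations and functions as sets *)

Definition prod (A B : set) : set :=
  bigcup (setof (fun w => exists x, x ∈ A /\
    w = setof (fun z => exists y, y ∈ B /\ z = op x y))).

Lemma mem_prod A B z :
  z ∈ prod A B <-> exists x y, x ∈ A /\ y ∈ B /\ z = op x y.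
Proof.
  unfold prod; rewrite mem_bigcup; split.
  - intros (w & Hw & Hz).
    apply (mem_setof_image (fun x w => w = setof (fun z => exists y, y ∈ B /\ z = op x y)))
      in Hw; [|congruence].
    destruct Hw as (x & Hx & ->).
    apply (mem_setof_image (fun y z => z = op x y)) in Hz; [|congruence].
    destruct Hz as (y & Hy & ->); eauto.
  - intros (x & y & Hx & Hy & ->).
    exists (setof (fun z => exists y, y ∈ B /\ z = op x y)); split.
    + apply (mem_setof_image (fun x w => w = setof (fun z => exists y, y ∈ B /\ z = op x y)));
        [congruence | eauto].
    + apply (mem_setof_image (fun y z => z = op x y)); [congruence | eauto].
Qed.

(** The common shape of sets built inside a model: names, tables of forced statements and graphs of
    partial maps are written this way, so that the single lemma [DefF_rel] shows that they belong to
    the model. *)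
Definition rel (A B : set) (Q : set -> set -> Prop) : set :=
  setof (fun z => z ∈ prod A B /\ exists x y, z = op x y /\ Q x y).

Lemma mem_rel A B Q z :
  z ∈ rel A B Q <-> exists x y, x ∈ A /\ y ∈ B /\ Q x y /\ z = op x y.
Proof.
  unfold rel; rewrite (mem_setof_sub (a := prod A B)) by tauto.
  rewrite mem_prod; split.
  - intros [(x & y & Hx & Hy & E) (x' & y' & E' & K)].
    assert (E0 := E); rewrite E' in E; apply op_inj in E; destruct E; subst x' y'.
    exists x, y; auto.
  - intros (x & y & Hx & Hy & K & E); split; exists x, y; auto.
Qed.

Lemma op_rel A B Q x y : op x y ∈ rel A B Q <-> x ∈ A /\ y ∈ B /\ Q x y.
Proof.
  rewrite mem_rel; split.
  - intros (x' & y' & Hx & Hy & K & E); apply op_inj in E; destruct E; subst; auto.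
  - intros (Hx & Hy & K); exists x, y; auto.
Qed.

Lemma op_graph A F x y : op x y ∈ graph A F <-> x ∈ A /\ y = F x.
Proof.
  rewrite mem_graph; split.
  - intros (x' & Hx & E); apply op_inj in E; destruct E; subst; auto.
  - intros [Hx E]; subst; eauto.
Qed.

Definition sep (a : set) (C : set -> Prop) : set := setof (fun x => x ∈ a /\ C x).

Lemma mem_sep a C z : z ∈ sep a C <-> z ∈ a /\ C z.
Proof. apply (mem_setof_sub (a := a)); tauto. Qed.

Definition image (a : set) (F : set -> set) : set :=
  setof (fun y => exists x, x ∈ a /\ y = F x).

Lemma mem_image a F y : y ∈ image a F <-> exists x, x ∈ a /\ y = F x.
Proof. apply (mem_setof_image (fun x y => y = F x)); congruence. Qed.

Definition union (x y : set) : set := bigcup (pair x y).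

Lemma mem_union x y z : z ∈ union x y <-> z ∈ x \/ z ∈ y.
Proof.
  unfold union; rewrite mem_bigcup; split.
  - intros (w & Hw & Hz); apply mem_pair in Hw; destruct Hw; subst; auto.
  - intros [H|H]; [exists x | exists y]; rewrite mem_pair; auto.
Qed.

Lemma mem_Pow M a z : z ∈ Pow M a <-> M z /\ z ⊆ a.
Proof. apply (mem_setof_Pow (a := a)); tauto. Qed.

(** * Definability without syntax *)

(** Each coordinate of [E e] is an entry of [e] or a fixed element of [M]:
    this is how a formula gets its variables renamed and its parameters filled in. *)
Definition simple (M : set -> Prop) (E : (nat -> set) -> nat -> set) : Prop :=
  forall n, (exists i, forall e, E e n = e i) \/ (exists c, M c /\ forall e, E e n = c).

Definition env (M : set -> Prop) (e : nat -> set) : Prop := forall n, M (e n).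

(** [Def M R]: the relation [R] on environments of [M] is definable over [M] with
    parameters.  A quantified variable is [e 0] and the outer environment is then
    shifted, so de Bruijn indices are computed by beta reduction. *)
Definition Def (M : set -> Prop) (R : (nat -> set) -> Prop) : Prop :=
  exists phi E, simple M E /\ forall e, env M e -> (R e <-> sat M (E e) phi).

Lemma env_scons M x e : M x -> env M e -> env M (scons x e).
Proof. intros Hx He [|n]; cbn; auto. Qed.

Lemma env_simple M E e : simple M E -> env M e -> env M (E e).
Proof.
  intros HE He n; destruct (HE n) as [[i H]|[c [Hc H]]]; rewrite H; auto.
Qed.

Fixpoint ren (r : nat -> nat) (a : fm) : fm :=
  match a with
  | Mem i j => Mem (r i) (r j)
  | Eq i j => Eq (r i) (r j)
  | Bot => Bot
  | Imp a b => Imp (ren r a) (ren r b)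
  | All a => All (ren (fun n => match n with O => O | S m => S (r m) end) a)
  end.

Lemma sat_ren M a r e : sat M e (ren r a) <-> sat M (fun n => e (r n)) a.
Proof.
  revert r e; induction a as [i j|i j| |a IHa b IHb|a IHa]; intros r e; cbn; try tauto.
  - rewrite IHa, IHb; tauto.
  - assert (E : forall x, (fun n => scons x e (match n with O => O | S m => S (r m) end))
                          = scons x (fun n => e (r n))).
    { intros x; apply functional_extensionality; intros [|n]; reflexivity. }
    split; intros H x Hx; specialize (H x Hx).
    + apply IHa in H; cbv beta in H; rewrite E in H; exact H.
    + apply IHa; cbv beta; rewrite E; exact H.
Qed.

Section Definability.
Variable M : set -> Prop.

Lemma Def_ext R R' : (forall e, env M e -> (R e <-> R' e)) -> Def M R -> Def M R'.
Proof.
  intros H (phi & E & HE & K); exists phi, E; split; auto.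
  intros e He; rewrite <- H, K by auto; tauto.
Qed.

Lemma Def_simple R E : simple M E -> Def M R -> Def M (fun e => R (E e)).
Proof.
  intros HE (phi & E' & HE' & K); exists phi, (fun e => E' (E e)); split.
  - intros n; destruct (HE' n) as [[i Hi]|[c [Hc Hi]]].
    + destruct (HE i) as [[j Hj]|[c [Hc Hj]]]; [left; exists j | right; exists c];
        intros; try split; intros; rewrite ?Hi, ?Hj; auto.
    + right; exists c; auto.
  - intros e He; apply K, env_simple; auto.
Qed.

Lemma Def_fm phi : Def M (fun e => sat M e phi).
Proof.
  exists phi, (fun e => e); split; [intros n; left; eauto | tauto].
Qed.

(** Two definitions bring two unrelated environments. Interleaving them at even and odd places lets
    one formula read both, which is how implication, and with it every connective, is handled. *)
Definition mix {A} (f g : nat -> A) (n : nat) : A :=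
  if Nat.even n then f (Nat.div2 n) else g (Nat.div2 n).

Lemma mix_even A (f g : nat -> A) n : mix f g (2 * n) = f n.
Proof.
  unfold mix; rewrite Nat.even_mul; cbn [Nat.even orb]; rewrite Nat.div2_double; auto.
Qed.

Lemma mix_odd A (f g : nat -> A) n : mix f g (S (2 * n)) = g n.
Proof.
  unfold mix; rewrite Nat.even_succ, Nat.odd_mul; cbn [Nat.odd Nat.even negb andb].
  rewrite Nat.div2_succ_double; auto.
Qed.

Lemma simple_mix E E' : simple M E -> simple M E' -> simple M (fun e => mix (E e) (E' e)).
Proof. intros H H' n; unfold mix; destruct (Nat.even n); auto. Qed.

Lemma sat_mix (E E' : (nat -> set) -> nat -> set) phi psi e :
  (sat M (mix (E e) (E' e)) (ren (fun n => 2 * n) phi) <-> sat M (E e) phi) /\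
  (sat M (mix (E e) (E' e)) (ren (fun n => S (2 * n)) psi) <-> sat M (E' e) psi).
Proof.
  rewrite !sat_ren.
  assert (A1 : (fun n => mix (E e) (E' e) (2 * n)) = E e).
  { apply functional_extensionality; intros n; apply mix_even. }
  assert (A2 : (fun n => mix (E e) (E' e) (S (2 * n))) = E' e).
  { apply functional_extensionality; intros n; apply mix_odd. }
  rewrite A1, A2; tauto.
Qed.

Lemma Def_imp R R' : Def M R -> Def M R' -> Def M (fun e => R e -> R' e).
Proof.
  intros (phi & E & HE & K) (psi & E' & HE' & K').
  exists (Imp (ren (fun n => 2 * n) phi) (ren (fun n => S (2 * n)) psi)),
    (fun e => mix (E e) (E' e)); split; [apply simple_mix; auto|].
  intros e He; cbn [sat].
  destruct (sat_mix E E' phi psi e) as [A1 A2]; rewrite A1, A2, K, K' by auto; tauto.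
Qed.

Lemma Def_False : Def M (fun _ => False).
Proof. exact (Def_fm Bot). Qed.

Lemma Def_True : Def M (fun _ => True).
Proof. apply Def_ext with (fun _ => False -> False); [tauto | apply Def_imp; apply Def_False]. Qed.

Lemma Def_not R : Def M R -> Def M (fun e => ~ R e).
Proof. intros H; apply Def_imp; auto using Def_False. Qed.

Lemma Def_and R R' : Def M R -> Def M R' -> Def M (fun e => R e /\ R' e).
Proof.
  intros H H'; apply Def_ext with (fun e => ~ (R e -> ~ R' e)); [intros; tauto|].
  apply Def_not, Def_imp, Def_not; auto.
Qed.

Lemma Def_or R R' : Def M R -> Def M R' -> Def M (fun e => R e \/ R' e).
Proof.
  intros H H'; apply Def_ext with (fun e => ~ R e -> R' e); [intros; tauto|].
  apply Def_imp, H'; apply Def_not, H.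
Qed.

Lemma Def_iff R R' : Def M R -> Def M R' -> Def M (fun e => R e <-> R' e).
Proof. intros; apply Def_and; apply Def_imp; auto. Qed.

(** A coordinate of [E] either is the quantified variable, possibly at several places, or does not
    depend on it. The renaming [r] sends all places of the first kind to the bound variable 0 and
    keeps the others as free variables, shifted by one. *)
Lemma Def_all (Q : set -> (nat -> set) -> Prop) :
  Def M (fun e => Q (e 0) (fun n => e (S n))) ->
  Def M (fun e => forall x, M x -> Q x e).
Proof.
  intros (phi & E & HE & K).
  assert (D : forall n, exists m, (m = 0 /\ forall e, E e n = e 0) \/
            (m = S n /\ exists F : (nat -> set) -> set, (forall x e, E (scons x e) n = F e) /\
               ((exists i, forall e, F e = e i) \/ (exists c, M c /\ forall e, F e = c)))).
  { intros n; destruct (HE n) as [[[|i] Hi]|[c [Hc Hi]]].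
    - exists 0; auto.
    - exists (S n); right; split; auto; exists (fun e => e i); split; [|left; eauto].
      intros; rewrite Hi; reflexivity.
    - exists (S n); right; split; auto; exists (fun _ => c); split; [|right; eauto].
      intros; rewrite Hi; reflexivity. }
  pose (r := fun n => proj1_sig (constructive_indefinite_description _ (D n))).
  assert (Hr : forall n, (r n = 0 /\ forall e, E e n = e 0) \/
            (r n = S n /\ exists F : (nat -> set) -> set, (forall x e, E (scons x e) n = F e) /\
               ((exists i, forall e, F e = e i) \/ (exists c, M c /\ forall e, F e = c)))).
  { intros n; exact (proj2_sig (constructive_indefinite_description _ (D n))). }
  clearbody r; clear D.
  (* The values [e 0] and [empty] are fillers: a place with [r n = 0] is never read from outside the
     quantifier, and at the other places [E] ignores the first entry. *)
  exists (All (ren r phi)), (fun e n => if Nat.eqb (r n) 0 then e 0 else E (scons empty e) n).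
  split.
  - intros n; destruct (Hr n) as [[-> H]|[-> (F & H & H')]]; cbn; [left; eauto|].
    destruct H' as [[i H']|[c [Hc H']]]; [left; exists i | right; exists c]; intros;
      try split; intros; rewrite ?H; auto.
  - intros e He; cbn [sat].
    assert (A : forall x, M x -> (Q x e <-> sat M (E (scons x e)) phi)).
    { intros x Hx; rewrite <- K by (apply env_scons; auto); cbn; tauto. }
    assert (B : forall x, (fun n => scons x (fun n => if Nat.eqb (r n) 0 then e 0
                    else E (scons empty e) n) (r n)) = E (scons x e)).
    { intros x; apply functional_extensionality; intros n.
      destruct (Hr n) as [[-> H]|[E1 (F & H & H')]]; cbn.
      - rewrite H; reflexivity.
      - rewrite E1 at 1; cbn; rewrite E1; cbn; rewrite !H; reflexivity. }
    split; intros H x Hx; [rewrite sat_ren, B; apply A; auto|].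
    apply A; auto; rewrite <- B, <- sat_ren; auto.
Qed.

Lemma Def_ex (Q : set -> (nat -> set) -> Prop) :
  Def M (fun e => Q (e 0) (fun n => e (S n))) ->
  Def M (fun e => exists x, M x /\ Q x e).
Proof.
  intros H; apply Def_ext with (fun e => ~ forall x, M x -> ~ Q x e).
  - intros e _; split.
    + intros K; apply NNPP; intros K'; apply K; intros x Hx Hq; eauto.
    + intros (x & Hx & Hq) K; exact (K x Hx Hq).
  - apply Def_not; apply (Def_all (fun x e => ~ Q x e)); apply Def_not, H.
Qed.

(** A definable graph alone would not permit substitution: the quantifier that replaces a term
    ranges over [M], so the value has to lie in [M] as well. *)
Definition DefF (F : (nat -> set) -> set) : Prop :=
  (forall e, env M e -> M (F e)) /\ Def M (fun e => e 0 = F (fun n => e (S n))).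

Lemma Def_sub F (Q : set -> (nat -> set) -> Prop) : DefF F ->
  Def M (fun e => Q (e 0) (fun n => e (S n))) ->
  Def M (fun e => Q (F e) e).
Proof.
  intros [HF H] K; apply Def_ext with (fun e => exists x, M x /\ (x = F e /\ Q x e)).
  - intros e He; split.
    + intros (x & _ & -> & Hq); exact Hq.
    + intros Hq; exists (F e); auto.
  - apply (Def_ex (fun x e => x = F e /\ Q x e)); apply Def_and; auto.
Qed.

Lemma DefF_var i : DefF (fun e => e i).
Proof. split; [intros e He; apply He | exact (Def_fm (Eq 0 (S i)))]. Qed.

Lemma DefF_const c : M c -> DefF (fun _ => c).
Proof.
  intros Hc; split; [auto|].
  exists (Eq 0 1), (fun e n => match n with O => e 0 | _ => c end); split.
  - intros [|n]; [left; eauto | right; eauto].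
  - intros e He; cbn; tauto.
Qed.

Lemma Def_simple_var r : simple M (fun e n => e (r n)).
Proof. intros n; left; eauto. Qed.

Lemma Def_app1 R F : Def M (fun e => R (e 0)) -> DefF F -> Def M (fun e => R (F e)).
Proof.
  intros H HF; apply (Def_sub (fun x e => R x) HF); exact H.
Qed.

Lemma DefF_weak F : DefF F -> DefF (fun e => F (fun n => e (S n))).
Proof.
  intros [HF H]; split; [intros e He; apply HF; intros n; apply He|].
  exact (Def_simple (Def_simple_var (fun n => match n with O => O | S m => S (S m) end)) H).
Qed.

Lemma Def_app2 R F1 F2 : Def M (fun e => R (e 0) (e 1)) -> DefF F1 -> DefF F2 ->
  Def M (fun e => R (F1 e) (F2 e)).
Proof.
  intros H H1 H2; apply (Def_sub (fun x e => R x (F2 e)) H1).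
  apply (Def_sub (fun y e => R (e 0) y) (DefF_weak H2)).
  exact (Def_simple (Def_simple_var (fun n => match n with O => 1 | _ => 0 end)) H).
Qed.

Lemma Def_app3 R F1 F2 F3 : Def M (fun e => R (e 0) (e 1) (e 2)) ->
  DefF F1 -> DefF F2 -> DefF F3 -> Def M (fun e => R (F1 e) (F2 e) (F3 e)).
Proof.
  intros H H1 H2 H3; apply (Def_sub (fun x e => R x (F2 e) (F3 e)) H1).
  apply (Def_sub (fun y e => R (e 0) y (F3 (fun n => e (S n)))) (DefF_weak H2)).
  apply (Def_sub (fun y e => R (e 1) (e 0) y) (DefF_weak (DefF_weak H3))).
  exact (Def_simple (Def_simple_var (fun n => match n with O => 2 | 1 => 1 | _ => 0 end)) H).
Qed.

Lemma DefF_app1 (f : set -> set) F : DefF (fun e => f (e 0)) -> DefF F ->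
  DefF (fun e => f (F e)).
Proof.
  intros [Hf H] HF; split.
  - intros e He; apply (Hf (fun _ => F e)); intros _; apply HF, He.
  - exact (Def_app2 (fun y x => y = f x) H (DefF_var 0) (DefF_weak HF)).
Qed.

Lemma DefF_app2 (f : set -> set -> set) F1 F2 : DefF (fun e => f (e 0) (e 1)) ->
  DefF F1 -> DefF F2 -> DefF (fun e => f (F1 e) (F2 e)).
Proof.
  intros [Hf H] H1 H2; split.
  - intros e He; apply (Hf (fun n => match n with O => F1 e | _ => F2 e end)).
    intros [|n]; [apply H1, He | apply H2, He].
  - exact (Def_app3 (fun z x y => z = f x y) H (DefF_var 0) (DefF_weak H1) (DefF_weak H2)).
Qed.

Lemma Def_app4 R F1 F2 F3 F4 : Def M (fun e => R (e 0) (e 1) (e 2) (e 3)) ->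
  DefF F1 -> DefF F2 -> DefF F3 -> DefF F4 ->
  Def M (fun e => R (F1 e) (F2 e) (F3 e) (F4 e)).
Proof.
  intros H H1 H2 H3 H4; apply (Def_sub (fun x e => R x (F2 e) (F3 e) (F4 e)) H1).
  apply (Def_sub (fun y e => R (e 0) y (F3 (fun n => e (S n))) (F4 (fun n => e (S n))))
    (DefF_weak H2)).
  apply (Def_sub (fun y e => R (e 1) (e 0) y (F4 (fun n => e (S (S n)))))
    (DefF_weak (DefF_weak H3))).
  apply (Def_sub (fun y e => R (e 2) (e 1) (e 0) y)
    (DefF_weak (DefF_weak (DefF_weak H4)))).
  exact (Def_simple
    (Def_simple_var (fun n => match n with O => 3 | 1 => 2 | 2 => 1 | _ => 0 end)) H).
Qed.

Lemma DefF_app3 (f : set -> set -> set -> set) F1 F2 F3 : DefF (fun e => f (e 0) (e 1) (e 2)) ->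
  DefF F1 -> DefF F2 -> DefF F3 -> DefF (fun e => f (F1 e) (F2 e) (F3 e)).
Proof.
  intros [Hf H] H1 H2 H3; split.
  - intros e He; apply (Hf (fun n => match n with O => F1 e | 1 => F2 e | _ => F3 e end)).
    intros [|[|n]]; [apply H1, He | apply H2, He | apply H3, He].
  - exact (Def_app4 (fun z x y w => z = f x y w) H (DefF_var 0)
      (DefF_weak H1) (DefF_weak H2) (DefF_weak H3)).
Qed.

Lemma Def_mem F1 F2 : DefF F1 -> DefF F2 -> Def M (fun e => F1 e ∈ F2 e).
Proof. apply Def_app2; exact (Def_fm (Mem 0 1)). Qed.

Lemma Def_eq F1 F2 : DefF F1 -> DefF F2 -> Def M (fun e => F1 e = F2 e).
Proof. apply Def_app2; exact (Def_fm (Eq 0 1)). Qed.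

End Definability.

(** Classically such a statement is equivalent to truth or to falsity, so [P] need not be
    expressible by a formula. *)
Lemma Def_cst M (P : Prop) : Def M (fun _ => P).
Proof.
  destruct (classic P); [apply Def_ext with (2 := Def_True M) | apply Def_ext with (2 := Def_False M)];
    tauto.
Qed.

(** The way back from [Def] to formulas. Once all entries from [k] on are frozen, the coordinates of
    [E] that read them become parameters, which leaves the form [scons x c] that the axiom schemas
    ask for. *)
Lemma Def_prefix M R k e0 : Def M R -> env M e0 -> exists phi c, env M c /\
  forall e, env M e -> (forall n, k <= n -> e n = e0 n) ->
    (R e <-> sat M (fun n => if n <? k then e n else c (n - k)) phi).
Proof.
  intros (phi & E & HE & K) H0.
  assert (D : forall n, exists m,
     (m < k /\ forall e, E e n = e m) \/
     (m = k + n /\ forall e, (forall n, k <= n -> e n = e0 n) -> E e n = E e0 n)).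
  { intros n; destruct (HE n) as [[i Hi]|[c [_ Hc]]].
    - destruct (Nat.lt_ge_cases i k); [exists i; auto|].
      exists (k + n); right; split; auto; intros e He; rewrite !Hi; auto.
    - exists (k + n); right; split; auto; intros; rewrite !Hc; auto. }
  pose (r := fun n => proj1_sig (constructive_indefinite_description _ (D n))).
  assert (Hr : forall n, (r n < k /\ forall e, E e n = e (r n)) \/
     (r n = k + n /\ forall e, (forall n, k <= n -> e n = e0 n) -> E e n = E e0 n)).
  { intros n; exact (proj2_sig (constructive_indefinite_description _ (D n))). }
  clearbody r; clear D; exists (ren r phi), (E e0); split; [apply env_simple; auto|].
  intros e He He0; rewrite K, sat_ren by auto.
  replace (fun n => if r n <? k then e (r n) else E e0 (r n - k)) with (E e); [tauto|].
  apply functional_extensionality; intros n.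
  destruct (Hr n) as [[H1 H2]|[H1 H2]].
  - apply Nat.ltb_lt in H1; rewrite H1; auto.
  - rewrite H1; replace (k + n <? k) with false by (symmetry; apply Nat.ltb_ge; lia).
    rewrite H2 by auto; f_equal; lia.
Qed.

(** Transitive models of ZF, with definable classes instead of formulas. *)
Record zf_model (M : set -> Prop) : Prop := {
  zf_trans : forall x y, M x -> y ∈ x -> M y;
  zf_infinity : M omega;
  zf_pairing : forall x y, M x -> M y -> M (pair x y);
  zf_union : forall a, M a -> M (bigcup a);
  zf_power : forall a, M a -> M (Pow M a);
  zf_separation : forall C a, Def M (fun e => C (e 0)) -> M a -> M (sep a C);
  zf_replacement : forall (R : set -> set -> Prop) a, Def M (fun e => R (e 0) (e 1)) -> M a ->
    (forall x, x ∈ a -> exists y, M y /\ R x y /\ forall y', M y' -> R x y' -> y' = y) ->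
    exists b, M b /\ forall x, x ∈ a -> exists y, y ∈ b /\ R x y
}.

Lemma zf_of_transitive_model M : transitive_model M -> zf_model M.
Proof.
  intros HM; split; try apply HM.
  - intros C a HC Ha.
    destruct (Def_prefix 1 (e0 := fun _ => omega) HC) as (phi & c & Hc & K).
    { intros n; apply HM. }
    assert (E : sep a C = setof (fun x => x ∈ a /\ sat M (scons x c) phi)).
    { apply setof_ext; intros x; split; intros [Hx H]; split; auto;
        assert (Mx := tm_trans HM Ha Hx);
        assert (L : env M (scons x (fun _ => omega))) by
          (apply env_scons; auto; intros n; apply HM);
        apply K in L; try (intros [|n]; [lia|reflexivity]);
        replace (scons x c) with
          (fun n => if n <? 1 then scons x (fun _ => omega) n else c (n - 1)) in *
          by (apply functional_extensionality; intros [|n]; cbn; rewrite ?Nat.sub_0_r; auto);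
        apply L; auto. }
    rewrite E; apply HM; auto.
  - intros R a HR Ha H.
    destruct (Def_prefix 2 (e0 := fun _ => omega) HR) as (phi & c & Hc & K).
    { intros n; apply HM. }
    assert (L : forall x y, M x -> M y -> (R x y <-> sat M (scons x (scons y c)) phi)).
    { intros x y Mx My.
      assert (L : env M (scons x (scons y (fun _ => omega)))).
      { repeat apply env_scons; auto; intros n; apply HM. }
      apply K in L; [|intros [|[|n]]; auto; lia].
      replace (scons x (scons y c)) with
          (fun n => if n <? 2 then scons x (scons y (fun _ => omega)) n else c (n - 2)).
      - exact L.
      - apply functional_extensionality; intros [|[|n]]; cbn; rewrite ?Nat.sub_0_r; auto. }
    destruct (tm_replacement HM phi c Hc Ha) as (b & Mb & Hb).
    + intros x Hx; assert (Mx := tm_trans HM Ha Hx).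
      destruct (H x Hx) as (y & My & Hxy & U); exists y; split.
      * split; auto; apply L; auto.
      * intros y' [My' Hy']; symmetry; apply U; auto; apply L; auto.
    + exists b; split; auto; intros x Hx; destruct (Hb x Hx) as (y & Hy & Hxy).
      exists y; split; auto; apply L; auto; [exact (tm_trans HM Ha Hx) | exact (tm_trans HM Mb Hy)].
Qed.

(** * Closure and definability in a transitive model of ZF *)

Section ZF.
Variable M : set -> Prop.
Hypothesis HM : zf_model M.

Lemma M_pair x y : M (pair x y) <-> M x /\ M y.
Proof.
  split; [|intros []; apply HM; auto].
  intros H; split; apply (zf_trans HM H), mem_pair; auto.
Qed.

Lemma M_op x y : M (op x y) <-> M x /\ M y.
Proof. unfold op; rewrite !M_pair; tauto. Qed.

Lemma M_op_l [t x y] : M t -> op x y ∈ t -> M x.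
Proof. intros Ht H; apply (zf_trans HM Ht), M_op in H; tauto. Qed.

Lemma M_op_r [t x y] : M t -> op x y ∈ t -> M y.
Proof. intros Ht H; apply (zf_trans HM Ht), M_op in H; tauto. Qed.

(** A quantifier over the whole universe is harmless when sets outside [M] cannot matter: here a
    counterexample must lie in [M], in [Def_exM] a witness must. *)
Lemma Def_allM (Q : set -> (nat -> set) -> Prop) :
  (forall e x, env M e -> ~ Q x e -> M x) ->
  Def M (fun e => Q (e 0) (fun n => e (S n))) -> Def M (fun e => forall x, Q x e).
Proof.
  intros H K; apply Def_ext with (fun e => forall x, M x -> Q x e); [|apply Def_all, K].
  intros e He; split; auto; intros A x; apply NNPP; eauto.
Qed.

Lemma Def_exM (Q : set -> (nat -> set) -> Prop) :
  (forall e x, env M e -> Q x e -> M x) ->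
  Def M (fun e => Q (e 0) (fun n => e (S n))) -> Def M (fun e => exists x, Q x e).
Proof.
  intros H K; apply Def_ext with (fun e => exists x, M x /\ Q x e); [|apply Def_ex, K].
  intros e He; split; [intros (x & _ & A) | intros (x & A)]; eauto.
Qed.

Lemma Def_ball F (Q : set -> (nat -> set) -> Prop) : DefF M F ->
  Def M (fun e => Q (e 0) (fun n => e (S n))) ->
  Def M (fun e => forall x, x ∈ F e -> Q x e).
Proof.
  intros HF HQ; apply (Def_allM (fun x e => x ∈ F e -> Q x e)).
  - intros e x He H; apply zf_trans with (F e); auto; [apply HF, He | tauto].
  - apply Def_imp; auto; apply Def_mem; [apply DefF_var | apply DefF_weak; auto].
Qed.

Lemma Def_bex F (Q : set -> (nat -> set) -> Prop) : DefF M F ->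
  Def M (fun e => Q (e 0) (fun n => e (S n))) ->
  Def M (fun e => exists x, x ∈ F e /\ Q x e).
Proof.
  intros HF HQ; apply (Def_exM (fun x e => x ∈ F e /\ Q x e)).
  - intros e x He H; apply zf_trans with (F e); auto; [apply HF, He | tauto].
  - apply Def_and; auto; apply Def_mem; [apply DefF_var | apply DefF_weak; auto].
Qed.

(** By extensionality and transitivity, equality with [F e] can be tested on elements of [M], so a
    definable membership condition defines the value. That the value exists in [M] is a separate
    matter. *)
Lemma DefF_char F (C : set -> (nat -> set) -> Prop) :
  (forall e, env M e -> M (F e)) ->
  (forall e z, env M e -> (z ∈ F e <-> C z e)) ->
  Def M (fun e => C (e 0) (fun n => e (S n))) -> DefF M F.
Proof.
  intros HF H HC; split; auto.
  apply Def_ext with (fun e => forall z, M z -> (z ∈ e 0 <-> C z (fun n => e (S n)))).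
  - intros e He; assert (Ht : env M (fun n => e (S n))) by (intros n; apply He); split.
    + intros K; apply set_ext; intros z; rewrite H by auto; split; intros Hz.
      * apply K; auto; exact (zf_trans HM (He 0) Hz).
      * assert (K1 := HF _ Ht); apply K; auto; exact (zf_trans HM K1 (proj2 (H _ _ Ht) Hz)).
    + intros K z Mz; rewrite K; auto.
  - apply (Def_all (fun z e => z ∈ e 0 <-> C z (fun n => e (S n)))).
    apply Def_iff; [apply Def_mem; apply DefF_var|].
    exact (Def_simple (Def_simple_var M (fun n => match n with O => O | S m => S (S m) end)) HC).
Qed.

Lemma DefF_pair : DefF M (fun e => pair (e 0) (e 1)).
Proof.
  apply DefF_char with (fun z e => z = e 0 \/ z = e 1).
  - intros; apply HM; auto.
  - intros; apply mem_pair.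
  - apply Def_or; apply Def_eq; apply DefF_var.
Qed.

Lemma DefF_op : DefF M (fun e => op (e 0) (e 1)).
Proof. repeat (apply (DefF_app2 pair); [apply DefF_pair | |]); apply DefF_var. Qed.

Lemma DefF_bigcup : DefF M (fun e => bigcup (e 0)).
Proof.
  apply DefF_char with (fun z e => exists y, y ∈ e 0 /\ z ∈ y).
  - intros; apply HM; auto.
  - intros; apply mem_bigcup.
  - apply (Def_bex (fun y e => e 0 ∈ y) (DefF_var M 1)); apply Def_mem; apply DefF_var.
Qed.

Lemma DefF_union : DefF M (fun e => union (e 0) (e 1)).
Proof. apply (DefF_app1 bigcup); [apply DefF_bigcup | apply DefF_pair]. Qed.

Lemma DefF_succ : DefF M (fun e => succ (e 0)).
Proof.
  apply DefF_char with (fun z e => z ∈ e 0 \/ z = e 0).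
  - intros e He; replace (succ (e 0)) with (union (e 0) (pair (e 0) (e 0))).
    + repeat apply HM; auto.
    + apply set_ext; intros z; rewrite mem_union, mem_pair, mem_succ; tauto.
  - intros; apply mem_succ.
  - apply Def_or; [apply Def_mem | apply Def_eq]; apply DefF_var.
Qed.

Lemma DefF_Pow : DefF M (fun e => Pow M (e 0)).
Proof.
  apply DefF_char with (fun z e => M z /\ z ⊆ e 0).
  - intros; apply HM; auto.
  - intros; apply mem_Pow.
  - apply Def_ext with (fun e => e 0 ⊆ e 1); [intros; split; [auto | tauto]|].
    apply (Def_ball (fun x e => x ∈ e 1) (DefF_var M 0)); apply Def_mem; apply DefF_var.
Qed.

Lemma DefF_sep A (C : set -> (nat -> set) -> Prop) : DefF M A ->
  Def M (fun e => C (e 0) (fun n => e (S n))) ->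
  DefF M (fun e => sep (A e) (fun x => C x e)).
Proof.
  intros HA HC; apply DefF_char with (fun z e => z ∈ A e /\ C z e).
  - intros e He; apply HM; [|apply HA, He].
    refine (Def_simple (E := fun e' => scons (e' 0) e) _ HC).
    intros [|n]; [left; exists 0; auto | right; exists (e n); cbn; auto].
  - intros; apply mem_sep.
  - apply Def_and; auto; apply Def_mem; [apply DefF_var | apply DefF_weak, HA].
Qed.

(** Replacement yields only a set that includes all values; separation by the same graph trims it to
    the image. *)
Lemma DefF_image A F : DefF M A -> DefF M (fun e => F (e 0) (fun n => e (S n))) ->
  DefF M (fun e => image (A e) (fun x => F x e)).
Proof.
  intros HA HF; apply DefF_char with (fun z e => exists x, x ∈ A e /\ z = F x e).
  - intros e He; assert (Ma : M (A e)) by apply HA, He.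
    assert (MF : forall x, M x -> M (F x e)).
    { intros x Mx; exact (proj1 HF (scons x e) (env_scons _ Mx He)). }
    assert (D : Def M (fun e' => e' 1 = F (e' 0) e)).
    { refine (Def_simple (E := fun e' n => match n with O => e' 1 | 1 => e' 0
                | S (S n) => e n end) _ (proj2 HF)).
      intros [|[|n]]; [left; exists 1; auto | left; exists 0; auto | right; exists (e n); auto]. }
    destruct (zf_replacement HM (fun x y => y = F x e) D Ma) as (b & Mb & Hb).
    + intros x Hx; exists (F x e); repeat split; auto.
      apply MF, (zf_trans HM Ma Hx).
    + replace (image (A e) (fun x => F x e)) with (sep b (fun y => exists x, x ∈ A e /\ y = F x e)).
      * apply HM; auto.
        apply (Def_bex (fun x e' => e' 0 = F x e) (DefF_const M _ Ma)).
        exact D.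
      * apply set_ext; intros y; rewrite mem_sep, mem_image; split; [tauto|].
        intros (x & Hx & ->); split; eauto; destruct (Hb x Hx) as (y & Hy & ->); auto.
  - intros; apply mem_image.
  - apply (Def_bex (fun x e => e 0 = F x (fun n => e (S n))) (DefF_weak HA)).
    exact (Def_simple (Def_simple_var M (fun n => match n with O => 1 | 1 => 0 | S n => S n end))
             (proj2 HF)).
Qed.

Lemma DefF_prod : DefF M (fun e => prod (e 0) (e 1)).
Proof.
  apply (DefF_app1 bigcup DefF_bigcup).
  apply (DefF_image (fun x e => setof (fun z => exists y, y ∈ e 1 /\ z = op x y)) (DefF_var M 0)).
  exact (DefF_image (fun y e => op (e 0) y) (DefF_var M 2)
    (DefF_app2 op DefF_op (DefF_var M 1) (DefF_var M 0))).
Qed.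

Lemma DefF_rel A B (Q : set -> set -> (nat -> set) -> Prop) : DefF M A -> DefF M B ->
  Def M (fun e => Q (e 1) (e 0) (fun n => e (S (S n)))) ->
  DefF M (fun e => rel (A e) (B e) (fun x y => Q x y e)).
Proof.
  intros HA HB HQ.
  apply (DefF_sep (fun z e => exists x y, z = op x y /\ Q x y e)).
  - exact (DefF_app2 prod DefF_prod HA HB).
  - apply (Def_exM (fun x e => exists y, e 0 = op x y /\ Q x y (fun n => e (S n)))).
    + intros e x He (y & E & _); assert (H := He 0); rewrite E in H; apply M_op in H; tauto.
    + apply (Def_exM (fun y e => e 1 = op (e 0) y /\ Q (e 0) y (fun n => e (S (S n))))).
      * intros e y He (E & _); assert (H := He 1); rewrite E in H; apply M_op in H; tauto.
      * apply Def_and.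
        -- apply Def_eq; [|apply (DefF_app2 op DefF_op)]; apply DefF_var.
        -- exact (Def_simple (Def_simple_var M (fun n => match n with O => O | 1 => 1 | S n => S (S n) end)) HQ).
Qed.

Lemma DefF_graph A F : DefF M A -> DefF M (fun e => F (e 0) (fun n => e (S n))) ->
  DefF M (fun e => graph (A e) (fun x => F x e)).
Proof.
  intros HA HF; apply (DefF_image (fun x e => op x (F x e)) HA).
  apply (DefF_app2 op DefF_op); auto; apply DefF_var.
Qed.

Lemma DefF_closed F : DefF M (fun _ => F) -> M F.
Proof. intros [H _]; apply (H (fun _ => omega)); intros n; apply HM. Qed.

End ZF.

Lemma M_eq_op_l M (HM : zf_model M) t x y : t = op x y -> M t -> M x.
Proof. intros -> H; apply (M_op HM) in H; tauto. Qed.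

Lemma M_eq_op_r M (HM : zf_model M) t x y : t = op x y -> M t -> M y.
Proof. intros -> H; apply (M_op HM) in H; tauto. Qed.

Lemma M_op_intro M (HM : zf_model M) x y : M x -> M y -> M (op x y).
Proof. intros Hx Hy; apply (M_op HM); auto. Qed.

(** A hook, redefined as soon as closure under [tcl] and [trcl] is available; [defF_user] has the
    same purpose for terms. *)
Ltac in_model_user HM := fail.

Ltac in_model HM :=
  first
  [ assumption
  | match goal with H : env _ _ |- _ => apply H end
  | lazymatch goal with
    | |- _ (op _ _) => apply (M_op_intro HM); in_model HM
    | |- _ (pair _ _) => apply (zf_pairing HM); in_model HM
    | |- _ (bigcup _) => apply (zf_union HM); in_model HM
    | |- _ omega => apply (zf_infinity HM)
    | |- _ (Pow _ _) => apply (zf_power HM); in_model HM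
    end
  | in_model_user HM; in_model HM
  | match goal with
    | H : op ?x _ ∈ _ |- _ ?x => apply (M_op_l HM) with (2 := H); in_model HM
    | H : op _ ?x ∈ _ |- _ ?x => apply (M_op_r HM) with (2 := H); in_model HM
    | H : ?x ∈ _ |- _ ?x => apply (zf_trans HM) with (2 := H); in_model HM
    | H : _ = op ?x _ |- _ ?x => apply (M_eq_op_l HM) with (1 := H); in_model HM
    | H : _ = op _ ?x |- _ ?x => apply (M_eq_op_r HM) with (1 := H); in_model HM
    end ].

Ltac def_side HM :=
  let e := fresh "e" in let x := fresh "x" in let He := fresh "He" in let H := fresh "H" in
  intros e x He H;
  first
  [ solve [ repeat match goal with
      | K : exists _, _ |- _ => destruct K
      | K : _ /\ _ |- _ => destruct K
      end; in_model HM ]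
  | solve [ apply NNPP; let N := fresh "N" in intros N; apply H; intros; exfalso; apply N;
      repeat match goal with
      | K : exists _, _ |- _ => destruct K
      | K : _ /\ _ |- _ => destruct K
      end; in_model HM ]
  | idtac ].

Ltac defF_user HM := fail.

Ltac defF_step HM :=
  lazymatch goal with
  | |- DefF _ (fun e => e ?n) => apply DefF_var
  | |- DefF _ (fun e => pair (@?F e) (@?G e)) => apply (DefF_app2 pair (DefF_pair HM))
  | |- DefF _ (fun e => op (@?F e) (@?G e)) => apply (DefF_app2 op (DefF_op HM))
  | |- DefF _ (fun e => union (@?F e) (@?G e)) => apply (DefF_app2 union (DefF_union HM))
  | |- DefF _ (fun e => prod (@?F e) (@?G e)) => apply (DefF_app2 prod (DefF_prod HM))
  | |- DefF _ (fun e => bigcup (@?F e)) => apply (DefF_app1 bigcup (DefF_bigcup HM))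
  | |- DefF _ (fun e => succ (@?F e)) => apply (DefF_app1 succ (DefF_succ HM))
  | |- DefF ?M (fun e => Pow ?M (@?F e)) => apply (DefF_app1 (Pow M) (DefF_Pow HM))
  | |- DefF _ (fun e => sep (@?A e) (@?F e)) => apply (DefF_sep HM)
  | |- DefF _ (fun e => image (@?A e) (@?F e)) => apply (DefF_image HM)
  | |- DefF _ (fun e => graph (@?A e) (@?F e)) => apply (DefF_graph HM)
  | |- DefF _ (fun e => rel (@?A e) (@?B e) (@?Q e)) => apply (DefF_rel HM)
  | |- DefF _ _ => defF_user HM
  end.

Ltac def_step HM :=
  cbv beta;
  lazymatch goal with
  | |- Def _ (fun _ => ?P) => apply Def_cst
  | |- Def _ (fun e => @?A e /\ @?B e) => apply Def_and
  | |- Def _ (fun e => @?A e \/ @?B e) => apply Def_or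
  | |- Def _ (fun e => ~ @?A e) => apply Def_not
  | |- Def _ (fun e => @?A e <-> @?B e) => apply Def_iff
  | |- Def _ (fun e => @?A e -> @?B e) => apply Def_imp
  | |- Def _ (fun e => exists x, @?Q e x) =>
      first [apply Def_ex | apply (Def_bex HM) | apply (Def_exM (M := _)); [def_side HM |]]
  | |- Def _ (fun e => forall x, @?Q e x) =>
      first [apply Def_all | apply (Def_ball HM) | apply (Def_allM (M := _)); [def_side HM |]]
  | |- Def _ (fun e => @?F e ∈ @?G e) => apply Def_mem
  | |- Def _ (fun e => @?F e ⊆ @?G e) => unfold subset
  | |- Def _ (fun e => le ?P (@?F e) (@?G e)) => unfold le
  | |- Def _ (fun e => @?F e = @?G e) => apply Def_eq
  | |- Def _ _ => assumption
  | |- DefF _ _ => first [assumption | apply DefF_const; in_model HM | defF_step HM]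
  end.

Ltac defn HM := repeat def_step HM.
(** * Recursion on sets inside a model *)

Definition tcl (x : set) : set := union (trcl x) (pair x x).

Lemma mem_tcl x z : z ∈ tcl x <-> tc z x \/ z = x.
Proof. unfold tcl; rewrite mem_union, mem_pair, mem_trcl; tauto. Qed.

Lemma tc_inv z x : tc z x -> exists y, y ∈ x /\ (tc z y \/ z = y).
Proof.
  intros H; apply clos_trans_tn1 in H; destruct H as [|y x Hy H]; eauto.
  exists y; split; auto; left; apply clos_tn1_trans; auto.
Qed.

Lemma trcl_eq x : trcl x = bigcup (image x tcl).
Proof.
  apply set_ext; intros z; rewrite mem_trcl, mem_bigcup; split.
  - intros H; apply tc_inv in H; destruct H as (y & Hy & H); exists (tcl y).
    rewrite mem_image, mem_tcl; eauto.
  - intros (w & Hw & Hz); apply mem_image in Hw; destruct Hw as (y & Hy & ->).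
    apply mem_tcl in Hz; destruct Hz as [Hz | ->]; [|apply t_step; auto].
    apply t_trans with y; auto; apply t_step; auto.
Qed.

Lemma tc_tcl x y z : y ∈ tcl x -> tc z y -> tc z x.
Proof.
  rewrite mem_tcl; intros [H | ->] K; auto; apply t_trans with y; auto.
Qed.

Definition restr (f a : set) : set := sep f (fun z => exists w v, w ∈ a /\ z = op w v).

Section ZF.
Variable M : set -> Prop.
Hypothesis HM : zf_model M.

Lemma M_sep a C : M a -> Def M (fun e => C (e 0)) -> M (sep a C).
Proof. intros; apply HM; auto. Qed.

Lemma M_image a F : M a -> DefF M (fun e => F (e 0)) -> M (image a F).
Proof.
  intros; apply (DefF_closed HM); defn HM.
Qed.

Lemma M_rel A B Q : M A -> M B -> Def M (fun e => Q (e 1) (e 0)) -> M (rel A B Q).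
Proof. intros; apply (DefF_closed HM); defn HM. Qed.

Lemma M_union x y : M x -> M y -> M (union x y).
Proof. intros; repeat apply HM; auto. Qed.

(** The relation [tc] is an inductive closure taken in the universe. Minimality among the transitive
    sets of [M] is a first-order substitute, and the two agree once [tcl x] is known to be in
    [M]. *)
Definition is_tcl (x t : set) : Prop :=
  (forall y z, y ∈ z -> z ∈ t -> y ∈ t) /\ x ∈ t /\
  forall t', M t' -> (forall y z, y ∈ z -> z ∈ t' -> y ∈ t') -> x ∈ t' -> t ⊆ t'.

Lemma tcl_least x t : (forall y z, y ∈ z -> z ∈ t -> y ∈ t) -> x ∈ t -> tcl x ⊆ t.
Proof.
  intros T Hx z Hz; apply mem_tcl in Hz; destruct Hz as [Hz | ->]; auto.
  apply clos_trans_t1n in Hz; induction Hz; eauto.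
Qed.

Lemma is_tcl_tcl x : is_tcl x (tcl x).
Proof.
  repeat split.
  - intros y z Hy Hz; apply mem_tcl; left; apply tc_tcl with z; auto; apply t_step; auto.
  - apply mem_tcl; auto.
  - intros; apply tcl_least; auto.
Qed.

Lemma is_tcl_unique x t : M (tcl x) -> is_tcl x t -> t = tcl x.
Proof.
  intros Mx (T & Hx & L); apply set_ext; intros z; split; intros Hz.
  - apply (L (tcl x)); auto; apply is_tcl_tcl.
  - apply (tcl_least T Hx), Hz.
Qed.

Lemma Def_is_tcl : Def M (fun e => is_tcl (e 0) (e 1)).
Proof. unfold is_tcl; defn HM. Qed.

(** Induction on membership: replacement collects the closures of the elements, which are unique by
    [is_tcl_unique], and their union together with [x] itself is the closure of [x]. *)
Lemma M_tcl x : M x -> M (tcl x).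
Proof.
  induction x as [x IH] using (well_founded_ind mem_wf); intros Mx.
  assert (IH' : forall y, y ∈ x -> M (tcl y)) by (intros y Hy; apply IH, (zf_trans HM Mx Hy); auto).
  destruct (zf_replacement HM is_tcl Def_is_tcl Mx) as (b & Mb & Hb).
  { intros y Hy; exists (tcl y); repeat split; auto using is_tcl_tcl.
    - intros u z Hu Hz; apply (proj1 (is_tcl_tcl y)) with z; auto.
    - apply mem_tcl; auto.
    - intros; apply tcl_least; auto.
    - intros t Mt Ht; apply is_tcl_unique; auto. }
  replace (tcl x) with
    (union (bigcup (sep b (fun t => exists y, y ∈ x /\ is_tcl y t))) (pair x x)).
  - apply M_union; [|apply HM; auto]; apply HM, M_sep; auto.
    assert (D := Def_is_tcl).
    apply (Def_bex HM (fun y e => is_tcl y (e 0)) (DefF_const M _ Mx)).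
    apply (Def_app2 is_tcl); auto; apply DefF_var.
  - unfold tcl at 1; rewrite trcl_eq; do 2 f_equal; apply set_ext; intros t.
    rewrite mem_sep, mem_image; split.
    + intros [_ (y & Hy & Ht)]; exists y; split; auto; apply is_tcl_unique; auto.
    + intros (y & Hy & ->); destruct (Hb y Hy) as (t & Ht & H).
      apply is_tcl_unique in H as E; auto; subst t; eauto.
Qed.

Lemma DefF_tcl : DefF M (fun e => tcl (e 0)).
Proof.
  split; [intros e He; apply M_tcl, He|].
  apply Def_ext with (fun e => is_tcl (e 1) (e 0)).
  - intros e He; split; [apply is_tcl_unique, M_tcl, He | intros ->; apply is_tcl_tcl].
  - apply (Def_app2 is_tcl Def_is_tcl); apply DefF_var.
Qed.

Lemma DefF_trcl : DefF M (fun e => trcl (e 0)).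
Proof.
  assert (E : trcl = fun x => bigcup (image x tcl)).
  { apply functional_extensionality, trcl_eq. }
  rewrite E; apply (DefF_app1 bigcup (DefF_bigcup HM)).
  apply (DefF_image HM (fun x _ => tcl x) (DefF_var M 0) DefF_tcl).
Qed.

Lemma DefF_restr : DefF M (fun e => restr (e 0) (e 1)).
Proof. unfold restr; defn HM. Qed.

End ZF.

Lemma M_trcl M (HM : zf_model M) x : M x -> M (trcl x).
Proof. intros Mx; apply (proj1 (DefF_trcl HM) (fun _ => x)); intros _; auto. Qed.

Ltac in_model_user HM ::=
  lazymatch goal with
  | |- _ (tcl _) => apply (M_tcl HM)
  | |- _ (trcl _) => apply (M_trcl HM)
  end.

Ltac defF_user HM ::=
  lazymatch goal with
  | |- DefF _ (fun e => tcl (@?F e)) => apply (DefF_app1 tcl (DefF_tcl HM))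
  | |- DefF _ (fun e => trcl (@?F e)) => apply (DefF_app1 trcl (DefF_trcl HM))
  | |- DefF _ (fun e => restr (@?F e) (@?G e)) => apply (DefF_app2 restr (DefF_restr HM))
  end.

Section Recursion.
Variable M : set -> Prop.
Hypothesis HM : zf_model M.
Variables (F : set -> set -> set) (H : set -> set -> set -> set).
Hypothesis FH : forall u x, M u -> M x -> F u x = H u x (graph (trcl x) (F u)).
Hypothesis DefH : DefF M (fun e => H (e 0) (e 1) (e 2)).

(** An approximation to the recursion, with domain the transitive closure of [y]. The function [F]
    lives in the universe and is not yet known to be definable; quantifying over attempts in [M]
    defines its values over [M]. *)
Definition attempt (u y f : set) : Prop :=
  (forall z, z ∈ f -> exists w v, w ∈ trcl y /\ z = op w v) /\
  (forall w, w ∈ trcl y -> exists v, M v /\ op w v ∈ f) /\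
  (forall w v, op w v ∈ f -> v = H u w (restr f (trcl w))).

Lemma attempt_unique u y f : M u -> M y -> M f -> attempt u y f -> f = graph (trcl y) (F u).
Proof.
  intros Mu My Mf (H1 & H2 & H3).
  assert (K : forall w, w ∈ trcl y -> forall v, op w v ∈ f <-> v = F u w).
  { intros w; induction w as [w IH] using (well_founded_ind tc_wf); intros Hw.
    assert (E : restr f (trcl w) = graph (trcl w) (F u)).
    { apply set_ext; intros z; unfold restr; rewrite mem_sep, mem_graph; split.
      - intros (Hz & w' & v & Hw' & ->); exists w'; split; auto.
        rewrite mem_trcl in Hw'; apply IH in Hz; [subst; auto | auto |].
        rewrite mem_trcl in *; apply t_trans with w; auto.
      - intros (w' & Hw' & ->); split; eauto.
        rewrite mem_trcl in Hw'; apply IH; auto.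
        rewrite mem_trcl in *; apply t_trans with w; auto. }
    assert (Mw : M w).
    { apply (zf_trans HM (x := trcl y)); auto.
      apply (M_trcl HM); auto. }
    intros v; split.
    - intros Hv; rewrite (H3 _ _ Hv), E, FH; auto.
    - intros ->; destruct (H2 w Hw) as (v & _ & Hv); rewrite FH, <- E, <- (H3 _ _ Hv); auto. }
  apply set_ext; intros z; rewrite mem_graph; split.
  - intros Hz; destruct (H1 z Hz) as (w & v & Hw & ->); exists w; split; auto.
    apply K in Hz; subst; auto.
  - intros (w & Hw & ->); apply K; auto.
Qed.

Lemma attempt_graph u y : M u -> M y ->
  (forall w, w ∈ trcl y -> M (F u w)) -> attempt u y (graph (trcl y) (F u)).
Proof.
  intros Mu My K; repeat split.
  - intros z Hz; apply mem_graph in Hz; destruct Hz as (w & Hw & ->); eauto.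
  - intros w Hw; exists (F u w); split; auto; apply op_graph; auto.
  - intros w v Hv; apply op_graph in Hv; destruct Hv as [Hw ->].
    assert (Mw : M w).
    { apply (zf_trans HM (x := trcl y)); auto.
      apply (M_trcl HM); auto. }
    rewrite FH at 1 by auto; f_equal; apply set_ext; intros z.
    unfold restr; rewrite mem_sep, !mem_graph; split.
    + intros (x & Hx & ->); split; eauto; exists x; split; auto.
      rewrite mem_trcl in *; apply t_trans with w; auto.
    + intros ((x & Hx & ->) & x' & v & Hx' & E); apply op_inj in E; destruct E; subst x'; eauto.
Qed.

Lemma Def_H F1 F2 F3 : DefF M F1 -> DefF M F2 -> DefF M F3 ->
  DefF M (fun e => H (F1 e) (F2 e) (F3 e)).
Proof. apply (DefF_app3 H DefH). Qed.

Lemma Def_attempt : Def M (fun e => attempt (e 0) (e 1) (e 2)).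
Proof. unfold attempt; defn HM; apply Def_H; defn HM. Qed.

Lemma M_H u y f : M u -> M y -> M f -> M (H u y f).
Proof.
  intros Mu My Mf; apply (proj1 DefH (fun n => match n with O => u | 1 => y | _ => f end)).
  intros [|[|n]]; auto.
Qed.

(** By induction the graphs below each [w] in the closure of [y] belong to [M] and are the only
    attempts there, so [R] defines the pairs of [w] and [F u w], and replacement collects them. *)
Lemma recursion_graph u y : M u -> M y -> M (graph (trcl y) (F u)).
Proof.
  intros Mu; induction y as [y IH] using (well_founded_ind tc_wf); intros My.
  assert (Mt : M (trcl y)) by (apply (M_trcl HM); auto).
  assert (IHg : forall w, w ∈ trcl y -> M w /\ M (graph (trcl w) (F u))).
  { intros w Hw; assert (Mw := zf_trans HM Mt Hw); split; auto; apply IH; auto.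
    apply mem_trcl; auto. }
  assert (IHF : forall w, w ∈ trcl y -> M (F u w)).
  { intros w Hw; destruct (IHg w Hw); rewrite FH by auto; apply M_H; auto. }
  pose (R := fun y z => exists f, M f /\ (attempt u y f /\ z = op y (H u y f))).
  assert (D : Def M (fun e => R (e 0) (e 1))).
  { unfold R; defn HM; [apply (Def_app3 attempt Def_attempt); defn HM | apply Def_H; defn HM]. }
  assert (K : forall w, w ∈ trcl y -> forall z, R w z <-> z = op w (F u w)).
  { intros w Hw z; destruct (IHg w Hw) as [Mw Mg]; unfold R; split.
    - intros (f & Mf & Hf & ->); apply attempt_unique in Hf; auto; subst f.
      rewrite <- FH; auto.
    - intros ->; exists (graph (trcl w) (F u)); split; auto.
      split; [|rewrite <- FH; auto].
      apply attempt_graph; auto; intros v Hv; apply IHF; rewrite mem_trcl in *.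
      apply t_trans with w; auto. }
  destruct (zf_replacement HM R D Mt) as (b & Mb & Hb).
  { intros w Hw; exists (op w (F u w)).
    assert (M (op w (F u w))) by (apply (M_op_intro HM); [apply IHg | apply IHF]; auto).
    repeat split; auto; [apply K; auto | intros z _ Hz; apply K in Hz; auto]. }
  replace (graph (trcl y) (F u)) with (sep b (fun z => exists w, w ∈ trcl y /\ R w z)).
  - apply (M_sep HM); auto; defn HM; apply (Def_app2 R D); defn HM.
  - apply set_ext; intros z; rewrite mem_sep, mem_graph; split.
    + intros [_ (w & Hw & Hz)]; exists w; split; auto; apply K; auto.
    + intros (w & Hw & ->); destruct (Hb w Hw) as (z & Hz & E).
      assert (E' := E); apply K in E'; auto; subst z; eauto.
Qed.

Lemma recursion_closed u x : M u -> M x -> M (F u x).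
Proof. intros Mu Mx; rewrite FH by auto; apply M_H; auto using recursion_graph. Qed.

Lemma recursion : DefF M (fun e => F (e 0) (e 1)).
Proof.
  split; [intros e He; apply recursion_closed; apply He|].
  apply Def_ext with (fun e => exists f, M f /\ (attempt (e 1) (e 2) f /\ e 0 = H (e 1) (e 2) f)).
  - intros e He; split.
    + intros (f & Mf & Hf & ->); apply attempt_unique in Hf; auto; subst f.
      rewrite <- FH; auto.
    + intros ->; exists (graph (trcl (e 2)) (F (e 1))); split; [apply recursion_graph; auto|].
      split; [|apply FH; auto]; apply attempt_graph; auto.
      intros w Hw; apply recursion_closed; auto.
      apply (zf_trans HM) with (2 := Hw), (M_trcl HM), He.
  - defn HM; [apply (Def_app3 attempt Def_attempt); defn HM | apply Def_H; defn HM].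
Qed.

End Recursion.

(** * Ordinals, ranks and enumerations *)

Lemma ord_in a x : ordinal a -> x ∈ a -> ordinal x.
Proof.
  intros [T1 T2] Hx; split; [exact (T2 x Hx)|].
  intros y Hy z Hz; apply (T2 y); auto; apply (T1 x); auto.
Qed.

Lemma ord_trans a x y : ordinal a -> y ∈ x -> x ∈ a -> y ∈ a.
Proof. intros [T _] Hy Hx; exact (T x Hx y Hy). Qed.

Lemma ord_total a b : ordinal a -> ordinal b -> a ∈ b \/ a = b \/ b ∈ a.
Proof.
  revert b; induction a as [a IHa] using (well_founded_ind mem_wf).
  intros b; induction b as [b IHb] using (well_founded_ind mem_wf); intros Oa Ob.
  destruct (classic (a ∈ b)) as [|Nab]; auto; destruct (classic (b ∈ a)) as [|Nba]; auto.
  right; left; apply set_ext; intros z; split; intros Hz.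
  - destruct (IHa z Hz b) as [H|[->|H]]; try exact (ord_in Oa Hz); auto; try contradiction.
    elim Nba; exact (ord_trans Oa H Hz).
  - destruct (IHb z Hz) as [H|[->|H]]; try exact (ord_in Ob Hz); auto; try contradiction.
    elim Nab; exact (ord_trans Ob H Hz).
Qed.

Lemma ord_subset a b : ordinal a -> ordinal b -> a ⊆ b -> a ∈ b \/ a = b.
Proof.
  intros Oa Ob H; destruct (ord_total Oa Ob) as [|[|K]]; auto.
  elim (mem_irrefl (H b K)).
Qed.

Lemma ord_leq a b : ordinal a -> ordinal b -> ~ a ∈ b -> b ⊆ a.
Proof.
  intros Oa Ob H; destruct (ord_total Oa Ob) as [|[->|K]]; [contradiction | intros x; auto|].
  exact (proj1 Oa b K).
Qed.

Lemma ord_of_ords a : (forall x, x ∈ a -> ordinal x) -> (forall x y, y ∈ x -> x ∈ a -> y ∈ a) ->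
  ordinal a.
Proof.
  intros H T; split; [intros x Hx y Hy; eauto | intros x Hx; apply H, Hx].
Qed.

Lemma ord_succ a : ordinal a -> ordinal (succ a).
Proof.
  intros Oa; apply ord_of_ords; intros x.
  - rewrite mem_succ; intros [Hx | ->]; auto; apply (ord_in Oa Hx).
  - intros y Hy; rewrite !mem_succ; intros [Hx | ->]; auto; left; exact (ord_trans Oa Hy Hx).
Qed.

Lemma ord_empty : ordinal empty.
Proof. split; intros x Hx; elim (empty_spec Hx). Qed.

Lemma ord_num n : ordinal (num n).
Proof. induction n; [apply ord_empty | apply ord_succ; auto]. Qed.

Lemma mem_num n x : x ∈ num n <-> exists m, m < n /\ x = num m.
Proof.
  induction n as [|n IH]; cbn.
  - split; [intros H; elim (empty_spec H) | intros (m & H & _); lia].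
  - rewrite mem_succ, IH; split.
    + intros [(m & H & ->) | ->]; [exists m | exists n]; auto.
    + intros (m & H & ->); destruct (Nat.eq_dec m n); [subst; auto|].
      left; exists m; split; auto; lia.
Qed.

Lemma ord_omega : ordinal omega.
Proof.
  apply ord_of_ords; intros x.
  - rewrite mem_omega; intros [n ->]; apply ord_num.
  - intros y Hy Hx; apply mem_omega in Hx; destruct Hx as [n ->]; apply mem_num in Hy; destruct Hy as (m & _ & ->); apply mem_omega; eauto.
Qed.

Lemma trcl_ord a : ordinal a -> trcl a = a.
Proof.
  intros Oa; apply set_ext; intros z; rewrite mem_trcl; split; [|apply t_step].
  intros H; apply clos_trans_t1n in H; induction H; auto.
  apply ord_trans with y; auto.
Qed.

(** Membership is well-founded in the universe, so this holds for arbitrary predicates, definable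
    over a model or not. *)
Lemma least_ord (C : set -> Prop) a : ordinal a -> C a ->
  exists b, ordinal b /\ C b /\ forall c, c ∈ b -> ~ C c.
Proof.
  induction a as [a IH] using (well_founded_ind mem_wf); intros Oa Ca.
  destruct (classic (exists b, b ∈ a /\ C b)) as [(b & Hb & Cb)|N].
  - apply (IH b); auto; exact (ord_in Oa Hb).
  - exists a; split; auto; split; auto; exact (fun c Hc Cc => N (ex_intro _ c (conj Hc Cc))).
Qed.

(** The union of all values at [x], hence the value itself when there is exactly one. This makes
    application a total operation. *)
Definition app (f x : set) : set := bigcup (sep (bigcup (bigcup f)) (fun v => op x v ∈ f)).

Lemma app_eq f x v : op x v ∈ f -> (forall v', op x v' ∈ f -> v' = v) -> app f x = v.
Proof.
  intros Hv U; unfold app; apply set_ext; intros z; rewrite mem_bigcup; split.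
  - intros (w & Hw & Hz); apply mem_sep in Hw; destruct Hw as [_ Hw].
    apply U in Hw; subst; auto.
  - intros Hz; exists v; split; auto; apply mem_sep; split; auto.
    apply mem_bigcup; exists (pair x v); split; [|apply mem_pair; auto].
    apply mem_bigcup; exists (op x v); split; auto; apply mem_pair; auto.
Qed.

Lemma app_graph A F x : x ∈ A -> app (graph A F) x = F x.
Proof.
  intros Hx; apply app_eq; [apply op_graph; auto|].
  intros v Hv; apply op_graph in Hv; tauto.
Qed.

(** Recursion in the universe, with the earlier values handed to the step as a set-coded graph. In
    this form the lemma [recursion] applies and gives definability over every model in which the
    step is definable. *)
Definition wrec (H : set -> set -> set) : set -> set :=
  Fix tc_wf (fun _ => set) (fun x rec =>
    H x (setof (fun z => exists y (h : tc y x), z = op y (rec y h)))).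

Lemma wrec_eq H x : wrec H x = H x (graph (trcl x) (wrec H)).
Proof.
  unfold wrec at 1; rewrite Fix_eq.
  - fold (wrec H); f_equal; apply setof_ext; intros z; split.
    + intros (y & h & E); exists y; rewrite mem_trcl; auto.
    + intros (y & h & E); rewrite mem_trcl in h; exists y, h; auto.
  - intros y f g E.
    replace f with g; auto.
    apply functional_extensionality_dep; intros z.
    apply functional_extensionality_dep; intros h; auto.
Qed.

Definition rank : set -> set :=
  wrec (fun x f => bigcup (image x (fun y => succ (app f y)))).

Lemma mem_rank x z : z ∈ rank x <-> exists y, y ∈ x /\ z ∈ succ (rank y).
Proof.
  unfold rank; rewrite wrec_eq, mem_bigcup; fold rank.
  assert (K : forall y, y ∈ x -> app (graph (trcl x) rank) y = rank y).
  { intros y Hy; apply app_graph, mem_trcl, t_step, Hy. }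
  split.
  - intros (w & Hw & Hz); apply mem_image in Hw; destruct Hw as (y & Hy & ->).
    rewrite K in Hz; eauto.
  - intros (y & Hy & Hz); exists (succ (rank y)); rewrite mem_image; split; auto.
    exists y; rewrite K; auto.
Qed.

Lemma ord_rank x : ordinal (rank x).
Proof.
  induction x as [x IH] using (well_founded_ind mem_wf).
  apply ord_of_ords; intros z.
  - rewrite mem_rank; intros (y & Hy & Hz); exact (ord_in (ord_succ (IH y Hy)) Hz).
  - intros w Hw Hz; apply mem_rank in Hz; destruct Hz as (y & Hy & Hz); rewrite mem_rank; exists y; split; auto.
    exact (ord_trans (ord_succ (IH y Hy)) Hw Hz).
Qed.

Lemma rank_mem y x : y ∈ x -> rank y ∈ rank x.
Proof. intros H; apply mem_rank; exists y; rewrite mem_succ; auto. Qed.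

(** [hier M a] is the level [V_a] of the cumulative hierarchy of [M], for an ordinal [a]. *)
Definition hier (M : set -> Prop) : set -> set :=
  wrec (fun x f => bigcup (image x (fun y => Pow M (app f y)))).

Lemma mem_hier M x z : z ∈ hier M x <-> exists y, y ∈ x /\ M z /\ z ⊆ hier M y.
Proof.
  unfold hier; rewrite wrec_eq, mem_bigcup; fold (hier M).
  assert (K : forall y, y ∈ x -> app (graph (trcl x) (hier M)) y = hier M y).
  { intros y Hy; apply app_graph, mem_trcl, t_step, Hy. }
  split.
  - intros (w & Hw & Hz); apply mem_image in Hw; destruct Hw as (y & Hy & ->).
    rewrite K in Hz by auto; apply mem_Pow in Hz; eauto.
  - intros (y & Hy & Hz); exists (Pow M (hier M y)); rewrite mem_image, mem_Pow; split; auto.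
    exists y; rewrite K; auto.
Qed.

(** Kept apart from [zf_model]: the forcing theorem and the ZF axioms of [V[G]] are derived from ZF
    in [V], and choice passes to [V[G]] in a separate step. *)
Definition choice (M : set -> Prop) : Prop := forall a, M a ->
  (forall x, x ∈ a -> exists z, z ∈ x) ->
  (forall x y z, x ∈ a -> y ∈ a -> z ∈ x -> z ∈ y -> x = y) ->
  exists c, M c /\ forall x, x ∈ a -> exists! z, z ∈ x /\ z ∈ c.

(** * Collection, enumeration and well-ordering in a model *)

Section ZF.
Variable M : set -> Prop.
Hypothesis HM : zf_model M.

Lemma M_bigcup a : M a -> M (bigcup a).
Proof. apply HM. Qed.

Lemma M_empty : M empty.
Proof.
  apply (zf_trans HM (zf_infinity HM)), mem_omega; exists 0; auto.
Qed.

Lemma M_num n : M (num n).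
Proof. apply (zf_trans HM (zf_infinity HM)), mem_omega; eauto. Qed.

Lemma DefF_app : DefF M (fun e => app (e 0) (e 1)).
Proof. unfold app; defn HM. Qed.

Lemma Def_ordinal : Def M (fun e => ordinal (e 0)).
Proof. unfold ordinal; defn HM. Qed.

Lemma DefF_wrec (H : set -> set -> set) : DefF M (fun e => H (e 0) (e 1)) ->
  DefF M (fun e => wrec H (e 0)).
Proof.
  intros HH; apply (DefF_app2 (fun _ x => wrec H x) (F1 := fun e => e 0)); [|apply DefF_var..].
  apply (recursion HM (fun _ x => wrec H x) (fun _ => H)); [intros; apply wrec_eq|].
  apply (DefF_app2 H HH); apply DefF_var.
Qed.

Lemma DefF_rank : DefF M (fun e => rank (e 0)).
Proof. apply DefF_wrec; defn HM; apply (DefF_app2 app DefF_app); defn HM. Qed.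

Lemma DefF_hier : DefF M (fun e => hier M (e 0)).
Proof. apply DefF_wrec; defn HM; apply (DefF_app2 app DefF_app); defn HM. Qed.

Lemma M_rank x : M x -> M (rank x).
Proof. intros Ma; exact (proj1 DefF_rank (fun _ => x) (fun _ => Ma)). Qed.

Lemma hier_rank x : M x -> x ⊆ hier M (rank x).
Proof.
  induction x as [x IH] using (well_founded_ind mem_wf); intros Mx z Hz.
  assert (Mz := zf_trans HM Mx Hz).
  apply mem_hier; exists (rank z); repeat split; auto using rank_mem; exact (IH z Hz Mz).
Qed.

(** Scott's trick: witnesses need not be unique, but the least [o] such that some witness is
    included in [hier M o] is, so replacement applies to these ordinals. *)
Lemma collection (R : set -> set -> Prop) a : Def M (fun e => R (e 0) (e 1)) -> M a ->
  (forall x, x ∈ a -> exists y, M y /\ R x y) ->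
  exists b, M b /\ forall x, x ∈ a -> exists y, y ∈ b /\ R x y.
Proof.
  intros HR Ma H.
  pose (C := fun x o => exists y, y ∈ Pow M (hier M o) /\ R x y).
  assert (DC : Def M (fun e => C (e 0) (e 1))).
  { unfold C; defn HM; [apply (DefF_app1 (hier M) DefF_hier) | apply (Def_app2 R HR)]; defn HM. }
  destruct (zf_replacement HM (fun x o => ordinal o /\ C x o /\ forall o', o' ∈ o -> ~ C x o')
    (a := a)) as (b & Mb & Hb); auto.
  - defn HM; [apply (Def_app1 ordinal Def_ordinal) | apply (Def_app2 C DC)..]; defn HM.
  - intros x Hx; destruct (H x Hx) as (y & My & Hxy).
    destruct (@least_ord (fun o => M o /\ C x o) (rank y)) as (o & Oo & [Mo Co] & L).
    + apply ord_rank.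
    + split; [apply M_rank; auto|]; exists y; rewrite mem_Pow; auto using hier_rank.
    + exists o; split; auto; split; [split; auto; split; auto|].
      * intros o' Ho' Co'; apply (L o' Ho'); split; auto; exact (zf_trans HM Mo Ho').
      * intros o' Mo' (Oo' & Co' & L'); destruct (ord_total Oo' Oo) as [K|[K|K]]; auto.
        -- elim (L o' K); auto.
        -- elim (L' o K); auto.
  - exists (bigcup (image b (fun o => Pow M (hier M o)))); split.
    + apply M_bigcup, (M_image HM); auto; defn HM.
      apply (DefF_app1 (hier M) DefF_hier); defn HM.
    + intros x Hx; destruct (Hb x Hx) as (o & Ho & _ & (y & Hy & Hxy) & _).
      exists y; split; auto; apply mem_bigcup; exists (Pow M (hier M o)); split; auto.
      apply mem_image; eauto.
Qed.

Definition remainder (X f : set) : set := sep X (fun y => ~ exists w, op w y ∈ f).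

(** [ch] picks the next element; it is a choice function in [well_order] and the
    minimum of a set of ordinals in [collapse]. *)
Definition enumeration (ch : set -> set) (X : set) : set -> set :=
  wrec (fun _ f => ch (remainder X f)).

Lemma enumeration_eq ch X a : ordinal a ->
  enumeration ch X a = ch (remainder X (graph a (enumeration ch X))).
Proof.
  intros Oa; unfold enumeration at 1; rewrite wrec_eq, trcl_ord; auto.
Qed.

Lemma DefF_remainder : DefF M (fun e => remainder (e 0) (e 1)).
Proof. unfold remainder; defn HM. Qed.

Lemma DefF_enumeration ch X : M X -> DefF M (fun e => ch (e 0)) ->
  DefF M (fun e => enumeration ch X (e 0)).
Proof.
  intros MX Hch.
  apply DefF_wrec; apply (DefF_app1 ch Hch), (DefF_app2 remainder DefF_remainder); defn HM.
Qed.

Lemma mem_remainder X F a y :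
  y ∈ remainder X (graph a F) <-> y ∈ X /\ forall w, w ∈ a -> y <> F w.
Proof.
  unfold remainder; rewrite mem_sep; split; intros [Hy N]; split; auto.
  - intros w Hw ->; apply N; exists w; apply op_graph; auto.
  - intros [w Hw]; apply op_graph in Hw; destruct Hw; apply (N w); auto.
Qed.

(** If [X] were never exhausted, the enumeration would be injective on all ordinals of [M].
    Replacement for its inverse would then make these ordinals a set of [M], which is the
    Burali-Forti contradiction. The length [o] is the first stage at which nothing remains. *)
Lemma enumerate ch X : M X -> DefF M (fun e => ch (e 0)) ->
  (forall Y, M Y -> Y ⊆ X -> (exists y, y ∈ Y) -> ch Y ∈ Y) ->
  exists o F, M o /\ ordinal o /\ DefF M (fun e => F (e 0)) /\
    (forall a, a ∈ o -> F a ∈ X /\ F a = ch (remainder X (graph a F))) /\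
    (forall a a', a ∈ o -> a' ∈ a -> F a <> F a') /\
    (forall x, x ∈ X -> exists a, a ∈ o /\ x = F a).
Proof.
  intros MX Hch Hc; pose (F := enumeration ch X).
  assert (DF := @DefF_enumeration ch X MX Hch); fold F in DF.
  assert (E : forall a, ordinal a -> F a = ch (remainder X (graph a F))).
  { intros a Oa; apply enumeration_eq; auto. }
  assert (MR : forall a, M a -> M (remainder X (graph a F))).
  { intros a Ma; apply (DefF_closed HM), (DefF_app2 remainder DefF_remainder); defn HM. }
  assert (Step : forall a, M a -> ordinal a -> (exists y, y ∈ remainder X (graph a F)) ->
    F a ∈ X /\ forall a', a' ∈ a -> F a <> F a').
  { intros a Ma Oa K; rewrite E by auto; apply mem_remainder, Hc; auto.
    intros y Hy; apply mem_remainder in Hy; tauto. }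
  assert (Full : exists o, M o /\ ordinal o /\ ~ exists y, y ∈ remainder X (graph o F)).
  { apply NNPP; intros N.
    assert (Step' : forall a, M a -> ordinal a -> F a ∈ X /\ forall a', a' ∈ a -> F a <> F a').
    { intros a Ma Oa; apply Step; auto; apply NNPP; intros K; apply N; eauto. }
    (* Replacement wants a value at every element of [X]; those that the enumeration misses get
       [empty]. *)
    pose (B := fun x a => (ordinal a /\ F a = x) \/
                          (~ (exists a', M a' /\ (ordinal a' /\ F a' = x)) /\ a = empty)).
    destruct (zf_replacement HM B (a := X)) as (b & Mb & Hb); auto.
    - unfold B; assert (DO := Def_ordinal); assert (ME := M_empty).
      defn HM; try apply (Def_app1 ordinal DO); try apply (DefF_app1 F DF); defn HM.
    - intros x Hx; destruct (classic (exists a', M a' /\ (ordinal a' /\ F a' = x)))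
        as [(a & Ma & Oa & Ea)|K].
      + exists a; split; auto; split; [left; auto|].
        intros a' Ma' [[Oa' Ea']|[K _]]; [|elim K; eauto].
        destruct (ord_total Oa' Oa) as [L|[L|L]]; auto.
        * elim (proj2 (Step' a Ma Oa) a' L); congruence.
        * elim (proj2 (Step' a' Ma' Oa') a L); congruence.
      + exists empty; split; [apply M_empty|]; split; [right; auto|].
        intros a' Ma' [[Oa' Ea']|[_ E']]; auto; elim K; eauto.
    - pose (c := sep b ordinal).
      assert (Mc : M c) by (apply (M_sep HM); auto using Def_ordinal).
      assert (Hall : forall a, M a -> ordinal a -> a ∈ c).
      { intros a Ma Oa; destruct (Hb (F a)) as (a' & Ha' & K); [apply Step'; auto|].
        apply mem_sep; split; auto.
        destruct K as [[Oa' Ea']|[K _]]; [|elim K; eauto].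
        assert (Ma' := zf_trans HM Mb Ha').
        replace a with a'; auto; destruct (ord_total Oa' Oa) as [L|[L|L]]; auto.
        + elim (proj2 (Step' a Ma Oa) a' L); congruence.
        + elim (proj2 (Step' a' Ma' Oa') a L); congruence. }
      assert (Oc : ordinal c).
      { apply ord_of_ords; [intros x Hx; apply mem_sep in Hx; tauto|].
        intros x y Hy Hx; apply Hall; [exact (zf_trans HM (zf_trans HM Mc Hx) Hy)|].
        apply mem_sep in Hx; apply (ord_in (proj2 Hx) Hy). }
      exact (mem_irrefl (Hall c Mc Oc)). }
  destruct Full as (o0 & Mo0 & Oo0 & Fo0).
  destruct (@least_ord (fun o => M o /\ ~ exists y, y ∈ remainder X (graph o F)) o0)
    as (o & Oo & [Mo Fo] & L); auto.
  exists o, F; split; auto; split; auto; split; auto.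
  assert (K : forall a, a ∈ o -> F a ∈ X /\ forall a', a' ∈ a -> F a <> F a').
  { intros a Ha; assert (Ma := zf_trans HM Mo Ha); apply Step; auto; [apply (ord_in Oo Ha)|].
    apply NNPP; intros K; apply (L a Ha); auto. }
  repeat split.
  - apply K; auto.
  - apply E, (ord_in Oo); auto.
  - intros a a' Ha; apply K; auto.
  - intros x Hx; apply NNPP; intros N; apply Fo; exists x; apply mem_remainder; split; auto.
    intros w Hw ->; eauto.
Qed.

Lemma choice_function X : choice M -> M X -> exists c, M c /\
  forall Y, M Y -> Y ⊆ X -> (exists y, y ∈ Y) -> app c Y ∈ Y.
Proof.
  intros AC MX.
  (* Tagging each nonempty [Y] with itself makes the family disjoint, as this form of the axiom of
     choice requires. *)
  pose (fam := image (sep (Pow M X) (fun Y => exists y, y ∈ Y)) (fun Y => prod (pair Y Y) Y)).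
  assert (Mfam : M fam).
  { unfold fam; apply (DefF_closed HM); defn HM. }
  destruct (AC fam Mfam) as (c & Mc & Hc).
  - intros x Hx; apply mem_image in Hx; destruct Hx as (Y & HY & ->).
    apply mem_sep in HY; destruct HY as [_ [y Hy]]; exists (op Y y); apply mem_prod.
    exists Y, y; rewrite mem_pair; auto.
  - intros x y z Hx Hy Hzx Hzy; apply mem_image in Hx, Hy.
    destruct Hx as (Y & HY & ->), Hy as (Y' & HY' & ->); apply mem_prod in Hzx, Hzy.
    destruct Hzx as (u & v & Hu & Hv & ->), Hzy as (u' & v' & Hu' & Hv' & E).
    apply op_inj in E; apply mem_pair in Hu, Hu'; destruct E; subst.
    destruct Hu as [->| ->], Hu' as [->| ->]; auto.
  (* The selector may have elements outside the family, which could spoil the uniqueness of the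
     value at [Y]. *)
  - exists (sep c (fun z => z ∈ bigcup fam)); split.
    { apply (M_sep HM); auto; defn HM. }
    intros Y MY HY Hne; destruct (Hc (prod (pair Y Y) Y)) as (z & [Hz Hzc] & U).
    { apply mem_image; exists Y; split; auto; apply mem_sep; rewrite mem_Pow; auto. }
    apply mem_prod in Hz; destruct Hz as (Y' & y & HY' & Hy & ->).
    assert (Y' = Y) by (apply mem_pair in HY'; tauto); subst Y'.
    rewrite (@app_eq _ Y y); auto.
    + apply mem_sep; split; auto; apply mem_bigcup; exists (prod (pair Y Y) Y).
      rewrite mem_prod; split; [|exists Y, y; auto].
      apply mem_image; exists Y; split; auto; apply mem_sep; rewrite mem_Pow; auto.
    + intros v Hv; apply mem_sep in Hv; destruct Hv as [Hvc Hv].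
      assert (op Y v ∈ prod (pair Y Y) Y).
      { apply mem_bigcup in Hv; destruct Hv as (w & Hw & Hv); apply mem_image in Hw.
        destruct Hw as (Z & _ & ->); assert (Hv' := Hv); apply mem_prod in Hv.
        destruct Hv as (Z' & v' & HZ & Hv & E); apply op_inj in E; destruct E; subst.
        apply mem_pair in HZ; destruct HZ as [->| ->]; auto. }
      specialize (U (op Y v) (conj H Hvc)); apply op_inj in U; destruct U; auto.
Qed.

Lemma well_order X : choice M -> M X ->
  exists o F, M o /\ ordinal o /\ DefF M (fun e => F (e 0)) /\
    (forall a, a ∈ o -> F a ∈ X) /\
    (forall a a', a ∈ o -> a' ∈ o -> F a = F a' -> a = a') /\
    (forall x, x ∈ X -> exists a, a ∈ o /\ x = F a).
Proof.
  intros AC MX; destruct (choice_function AC MX) as (c & Mc & Hc).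
  destruct (enumerate (app c) MX) as (o & F & Mo & Oo & DF & H1 & H2 & H3); auto.
  { apply (DefF_app2 app DefF_app); defn HM. }
  exists o, F; do 3 (split; [assumption|]); split; [|split; [|assumption]].
  - intros a Ha; apply H1; auto.
  - intros a a' Ha Ha' E; destruct (ord_total (ord_in Oo Ha) (ord_in Oo Ha')) as [K|[K|K]]; auto.
    + elim (H2 a' a Ha' K); auto.
    + elim (H2 a a' Ha K); auto.
Qed.

Definition least (Y : set) : set := bigcup (sep Y (fun y => forall z, z ∈ Y -> y ⊆ z)).

Lemma least_mem X Y : ordinal X -> Y ⊆ X -> (exists y, y ∈ Y) ->
  least Y ∈ Y /\ forall z, z ∈ Y -> least Y ⊆ z.
Proof.
  intros OX HY [y Hy].
  destruct (@least_ord (fun z => z ∈ Y) y) as (m & Om & Hm & L); auto.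
  { apply (ord_in OX); auto. }
  assert (Lm : forall z, z ∈ Y -> m ⊆ z).
  { intros z Hz; apply ord_leq; auto; [apply (ord_in OX); auto|]; intros K; exact (L z K Hz). }
  replace (least Y) with m; auto; unfold least; apply set_ext; intros z.
  rewrite mem_bigcup; split.
  - intros Hz; exists m; split; auto; apply mem_sep; auto.
  - intros (m' & Hm' & Hz); apply mem_sep in Hm'; destruct Hm' as [Hm' L']; apply (L' m); auto.
Qed.

Lemma collapse X a : M X -> ordinal a -> X ⊆ a ->
  exists o F, M o /\ ordinal o /\ DefF M (fun e => F (e 0)) /\
    (forall a, a ∈ o -> F a ∈ X) /\
    (forall a a', a ∈ o -> a' ∈ a -> F a' ∈ F a) /\
    (forall x, x ∈ X -> exists a, a ∈ o /\ x = F a).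
Proof.
  intros MX Oa HX.
  destruct (enumerate (least) MX) as (o & F & Mo & Oo & DF & H1 & H2 & H3); auto.
  { unfold least; defn HM. }
  { intros Y MY HY Hne; apply (least_mem (X := a)); auto; intros y Hy; apply HX, HY, Hy. }
  exists o, F; do 3 (split; [assumption|]); split; [|split; [|assumption]].
  - intros b Hb; apply H1; auto.
  - intros b b' Hb Hb'.
    assert (Ho' := ord_trans Oo Hb' Hb).
    (* At the earlier stage [b'] the element [F b] was still available, so the minimum taken there
       is at most [F b]. *)
    assert (Hr : F b ∈ remainder X (graph b' F)).
    { apply mem_remainder; split; [apply H1; auto|]; intros w Hw.
      apply H2; auto; exact (ord_trans (ord_in Oo Hb) Hw Hb'). }
    destruct (@least_mem a (remainder X (graph b' F))) as [K1 K2]; auto.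
    { intros y Hy; apply mem_remainder in Hy; apply HX; tauto. }
    { eauto. }
    specialize (K2 _ Hr); rewrite <- (proj2 (H1 b' Ho')) in K2.
    apply ord_subset in K2.
    + destruct K2 as [|K2]; auto; elim (H2 b b' Hb Hb'); auto.
    + apply (ord_in Oa), HX, H1; auto.
    + apply (ord_in Oa), HX, H1; auto.
Qed.

End ZF.

(** * The forcing theorem *)

Lemma rel_ext A B (Q Q' : set -> set -> Prop) :
  (forall x y, x ∈ A -> y ∈ B -> (Q x y <-> Q' x y)) -> rel A B Q = rel A B Q'.
Proof.
  intros H; apply set_ext; intros z; rewrite !mem_rel.
  split; intros (x & y & Hx & Hy & K & ->); exists x, y; split; auto; split; auto; split; auto;
    apply (H x y); auto.
Qed.

Lemma le_car P : is_poset P -> forall p q, le P p q -> p ∈ car P /\ q ∈ car P.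
Proof.
  intros HP p q H; apply (po_dom HP) in H; destruct H as (x & y & Hx & Hy & E).
  apply op_inj in E; destruct E; subst; auto.
Qed.

Section Forcing.
Variables (V : set -> Prop) (P : poset).
Hypotheses (HV : zf_model V) (HP : is_poset P) (VP : V (code P)).

Lemma V_car : V (car P).
Proof. apply (M_op HV) in VP; tauto. Qed.

Lemma V_leq : V (leq P).
Proof. apply (M_op HV) in VP; destruct VP as [_ H]; apply (M_op HV) in H; tauto. Qed.

Lemma V_one : V (one P).
Proof. apply (M_op HV) in VP; destruct VP as [_ H]; apply (M_op HV) in H; tauto. Qed.

Lemma V_cond p : p ∈ car P -> V p.
Proof. apply (zf_trans HV V_car). Qed.

(** For a recursion on [s], the class of all [(t, p)] with [p ||- s = t] is cut down to
    a set, with [t] in the transitive closure of a fixed name. *)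
Definition feq_table (u x : set) : set := rel (tcl u) (car P) (fun t p => feq P x t p).

Definition feq_step (u x f : set) : set := rel (tcl u) (car P) (fun t p =>
  (forall s' a, op s' a ∈ x -> forall q, le P q p -> le P q a ->
     exists r t' b, le P r q /\ op t' b ∈ t /\ le P r b /\ op t' r ∈ app f s') /\
  (forall t' b, op t' b ∈ t -> forall q, le P q p -> le P q b ->
     exists r s' a, le P r q /\ op s' a ∈ x /\ le P r a /\ op t' r ∈ app f s')).

Lemma feq_table_eq u x : feq_table u x = feq_step u x (graph (trcl x) (feq_table u)).
Proof.
  unfold feq_table at 1, feq_step; apply rel_ext; intros t p Ht Hp; rewrite feq_eq.
  assert (K : forall s' a t' b r q, op s' a ∈ x -> op t' b ∈ t -> le P r q ->
    (op t' r ∈ app (graph (trcl x) (feq_table u)) s' <-> feq P s' t' r)).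
  { intros s' a t' b r q Hs Ht' Hr; rewrite app_graph by (apply mem_trcl, (tc_op Hs)).
    unfold feq_table; rewrite op_rel; split; [tauto|]; intros E; split; [|split; auto].
    - apply mem_tcl; left; apply tc_tcl with t; auto; apply (tc_op Ht').
    - apply (le_car HP Hr). }
  split; intros [H1 H2]; split.
  - intros s' a Hs q Hq Hqa; destruct (H1 s' a Hs q Hq Hqa) as (r & t' & b & A & B & C & D).
    exists r, t', b; repeat split; auto; eapply K; eauto.
  - intros t' b Ht' q Hq Hqb; destruct (H2 t' b Ht' q Hq Hqb) as (r & s' & a & A & B & C & D).
    exists r, s', a; repeat split; auto; eapply K; eauto.
  - intros s' a Hs q Hq Hqa; destruct (H1 s' a Hs q Hq Hqa) as (r & t' & b & A & B & C & D).
    exists r, t', b; repeat split; auto; eapply K; eauto.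
  - intros t' b Ht' q Hq Hqb; destruct (H2 t' b Ht' q Hq Hqb) as (r & s' & a & A & B & C & D).
    exists r, s', a; repeat split; auto; eapply K; eauto.
Qed.

Lemma DefF_feq_table : DefF V (fun e => feq_table (e 0) (e 1)).
Proof.
  apply (recursion HV feq_table feq_step); [intros; apply feq_table_eq|].
  assert (V1 := V_car); assert (V2 := V_leq).
  unfold feq_step, le; defn HV; apply (DefF_app2 app (DefF_app HV)); defn HV.
Qed.

(** Outside the carrier [feq] holds vacuously, since [leq P] relates conditions only; the table
    records conditions only. *)
Lemma feq_table_spec s t p : feq P s t p <-> (p ∈ car P -> op t p ∈ feq_table t s).
Proof.
  unfold feq_table; rewrite op_rel, mem_tcl; split; [auto|].
  intros H; destruct (classic (p ∈ car P)) as [Hp|N]; [apply H; auto|].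
  apply feq_eq; split; intros ? ? _ q Hq; apply (le_car HP) in Hq; tauto.
Qed.

Lemma Def_feq : Def V (fun e => feq P (e 0) (e 1) (e 2)).
Proof.
  apply Def_ext with (fun e => e 2 ∈ car P -> op (e 1) (e 2) ∈ feq_table (e 1) (e 0)).
  - intros; symmetry; apply feq_table_spec.
  - assert (V1 := V_car); defn HV; apply (DefF_app2 feq_table DefF_feq_table); defn HV.
Qed.

Lemma Def_forces a : Def V (fun e => forces V P (fun n => e (S n)) a (e 0)).
Proof.
  assert (V1 := V_leq).
  induction a as [i j|i j| |a IHa b IHb|a IHa]; cbn [forces]; unfold le.
  - defn HV; apply (Def_app3 (feq P) Def_feq); defn HV.
  - apply (Def_app3 (feq P) Def_feq); defn HV.
  - defn HV.
  - apply Def_allM.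
    + def_side HV.
    + apply Def_imp; [defn HV|]; apply Def_imp.
      * exact (Def_simple (Def_simple_var V (fun n => match n with O => O | S n => S (S n) end)) IHa).
      * exact (Def_simple (Def_simple_var V (fun n => match n with O => O | S n => S (S n) end)) IHb).
  - apply Def_all.
    apply Def_ext with (2 := Def_simple (Def_simple_var V
      (fun n => match n with O => 1 | 1 => 0 | S n => S n end)) IHa).
    intros e _.
    match goal with |- forces _ _ ?x _ _ <-> forces _ _ ?y _ _ => replace x with y; [tauto|] end.
    apply functional_extensionality; intros [|n]; reflexivity.
Qed.

Lemma Def_forces_at a E : simple V E -> forall F, DefF V F ->
  Def V (fun e => forces V P (E e) a (F e)).
Proof.
  intros HE F HF; apply (Def_sub (fun x e => forces V P (E e) a x) HF).
  refine (Def_simple (E := fun e => scons (e 0) (E (fun n => e (S n)))) _ (Def_forces a)).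
  intros [|n]; [left; exists 0; auto|]; cbn.
  destruct (HE n) as [[i Hi]|[c [Hc Hi]]]; [left; exists (S i) | right; exists c]; auto.
Qed.

Lemma feq_mono {s t p q} : feq P s t p -> le P q p -> feq P s t q.
Proof.
  rewrite !feq_eq; intros [H1 H2] Hq; split.
  - intros s' a Hs r Hr; apply H1; auto; exact (po_trans HP Hr Hq).
  - intros s' a Hs r Hr; apply H2; auto; exact (po_trans HP Hr Hq).
Qed.

Lemma feq_dense s t p : (forall q, le P q p -> exists r, le P r q /\ feq P s t r) -> feq P s t p.
Proof.
  intros H; rewrite feq_eq; split.
  - intros s' a Hs q Hq Hqa; destruct (H q Hq) as (r & Hr & E).
    apply feq_eq in E; destruct E as [E _].
    destruct (E s' a Hs r) as (r' & t' & b & A & B); auto.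
    + apply (po_refl HP), (le_car HP Hr).
    + exact (po_trans HP Hr Hqa).
    + exists r', t', b; split; auto; exact (po_trans HP A Hr).
  - intros s' a Hs q Hq Hqa; destruct (H q Hq) as (r & Hr & E).
    apply feq_eq in E; destruct E as [_ E].
    destruct (E s' a Hs r) as (r' & t' & b & A & B); auto.
    + apply (po_refl HP), (le_car HP Hr).
    + exact (po_trans HP Hr Hqa).
    + exists r', t', b; split; auto; exact (po_trans HP A Hr).
Qed.

Lemma forces_mono a {e p q} : forces V P e a p -> le P q p -> forces V P e a q.
Proof.
  revert e p q; induction a as [i j|i j| |a IHa b IHb|a IHa]; cbn [forces]; intros e p q H Hq; auto.
  - intros r Hr; apply H; exact (po_trans HP Hr Hq).
  - exact (feq_mono H Hq).
  - intros r Hr; apply H; exact (po_trans HP Hr Hq).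
  - intros t Vt; apply IHa with p; auto.
Qed.

(** Used contrapositively in the forcing theorem: if [p] does not force a formula, some extension of
    [p] has no extension forcing it. That [p] is a condition matters for [Bot], where the density
    hypothesis must be applied to [p] itself. *)
Lemma forces_dense a : forall e p, p ∈ car P ->
  (forall q, le P q p -> exists r, le P r q /\ forces V P e a r) -> forces V P e a p.
Proof.
  induction a as [i j|i j| |a IHa b IHb|a IHa]; cbn [forces]; intros e p Hp H.
  - intros q Hq; destruct (H q Hq) as (r & Hr & K).
    destruct (K r) as (r' & t & b & A & B); [apply (po_refl HP), (le_car HP Hr)|].
    exists r', t, b; split; auto; exact (po_trans HP A Hr).
  - apply feq_dense, H.
  - destruct (H p) as (r & _ & []); apply (po_refl HP); auto.
  - intros q Hq Ha; apply IHb; [apply (le_car HP Hq)|]; intros r Hr.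
    destruct (H r) as (s & Hs & K); [exact (po_trans HP Hr Hq)|].
    exists s; split; auto; apply K; [apply (po_refl HP), (le_car HP Hs)|].
    apply forces_mono with q; auto; exact (po_trans HP Hs Hr).
  - intros t Vt; apply IHa; auto; intros q Hq; destruct (H q Hq) as (r & Hr & K); eauto.
Qed.

Section Generic.
Variable G : set.
Hypothesis HG : generic V P G.

Lemma G_car p : p ∈ G -> p ∈ car P.
Proof. apply (fi_sub (proj1 HG)). Qed.

Lemma generic_meets (D : set -> Prop) : Def V (fun e => D (e 0)) ->
  (forall p, p ∈ car P -> exists q, D q /\ le P q p) -> exists p, p ∈ G /\ D p.
Proof.
  intros HD H; destruct (proj2 HG (sep (car P) D)) as (p & Hp & Hd).
  - apply (M_sep HV); auto using V_car.
  - split; [intros p Hp; apply mem_sep in Hp; tauto|]; intros p Hp.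
    destruct (H p Hp) as (q & Dq & Hq); exists q; rewrite mem_sep; repeat split; auto.
    apply (le_car HP Hq).
  - apply mem_sep in Hd; exists p; tauto.
Qed.

(** Adding the conditions incompatible with [p] turns density below [p] into density, and none of
    these can share a filter with [p]. *)
Lemma generic_below (D : set -> Prop) p : Def V (fun e => D (e 0)) -> p ∈ G ->
  (forall q, le P q p -> exists r, le P r q /\ D r) -> exists r, r ∈ G /\ le P r p /\ D r.
Proof.
  intros HD Hp H; assert (V1 := V_leq); assert (V2 := V_cond (G_car Hp)).
  destruct (generic_meets (fun r => (le P r p /\ D r) \/
    ~ exists s, le P s r /\ le P s p)) as (r & Hr & K).
  - unfold le; defn HV.
  - intros q Hq; destruct (classic (exists s, le P s q /\ le P s p)) as [(s & A & B)|N].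
    + destruct (H s B) as (r & Hr & Dr); exists r; split; [|exact (po_trans HP Hr A)].
      left; split; auto; exact (po_trans HP Hr B).
    + exists q; split; auto; apply (po_refl HP), Hq.
  - destruct K as [K|K]; [exists r; auto|].
    destruct (fi_dir (proj1 HG) Hr Hp) as (s & _ & A); elim K; eauto.
Qed.

Lemma val_feq s : V s -> forall t, V t -> (val G s = val G t <-> exists p, p ∈ G /\ feq P s t p).
Proof.
  induction s as [s IH] using (well_founded_ind tc_wf); intros Vs t Vt.
  assert (V1 := V_leq); assert (DQ := Def_feq); split.
  - intros E.
    (* A condition in [bad1] puts some [s'] into [s] although no extension puts it into [t]; [bad2]
       is the symmetric case. A condition with no extension in either class forces the equality. *)
    pose (bad1 := fun p => exists s' a, op s' a ∈ s /\ le P p a /\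
      ~ exists r t' b, le P r p /\ op t' b ∈ t /\ le P r b /\ feq P s' t' r).
    pose (bad2 := fun p => exists t' b, op t' b ∈ t /\ le P p b /\
      ~ exists r s' a, le P r p /\ op s' a ∈ s /\ le P r a /\ feq P s' t' r).
    destruct (generic_meets (fun p => feq P s t p \/ bad1 p \/ bad2 p)) as (p & Hp & K).
    + unfold bad1, bad2, le; defn HV; apply (Def_app3 (feq P) DQ); defn HV.
    + intros p Hp; destruct (classic (feq P s t p)) as [Q|N].
      { exists p; split; auto; apply (po_refl HP), Hp. }
      apply NNPP; intros K; apply N; rewrite feq_eq; split.
      * intros s' a Hs q Hq Hqa; apply NNPP; intros L; apply K; exists q; split; auto.
        right; left; exists s', a; auto.
      * intros s' a Hs q Hq Hqa; apply NNPP; intros L; apply K; exists q; split; auto.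
        right; right; exists s', a; auto.
    + destruct K as [K|[(s' & a & Hs & Ha & N)|(t' & b & Ht & Hb & N)]]; [eauto|..].
      * elim N; assert (Ga := fi_up (proj1 HG) Hp Ha).
        assert (K : val G s' ∈ val G t) by (rewrite <- E; apply mem_val; eauto).
        apply mem_val in K; destruct K as (t' & b & Gb & Ht & K).
        apply (IH s' (tc_op Hs) (M_op_l HV Vs Hs) t' (M_op_l HV Vt Ht)) in K.
        destruct K as (q & Gq & Q).
        destruct (fi_dir (proj1 HG) Gq Hp) as (r & Gr & A & B).
        destruct (fi_dir (proj1 HG) Gr Gb) as (r' & Gr' & A' & B').
        exists r', t', b; repeat split; auto.
        -- exact (po_trans HP A' B).
        -- exact (feq_mono Q (po_trans HP A' A)).
      * elim N; assert (Gb := fi_up (proj1 HG) Hp Hb).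
        assert (K : val G t' ∈ val G s) by (rewrite E; apply mem_val; eauto).
        apply mem_val in K; destruct K as (s' & a & Ga & Hs & K); symmetry in K.
        apply (IH s' (tc_op Hs) (M_op_l HV Vs Hs) t' (M_op_l HV Vt Ht)) in K.
        destruct K as (q & Gq & Q).
        destruct (fi_dir (proj1 HG) Gq Hp) as (r & Gr & A & B).
        destruct (fi_dir (proj1 HG) Gr Ga) as (r' & Gr' & A' & B').
        exists r', s', a; repeat split; auto.
        -- exact (po_trans HP A' B).
        -- exact (feq_mono Q (po_trans HP A' A)).
  - intros (p & Gp & Q); apply feq_eq in Q; destruct Q as [Q1 Q2].
    apply set_ext; intros z; rewrite !mem_val; split.
    + intros (s' & a & Ga & Hs & ->); assert (Vs' := M_op_l HV Vs Hs).
      destruct (fi_dir (proj1 HG) Gp Ga) as (q & Gq & A & B).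
      destruct (@generic_below (fun r => exists t' b, op t' b ∈ t /\ le P r b /\ feq P s' t' r) q)
        as (r & Gr & Hr & t' & b & Ht & Hb & K); auto.
      * unfold le; defn HV; apply (Def_app3 (feq P) DQ); defn HV.
      * intros q' Hq'; destruct (Q1 s' a Hs q') as (r & t' & b & C & D);
          [exact (po_trans HP Hq' A) | exact (po_trans HP Hq' B) | eauto 6].
      * exists t', b; split; [exact (fi_up (proj1 HG) Gr Hb)|]; split; auto.
        apply (IH s' (tc_op Hs) Vs' t' (M_op_l HV Vt Ht)); eauto.
    + intros (t' & b & Gb & Ht & ->); assert (Vt' := M_op_l HV Vt Ht).
      destruct (fi_dir (proj1 HG) Gp Gb) as (q & Gq & A & B).
      destruct (@generic_below (fun r => exists s' a, op s' a ∈ s /\ le P r a /\ feq P s' t' r) q)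
        as (r & Gr & Hr & s' & a & Hs & Ha & K); auto.
      * unfold le; defn HV; apply (Def_app3 (feq P) DQ); defn HV.
      * intros q' Hq'; destruct (Q2 t' b Ht q') as (r & s' & a & C & D);
          [exact (po_trans HP Hq' A) | exact (po_trans HP Hq' B) | eauto 6].
      * exists s', a; split; [exact (fi_up (proj1 HG) Gr Ha)|]; split; auto.
        symmetry; apply (IH s' (tc_op Hs) (M_op_l HV Vs Hs) t' Vt'); eauto.
Qed.

Lemma forcing_theorem a : forall e, env V e ->
  (sat (gen_ext V G) (fun n => val G (e n)) a <-> exists p, p ∈ G /\ forces V P e a p).
Proof.
  assert (V1 := V_leq); assert (DQ := Def_feq).
  induction a as [i j|i j| |a IHa b IHb|a IHa]; intros e He; cbn [sat forces].
  - split.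
    + intros H; apply mem_val in H; destruct H as (t & b & Gb & Ht & E).
      apply val_feq in E; [|auto|exact (M_op_l HV (He j) Ht)]; destruct E as (p & Gp & Q).
      destruct (fi_dir (proj1 HG) Gp Gb) as (q & Gq & A & B); exists q; split; auto.
      intros r Hr; exists r, t, b; split; [apply (po_refl HP), (le_car HP Hr)|].
      split; auto; split; [exact (po_trans HP Hr B)|].
      exact (feq_mono Q (po_trans HP Hr A)).
    + intros (p & Gp & K); assert (Vi := He i); assert (Vj := He j).
      destruct (@generic_below (fun r => exists t b, op t b ∈ e j /\ le P r b /\ feq P (e i) t r) p)
        as (r & Gr & Hr & t & b & Ht & Hb & Q); auto.
      * unfold le; defn HV; apply (Def_app3 (feq P) DQ); defn HV.
      * intros q Hq; destruct (K q Hq) as (r & t & b & A & B); eauto 6.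
      * apply mem_val; exists t, b; split; [exact (fi_up (proj1 HG) Gr Hb)|]; split; auto.
        apply val_feq; eauto; exact (M_op_l HV (He j) Ht).
  - apply val_feq; apply He.
  - split; [tauto | intros (p & _ & [])].
  - assert (Fa : forall c, Def V (fun e0 => forces V P e c (e0 0))).
    { intros c; apply (Def_forces_at c (E := fun _ => e)); [|defn HV].
      intros n; right; exists (e n); auto. }
    rewrite IHa, IHb by auto; split.
    + intros H.
      (* A condition that does not force the implication has an extension that forces [a] while
         nothing below it forces [b]. Hence the two alternatives form a dense class. *)
      destruct (generic_meets (fun p => (forall q, le P q p -> forces V P e a q ->
         forces V P e b q) \/ (forces V P e a p /\ ~ exists r, le P r p /\ forces V P e b r)))
        as (p & Gp & K).
      * unfold le; defn HV; first [apply (Def_app1 (forces V P e a) (Fa a)) |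
          apply (Def_app1 (forces V P e b) (Fa b))]; defn HV.
      * intros p Hp; destruct (classic (forall q, le P q p -> forces V P e a q ->
         forces V P e b q)) as [A|N].
        { exists p; split; auto; apply (po_refl HP), Hp. }
        apply NNPP; intros K; apply N; intros q Hq Ha.
        apply forces_dense; [apply (le_car HP Hq)|]; intros r Hr.
        apply NNPP; intros L; apply K; exists r; split; [|exact (po_trans HP Hr Hq)].
        right; split; [exact (forces_mono _ Ha Hr)|].
        intros (s & Hs & C); apply L; eauto.
      * destruct K as [K|[Ha N]]; [eauto|].
        destruct H as (q & Gq & Hb); [eauto|].
        destruct (fi_dir (proj1 HG) Gp Gq) as (r & Gr & A & B); elim N; exists r; split; auto.
        exact (forces_mono _ Hb B).
    + intros (p & Gp & K) (q & Gq & Ha).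
      destruct (fi_dir (proj1 HG) Gp Gq) as (r & Gr & A & B); exists r; split; auto.
      apply K; auto; exact (forces_mono _ Ha B).
  - assert (Sc : forall t, scons (val G t) (fun n => val G (e n)) = fun n => val G (scons t e n)).
    { intros t; apply functional_extensionality; intros [|n]; reflexivity. }
    split.
    + intros H.
      assert (Fa : Def V (fun e0 => forces V P (scons (e0 1) e) a (e0 0))).
      { apply (Def_forces_at a (E := fun e0 => scons (e0 1) e)); [|defn HV].
        intros [|n]; [left; exists 1; auto | right; exists (e n); auto]. }
      (* Likewise, failing to force all instances yields a name [t] and an extension below which the
         instance at [t] is never forced. *)
      destruct (generic_meets (fun p => (forall t, V t -> forces V P (scons t e) a p) \/
         (exists t, V t /\ ~ exists r, le P r p /\ forces V P (scons t e) a r)))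
        as (p & Gp & K).
      * unfold le; defn HV; apply (Def_app2 (fun p t => forces V P (scons t e) a p) Fa); defn HV.
      * intros p Hp; destruct (classic (forall t, V t -> forces V P (scons t e) a p)) as [A|N].
        { exists p; split; auto; apply (po_refl HP), Hp. }
        apply NNPP; intros K; apply N; intros t Vt; apply forces_dense; auto; intros q Hq.
        apply NNPP; intros L; apply K; exists q; split; auto; right; exists t; auto.
      * destruct K as [K|(t & Vt & N)]; [eauto|].
        specialize (H (val G t) (ex_intro _ t (conj Vt eq_refl))); rewrite Sc in H.
        apply IHa in H; [|apply env_scons; auto]; destruct H as (q & Gq & H).
        destruct (fi_dir (proj1 HG) Gp Gq) as (r & Gr & A & B); elim N; exists r; split; auto.
        exact (forces_mono _ H B).
    + intros (p & Gp & K) x (t & Vt & ->); rewrite Sc; apply IHa; [apply env_scons; auto|].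
      eauto.
Qed.

End Generic.
End Forcing.

(** * Generic extensions are models of ZFC *)

Lemma transitive_model_of_zf M : zf_model M -> choice M -> transitive_model M.
Proof.
  intros HM AC; split; try apply HM; auto.
  - intros phi e a He Ha; apply (M_sep HM a (fun x => sat M (scons x e) phi)); auto.
    refine (Def_simple (E := fun e' => scons (e' 0) e) _ (Def_fm M phi)).
    intros [|n]; [left; exists 0; auto | right; exists (e n); auto].
  - intros phi e a He Ha H.
    destruct (zf_replacement HM (fun x y => sat M (scons x (scons y e)) phi) (a := a))
      as (b & Mb & Hb); auto.
    + refine (Def_simple (E := fun e' => scons (e' 0) (scons (e' 1) e)) _ (Def_fm M phi)).
      intros [|[|n]]; [left; exists 0; auto | left; exists 1; auto | right; exists (e n); auto].
    + intros x Hx; destruct (H x Hx) as (y & [My Hy] & U); exists y; repeat split; auto.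
      intros y' My' Hy'; symmetry; apply U; auto.
    + exists b; auto.
Qed.

Definition dom (t : set) : set := bigcup (bigcup t).

Definition val_step (g x f : set) : set :=
  image (sep (dom x) (fun s => exists p, p ∈ g /\ op s p ∈ x)) (app f).

Lemma val_step_eq g x : val g x = val_step g x (graph (trcl x) (val g)).
Proof.
  apply set_ext; intros z; unfold val_step; rewrite mem_val, mem_image; split.
  - intros (s & p & Hp & Hs & ->); exists s; rewrite mem_sep; split.
    + split; eauto; apply (mem_op_l _ _ Hs).
    + rewrite app_graph; auto; apply mem_trcl, (tc_op Hs).
  - intros (s & Hs & ->); apply mem_sep in Hs; destruct Hs as (_ & p & Hp & Hs).
    exists s, p; rewrite app_graph; auto; apply mem_trcl, (tc_op Hs).
Qed.

Lemma DefF_val M (HM : zf_model M) : DefF M (fun e => val (e 0) (e 1)).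
Proof.
  apply (recursion HM val val_step); [intros; apply val_step_eq|].
  unfold val_step, dom; defn HM; apply (DefF_app2 app (DefF_app HM)); defn HM.
Qed.

(** Evaluation of names is absolute: it is a recursion that every model containing the filter and
    the name can carry out. *)
Lemma gen_ext_least M V G : zf_model M -> (forall x, V x -> M x) -> M G ->
  forall y, gen_ext V G y -> M y.
Proof.
  intros HM HV MG y (t & Vt & ->).
  apply (proj1 (DefF_app2 val (DefF_val HM) (DefF_const M _ MG) (DefF_const M _ (HV t Vt)))
    (fun _ => G)); intros _; auto.
Qed.

Section GenericExtension.
Variables (V : set -> Prop) (P : poset).
Hypotheses (HV : zf_model V) (HP : is_poset P) (VP : V (code P)).
Variable G : set.
Hypothesis HG : generic V P G.

Let N := gen_ext V G.
Let V1 := V_leq P HV VP.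
Let V2 := V_car P HV VP.
Let V3 := V_one P HV VP.

Lemma N_val t : V t -> N (val G t).
Proof. intros Vt; exists t; auto. Qed.

Lemma DefF_check : DefF V (fun e => check P (e 0)).
Proof.
  apply (DefF_app2 (fun _ x => check P x) (F1 := fun e => e 0)); [|apply DefF_var..].
  apply (recursion HV (fun _ x => check P x) (fun _ x f => image x (fun y => op (app f y) (one P)))).
  - intros _ x _ _; apply set_ext; intros z; rewrite mem_check, mem_image.
    split; intros (y & Hy & ->); exists y; split; auto;
      rewrite app_graph; auto; apply mem_trcl, t_step, Hy.
  - defn HV; apply (DefF_app2 app (DefF_app HV)); defn HV.
Qed.

Lemma V_check x : V x -> V (check P x).
Proof. intros Vx; exact (proj1 DefF_check (fun _ => x) (fun _ => Vx)). Qed.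

Lemma val_check x : val G (check P x) = x.
Proof.
  induction x as [x IH] using (well_founded_ind mem_wf); apply set_ext; intros z.
  rewrite mem_val; split.
  - intros (s & p & _ & Hs & ->); apply mem_check in Hs; destruct Hs as (y & Hy & E).
    apply op_inj in E; destruct E; subst; rewrite IH; auto.
  - intros Hz; exists (check P z), (one P); split; [apply HG|].
    rewrite IH by auto; split; auto; apply mem_check; eauto.
Qed.

Lemma N_ground x : V x -> N x.
Proof. intros Vx; rewrite <- (val_check x); apply N_val, V_check, Vx. Qed.

Lemma N_trans x y : N x -> y ∈ x -> N y.
Proof.
  intros (t & Vt & ->) Hy; apply mem_val in Hy; destruct Hy as (s & p & _ & Hs & ->).
  apply N_val, (M_op_l HV Vt Hs).
Qed.

(** The canonical name pairs the check name of each condition with that condition. *)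
Lemma N_filter : N G.
Proof.
  exists (image (car P) (fun p => op (check P p) p)); split.
  - apply (DefF_closed HV); defn HV; apply (DefF_app1 (check P) DefF_check); defn HV.
  - apply set_ext; intros z; rewrite mem_val; split.
    + intros Hz; exists (check P z), z; rewrite val_check, mem_image; split; auto; split; auto.
      exists z; split; auto; apply (G_car HG Hz).
    + intros (s & p & Hp & Hs & ->); apply mem_image in Hs; destruct Hs as (q & _ & E).
      apply op_inj in E; destruct E; subst; rewrite val_check; auto.
Qed.

(** The forcing theorem without formulas: a relation definable over [V[G]] gets a forcing relation
    [Phi] that is definable over [V]. Parameters from [V[G]] are replaced by names chosen once and
    for all. *)
Lemma forcing_Def R : Def N R -> exists Phi : (nat -> set) -> set -> Prop,
  (forall E F, simple V E -> DefF V F -> Def V (fun e => Phi (E e) (F e))) /\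
  (forall e p q, Phi e p -> le P q p -> Phi e q) /\
  (forall e, env V e -> (R (fun n => val G (e n)) <-> exists p, p ∈ G /\ Phi e p)).
Proof.
  intros (phi & E & HE & K).
  assert (D : forall n, exists T : (nat -> set) -> set,
    ((exists i, forall e, T e = e i) \/ exists c, V c /\ forall e, T e = c) /\
    forall e, E (fun n => val G (e n)) n = val G (T e)).
  { intros n; destruct (HE n) as [[i Hi]|[c [(t & Vt & ->) Hi]]].
    - exists (fun e => e i); split; [left; eauto|]; intros; apply Hi.
    - exists (fun _ => t); split; [right; eauto|]; intros; apply Hi. }
  pose (E' := fun e n => proj1_sig (constructive_indefinite_description _ (D n)) e).
  assert (HE' : simple V E').
  { intros n; exact (proj1 (proj2_sig (constructive_indefinite_description _ (D n)))). }
  assert (EE : forall e, E (fun n => val G (e n)) = fun n => val G (E' e n)).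
  { intros e; apply functional_extensionality; intros n.
    exact (proj2 (proj2_sig (constructive_indefinite_description _ (D n))) e). }
  clearbody E'; clear D.
  exists (fun e p => forces V P (E' e) phi p); split; [|split].
  - intros E0 F HE0 HF; apply (Def_forces_at HV HP VP phi (E := fun e => E' (E0 e))); auto.
    intros n; destruct (HE' n) as [[i Hi]|[c [Hc Hi]]].
    + destruct (HE0 i) as [[j Hj]|[c [Hc Hj]]]; [left; exists j | right; exists c];
        intros; try split; intros; rewrite ?Hi, ?Hj; auto.
    + right; exists c; auto.
  - intros e p q H Hq; eapply forces_mono; eauto.
  - intros e He; rewrite K, EE by (intros n; apply N_val, He).
    apply (forcing_theorem HV HP VP HG); apply env_simple; auto.
Qed.

Lemma N_sep C a : Def N (fun e => C (e 0)) -> N a -> N (sep a C).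
Proof.
  intros HC (t & Vt & ->); destruct (forcing_Def HC) as (Phi & DPhi & Mono & HPhi).
  exists (rel (dom t) (car P) (fun u p => (exists b, op u b ∈ t /\ le P p b) /\
    Phi (fun _ => u) p)); split.
  - unfold dom, le; apply (DefF_closed HV); defn HV.
    apply DPhi; [intros n; left; exists 1; auto | defn HV].
  - apply set_ext; intros z; rewrite mem_sep, !mem_val; split.
    + intros ((u & b & Gb & Hu & ->) & Cz).
      apply (HPhi (fun _ => u)) in Cz; [|intros _; exact (M_op_l HV Vt Hu)].
      destruct Cz as (p & Gp & H).
      destruct (fi_dir (proj1 HG) Gp Gb) as (q & Gq & A & B).
      exists u, q; split; auto; split; auto; apply op_rel; split; [apply (mem_op_l _ _ Hu)|].
      split; [apply (G_car HG Gq)|]; split; eauto.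
    + intros (u & p & Gp & Hu & ->); apply op_rel in Hu.
      destruct Hu as (_ & _ & (b & Hu & Hb) & H); split.
      * exists u, b; split; auto; exact (fi_up (proj1 HG) Gp Hb).
      * apply (HPhi (fun _ => u)); eauto; intros _; exact (M_op_l HV Vt Hu).
Qed.

(** Attaching the maximum to each [u] makes its value an element whatever the filter is. Sets of
    names in [V] thus become sets in [V[G]], from which pairs, power sets and replacement are
    obtained. *)
Lemma N_image_val b : V b -> exists c, N c /\ forall z, z ∈ c <-> exists u, u ∈ b /\ z = val G u.
Proof.
  intros Vb; exists (val G (image b (fun u => op u (one P)))); split.
  - apply N_val, (DefF_closed HV); defn HV.
  - intros z; rewrite mem_val; split.
    + intros (s & p & _ & Hs & ->); apply mem_image in Hs; destruct Hs as (u & Hu & E).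
      apply op_inj in E; destruct E; subst; eauto.
    + intros (u & Hu & ->); exists u, (one P); split; [apply HG|]; split; auto.
      apply mem_image; eauto.
Qed.

Lemma zf_gen_ext : zf_model N.
Proof.
  split.
  - apply N_trans.
  - apply N_ground, HV.
  - intros x y (s & Vs & ->) (t & Vt & ->).
    destruct (N_image_val (b := pair s t)) as (c & Nc & Hc); [apply HV; auto|].
    replace (pair (val G s) (val G t)) with c; auto; apply set_ext; intros z.
    rewrite Hc, mem_pair; split.
    + intros (u & Hu & ->); apply mem_pair in Hu; destruct Hu; subst; auto.
    + intros [-> | ->]; [exists s | exists t]; rewrite mem_pair; auto.
  - intros a (t & Vt & ->).
    exists (rel (dom (bigcup (dom t))) (car P) (fun r q => exists s p p',
      op s p ∈ t /\ op r p' ∈ s /\ le P q p /\ le P q p')); split.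
    + unfold dom, le; apply (DefF_closed HV); defn HV.
    + apply set_ext; intros z; rewrite mem_bigcup, mem_val; split.
      * intros (y & Hy & Hz); apply mem_val in Hy; destruct Hy as (s & p & Gp & Hs & ->).
        apply mem_val in Hz; destruct Hz as (r & p' & Gp' & Hr & ->).
        destruct (fi_dir (proj1 HG) Gp Gp') as (q & Gq & A & B).
        exists r, q; split; auto; split; auto; apply op_rel; split; [|split].
        -- apply (mem_op_l r p'), mem_bigcup; exists s; split; auto; apply (mem_op_l _ _ Hs).
        -- apply (G_car HG Gq).
        -- exists s, p, p'; auto.
      * intros (r & q & Gq & Hr & ->); apply op_rel in Hr.
        destruct Hr as (_ & _ & s & p & p' & Hs & Hr & A & B).
        exists (val G s); rewrite !mem_val; split.
        -- exists s, p; split; auto; exact (fi_up (proj1 HG) Gq A).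
        -- exists r, p'; split; auto; exact (fi_up (proj1 HG) Gq B).
  - intros a Na; assert (Na' := Na); destruct Na as (t & Vt & Et).
    (* Every subset of [a] in [V[G]] has a name consisting of pairs of an element of [dom t] and a
       condition, so the values of these names cover the power set. *)
    destruct (N_image_val (b := Pow V (prod (dom t) (car P)))) as (c & Nc & Hc).
    { unfold dom; apply (DefF_closed HV); defn HV. }
    replace (Pow N a) with (sep c (fun x => x ⊆ a)).
    + apply N_sep; auto.
      apply Def_ext with (fun e => forall z, N z -> z ∈ e 0 -> z ∈ a).
      * intros e He; split; intros H z Hz; auto; apply H; auto; exact (N_trans (He 0) Hz).
      * apply (Def_all (fun z e => z ∈ e 0 -> z ∈ a)).
        apply Def_imp; apply Def_mem; try apply DefF_var; apply DefF_const; auto.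
    + apply set_ext; intros x; rewrite mem_sep, mem_Pow; split.
      { intros [Hx K]; split; auto; exact (N_trans Nc Hx). }
      intros [Nx Hx]; split; auto; apply Hc.
      destruct (@forcing_Def (fun e => e 0 ∈ x)) as (Phi & DPhi & Mono & HPhi).
      { apply Def_mem; [apply DefF_var | apply DefF_const; auto]. }
      assert (Vs : V (rel (dom t) (car P) (fun u p => Phi (fun _ => u) p))).
      { unfold dom; apply (DefF_closed HV); defn HV.
        apply DPhi; [intros n; left; exists 1; auto | defn HV]. }
      exists (rel (dom t) (car P) (fun u p => Phi (fun _ => u) p)); split.
      { apply mem_Pow; split; auto; intros z Hz; apply mem_rel in Hz; apply mem_prod.
        destruct Hz as (u & p & Hu & Hp & _ & ->); exists u, p; auto. }
      apply set_ext; intros z; rewrite mem_val; split.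
      * intros Hz; assert (Hz' := Hx z Hz); rewrite Et in Hz'; apply mem_val in Hz'.
        destruct Hz' as (u & b & Gb & Hu & ->).
        apply (HPhi (fun _ => u)) in Hz; [|intros _; exact (M_op_l HV Vt Hu)].
        destruct Hz as (p & Gp & H); exists u, p; split; auto; split; auto; apply op_rel.
        split; [apply (mem_op_l _ _ Hu)|]; split; auto; apply (G_car HG Gp).
      * intros (u & p & Gp & Hu & ->); assert (Vu := M_op_l HV Vs Hu); apply op_rel in Hu.
        apply (HPhi (fun _ => u)); [intros _; auto|]; exists p; tauto.
  - apply N_sep.
  - intros R a HR (t & Vt & ->) H.
    destruct (forcing_Def HR) as (Phi & DPhi & Mono & HPhi).
    pose (e2 := fun u v (n : nat) => match n with O => u | _ => v : set end).
    pose (R' := fun z v => exists u p, z = op u p /\ Phi (e2 u v) p).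
    assert (DR : Def V (fun e => R' (e 0) (e 1))).
    { unfold R'; defn HV; apply DPhi; [|defn HV].
      intros [|n]; [left; exists 1; auto | left; exists 3; auto]. }
    (* A value has many names, so collection rather than replacement is applied, to the pairs of an
       element of [dom t] and a condition that forces some name to be its value. *)
    destruct (collection HV R' (a := sep (prod (dom t) (car P)) (fun z => exists v, V v /\ R' z v)))
      as (b & Vb & Hb); auto.
    { unfold dom; apply (DefF_closed HV); defn HV; apply (Def_app2 R' DR); defn HV. }
    { intros z Hz; apply mem_sep in Hz; tauto. }
    destruct (N_image_val Vb) as (c & Nc & Hc); exists c; split; auto.
    intros x Hx; destruct (H x Hx) as (y & (v & Vv & ->) & Hxy & _).
    apply mem_val in Hx; destruct Hx as (u & p' & Gp' & Hu & ->).
    assert (Vu := M_op_l HV Vt Hu).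
    assert (He : forall v, V v -> env V (e2 u v)) by (intros v' Vv' [|n]; auto).
    apply (HPhi _ (He v Vv)) in Hxy; destruct Hxy as (p & Gp & K).
    destruct (Hb (op u p)) as (v' & Hv' & u' & p1 & E & K').
    { apply mem_sep; split; [|exists v; split; auto; exists u, p; auto].
      apply mem_prod; exists u, p; split; [apply (mem_op_l _ _ Hu)|]; split; auto.
      apply (G_car HG Gp). }
    apply op_inj in E; destruct E; subst u' p1.
    exists (val G v'); split; [apply Hc; eauto|].
    apply (HPhi _ (He v' (zf_trans HV Vb Hv'))); eauto.
Qed.

Lemma choice_gen_ext : choice V -> choice N.
Proof.
  intros AC a Na Hne Hdis; assert (HN := zf_gen_ext).
  (* With [t] a name of the union of [a], every candidate is the value of an element of [dom t]. The
     selector takes from each member the element whose name comes first in a well-ordering from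
     [V]. *)
  destruct (zf_union HN _ Na) as (t & Vt & Et).
  assert (Vd : V (dom t)) by (apply HV, HV, Vt).
  destruct (well_order HV (dom t) AC Vd) as (o & F & Vo & Oo & DF & _ & _ & Hon).
  (* The function [F] is definable over [V] only; its graph is a set of [V] and can serve as a
     parameter over [V[G]]. *)
  pose (f := graph o F).
  assert (Nf : N f).
  { apply N_ground; unfold f; apply (DefF_closed HV); defn HV. }
  assert (No := N_ground Vo); assert (NG := N_filter).
  pose (nm := fun b => val G (app f b)).
  assert (Dnm : DefF N (fun e => nm (e 0))).
  { apply (DefF_app2 val (DefF_val HN)); [defn HN|].
    apply (DefF_app2 app (DefF_app HN)); defn HN. }
  exists (sep (bigcup a) (fun z => exists x, x ∈ a /\ z ∈ x /\ exists i, i ∈ o /\ nm i = z /\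
    forall j, j ∈ i -> ~ nm j ∈ x)); split.
  { apply (M_sep HN); [apply HN; auto|]; defn HN; apply (DefF_app1 nm Dnm); defn HN. }
  intros x Hx; destruct (Hne x Hx) as [z Hz].
  assert (Hzb : z ∈ bigcup a) by (apply mem_bigcup; eauto).
  rewrite Et in Hzb; apply mem_val in Hzb; destruct Hzb as (s & p & _ & Hs & ->).
  destruct (Hon s (mem_op_l _ _ Hs)) as (i0 & Hi0 & ->).
  destruct (@least_ord (fun i => i ∈ o /\ nm i ∈ x) i0) as (i & Oi & [Hi Hix] & L).
  { apply (ord_in Oo Hi0). }
  { split; auto; unfold nm, f; rewrite app_graph; auto. }
  assert (L' : forall j, j ∈ i -> ~ nm j ∈ x).
  { intros j Hj K; apply (L j Hj); split; auto; exact (ord_trans Oo Hj Hi). }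
  exists (nm i); split; [split; auto|].
  - apply mem_sep; split; [apply mem_bigcup; eauto|]; exists x; split; auto; split; auto.
    exists i; auto.
  - intros z' [Hz' Hc]; apply mem_sep in Hc; destruct Hc as (_ & x' & Hx' & Hzx' & j & Hj & <- & Lj).
    rewrite (Hdis _ _ _ Hx' Hx Hzx' Hz') in *.
    destruct (ord_total Oi (ord_in Oo Hj)) as [K|[->|K]]; auto.
    + elim (Lj i K Hix).
    + elim (L' j K Hz').
Qed.

End GenericExtension.

Theorem generic_model V P G : transitive_model V -> is_poset P -> V (code P) ->
  generic V P G -> transitive_model (gen_ext V G).
Proof.
  intros HV HP VP HG; assert (HZ := zf_of_transitive_model HV).
  apply transitive_model_of_zf; [apply zf_gen_ext with P | apply choice_gen_ext with P]; auto.
  intros a; apply (tm_choice HV).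
Qed.

(** * Projections of generic filters, and small forcing *)

Lemma mem_push Q pi G q :
  q ∈ push Q pi G <-> q ∈ car Q /\ exists p, p ∈ G /\ le Q (pi p) q.
Proof. apply (mem_setof_sub (a := car Q)); tauto. Qed.

(** For a dense [D] in [Q], the conditions whose image lies below an element of [D] are dense in
    [P]; the condition [p'] of a weak projection provides just this. The map is read through its
    graph, since it is the graph that lies in [V]. *)
Lemma push_generic V P Q pi G : zf_model V -> is_poset P -> is_poset Q ->
  V (code P) -> V (code Q) -> V (graph (car P) pi) -> weak_projection P Q pi ->
  generic V P G -> generic V Q (push Q pi G).
Proof.
  intros HV HP HQ VP VQ Vpi (Hcar & Hord & Hw) HG.
  assert (V1 := V_car P HV VP); assert (V2 := V_leq Q HV VQ); split; [split|].
  - intros q Hq; apply mem_push in Hq; tauto.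
  - apply mem_push; split; [apply (po_one HQ)|]; exists (one P); split; [apply HG|].
    apply (po_max HQ), Hcar, (po_one HP).
  - intros p q Hp Hq; apply mem_push in Hp; apply mem_push; destruct Hp as (_ & r & Hr & K).
    split; [apply (le_car HQ Hq)|]; exists r; split; auto; exact (po_trans HQ K Hq).
  - intros p q Hp Hq; apply mem_push in Hp, Hq.
    destruct Hp as (_ & p' & Gp & A), Hq as (_ & q' & Gq & B).
    destruct (fi_dir (proj1 HG) Gp Gq) as (r & Gr & C & D).
    exists (pi r); split; [|split].
    + assert (K := Hcar r (G_car HG Gr)); apply mem_push; split; auto.
      exists r; split; auto; apply (po_refl HQ K).
    + exact (po_trans HQ (Hord _ _ C) A).
    + exact (po_trans HQ (Hord _ _ D) B).
  - intros D VD [Dsub Dd].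
    destruct (generic_meets HV HP VP HG
      (fun p => exists q, q ∈ D /\ le Q (app (graph (car P) pi) p) q)) as (p & Gp & K).
    + unfold le; defn HV; apply (DefF_app2 app (DefF_app HV)); defn HV.
    + intros p Hp; destruct (Hw p Hp) as (p' & Hp' & Hw').
      destruct (Dd (pi p')) as (q & Dq & Hq); [apply Hcar, (le_car HP Hp')|].
      destruct (Hw' q Hq) as (p'' & Hp'' & K); exists p''; split; auto; exists q; split; auto.
      rewrite app_graph; auto; apply (le_car HP Hp'').
    + destruct K as (q & Dq & K); rewrite app_graph in K by (apply (G_car HG Gp)).
      exists q; split; auto; apply mem_push; eauto.
Qed.

Lemma M_push M Q pi P G : zf_model M -> M (code Q) -> M (graph (car P) pi) -> M G ->
  G ⊆ car P -> M (push Q pi G).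
Proof.
  intros HM MQ Mpi MG HG; assert (M1 := V_car Q HM MQ); assert (M2 := V_leq Q HM MQ).
  replace (push Q pi G) with
    (sep (car Q) (fun q => exists p, p ∈ G /\ op (app (graph (car P) pi) p) q ∈ leq Q)).
  - apply (DefF_closed HM); defn HM; apply (DefF_app2 app (DefF_app HM)); defn HM.
  - apply set_ext; intros q; rewrite mem_sep, mem_push; split; intros (Hq & p & Hp & K);
      (split; [|exists p; split]); auto; rewrite app_graph in *; auto.
Qed.

(** * Functions and comparison of cardinalities *)

Lemma maps_app [f A B x] : maps f A B -> x ∈ A ->
  op x (app f x) ∈ f /\ app f x ∈ B /\ forall y, op x y ∈ f -> y = app f x.
Proof.
  intros [H1 H2] Hx; destruct (H2 x Hx) as (y & Hy & U).
  rewrite (@app_eq f x y Hy U); split; auto; split; auto.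
  destruct (H1 _ Hy) as (x' & y' & [_ K] & E); apply op_inj in E; destruct E; subst; auto.
Qed.

Lemma maps_op [f A B x y] : maps f A B -> op x y ∈ f -> x ∈ A /\ y ∈ B.
Proof.
  intros [H1 _] Hy; destruct (H1 _ Hy) as (x' & y' & K & E); apply op_inj in E.
  destruct E; subst; auto.
Qed.

Lemma maps_graph A B F : (forall x, x ∈ A -> F x ∈ B) -> maps (graph A F) A B.
Proof.
  intros H; split.
  - intros z Hz; apply mem_graph in Hz; destruct Hz as (x & Hx & ->); exists x, (F x); auto.
  - intros x Hx; exists (F x); split; [apply op_graph; auto|].
    intros y Hy; apply op_graph in Hy; tauto.
Qed.

Section Card.
Variable M : set -> Prop.
Hypothesis HM : zf_model M.

Lemma card_le_rel A B R : M A -> M B -> Def M (fun e => R (e 0) (e 1)) ->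
  (forall x, x ∈ A -> exists y, y ∈ B /\ R x y) ->
  (forall x y y', x ∈ A -> y ∈ B -> y' ∈ B -> R x y -> R x y' -> y = y') ->
  (forall x x' y, x ∈ A -> x' ∈ A -> y ∈ B -> R x y -> R x' y -> x = x') -> card_le M A B.
Proof.
  intros MA MB HR Tot Fun Inj; exists (rel A B R); split; [|split; [split|]].
  - apply (M_rel HM); auto; apply (Def_app2 R HR); defn HM.
  - intros z Hz; apply mem_rel in Hz; destruct Hz as (x & y & Hx & Hy & _ & ->).
    exists x, y; auto.
  - intros x Hx; destruct (Tot x Hx) as (y & Hy & K); exists y; split; [apply op_rel; auto|].
    intros y' Hy'; apply op_rel in Hy'; destruct Hy' as (_ & Hy' & K'); eauto.
  - intros x x' y H H'; apply op_rel in H, H'; apply (Inj x x' y); tauto.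
Qed.

Lemma card_le_map A B F : M A -> DefF M (fun e => F (e 0)) -> (forall x, x ∈ A -> F x ∈ B) ->
  (forall x x', x ∈ A -> x' ∈ A -> F x = F x' -> x = x') -> card_le M A B.
Proof.
  intros MA HF H Inj; exists (graph A F); split; [|split].
  - apply (DefF_closed HM); defn HM.
  - apply maps_graph; auto.
  - intros x x' y K K'; apply op_graph in K, K'; apply Inj; try tauto.
    destruct K, K'; congruence.
Qed.

Lemma card_le_elim A B : card_le M A B -> exists F, DefF M (fun e => F (e 0)) /\
  (forall x, x ∈ A -> F x ∈ B) /\ (forall x x', x ∈ A -> x' ∈ A -> F x = F x' -> x = x').
Proof.
  intros (f & Mf & Hm & Inj); exists (app f); split; [|split].
  - apply (DefF_app2 app (DefF_app HM)); defn HM.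
  - intros x Hx; apply (maps_app Hm Hx).
  - intros x x' Hx Hx' E; destruct (maps_app Hm Hx) as [K _], (maps_app Hm Hx') as [K' _].
    rewrite E in K; eauto.
Qed.

Lemma card_le_trans A B C : M A -> card_le M A B -> card_le M B C -> card_le M A C.
Proof.
  intros MA H K; apply card_le_elim in H, K.
  destruct H as (F & DF & HF & IF), K as (F' & DF' & HF' & IF').
  apply card_le_map with (F := fun x => F' (F x)); auto.
  apply (DefF_app1 F' DF'); auto.
Qed.

Lemma card_le_sub A B : M A -> A ⊆ B -> card_le M A B.
Proof. intros MA H; apply card_le_map with (F := fun x => x); auto; apply DefF_var. Qed.

End Card.

Lemma card_le_weaken (M N : set -> Prop) A B : (forall x, M x -> N x) ->
  card_le M A B -> card_le N A B.
Proof. intros H (f & Mf & K); exists f; auto. Qed.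

(** * Sets of size below an inaccessible, and forcing with a small poset *)

Section SmallForcing.
Variables (V : set -> Prop) (l : set).
Hypotheses (HV : zf_model V) (AC : choice V) (Hl : inaccessible V l).

(** The positive form supplies an injection to work with. By choice in [V], and because [l] is a
    cardinal, it agrees with [~ card_le V l X] for [X] in [V]. *)
Definition small (X : set) : Prop := V X /\ exists b, b ∈ l /\ card_le V X b.

Lemma V_l : V l.
Proof. apply Hl. Qed.

Lemma ord_l : ordinal l.
Proof. apply Hl. Qed.

Lemma small_of_lt X : V X -> ~ card_le V l X -> small X.
Proof.
  intros VX N; split; auto; destruct (well_order HV X AC VX) as (o & F & Vo & Oo & DF & H1 & H2 & H3).
  destruct (classic (o ∈ l)) as [Ho|No].
  - exists o; split; auto; apply (card_le_rel HV) with (R := fun x a => x = F a); auto.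
    + defn HV; apply (DefF_app1 F DF); defn HV.
    + intros x y y' _ Hy Hy' E E'; apply H2; congruence.
    + intros x x' y _ _ _ E E'; congruence.
  - elim N; assert (Hlo := ord_leq Oo ord_l No).
    apply (card_le_map HV) with (F := F); auto; apply V_l.
Qed.

Lemma small_lt X : small X -> ~ card_le V l X.
Proof.
  intros (VX & b & Hb & K) N; destruct Hl as (_ & ((_ & _ & C) & _) & _).
  exact (C b Hb (card_le_trans HV V_l N K)).
Qed.

Lemma small_le X Y : V X -> card_le V X Y -> small Y -> small X.
Proof.
  intros VX K HY; apply small_of_lt; auto; intros N.
  exact (small_lt HY (card_le_trans HV V_l N K)).
Qed.

Lemma small_ord a : a ∈ l -> small a.
Proof.
  intros Ha; assert (Va := zf_trans HV V_l Ha); split; auto; exists a; split; auto.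
  apply (card_le_sub HV); auto; intros x; auto.
Qed.

Lemma small_Pow X : small X -> small (Pow V X).
Proof.
  intros (VX & b & Hb & K); apply small_of_lt; [apply HV; auto|]; intros N.
  assert (C := proj2 (proj2 (proj2 Hl)) b Hb); apply C.
  apply (card_le_trans HV) with (2 := N); [apply V_l|].
  apply (card_le_elim HV) in K; destruct K as (F & DF & HF & IF).
  apply (card_le_map HV) with (F := fun Y => image Y F).
  - apply HV; auto.
  - defn HV.
  - intros Y HY; apply mem_Pow in HY; destruct HY as [VY HY]; apply mem_Pow; split.
    + apply (M_image HV); auto.
    + intros z Hz; apply mem_image in Hz; destruct Hz as (x & Hx & ->); auto.
  - intros Y Y' HY HY' E; apply mem_Pow in HY, HY'.
    assert (W : forall A A', A ⊆ X -> A' ⊆ X -> image A F = image A' F -> A ⊆ A').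
    { intros A A' HA HA' EA z Hz; assert (Hi : F z ∈ image A F) by (apply mem_image; eauto).
      rewrite EA in Hi; apply mem_image in Hi; destruct Hi as (z' & Hz' & E').
      apply IF in E'; auto; subst; auto. }
    apply set_ext; intros z; split; apply W; try tauto; auto.
Qed.

(** Kuratowski pairs of elements of an ordinal [m] belong to its double power set, which is small
    because [l] is a strong limit. This replaces the arithmetic of infinite products. *)
Lemma small_prod X Y : small X -> small Y -> small (prod X Y).
Proof.
  intros (VX & b & Hb & K) (VY & c & Hc & L).
  assert (Hm : exists m, m ∈ l /\ b ⊆ m /\ c ⊆ m).
  { destruct (ord_total (ord_in ord_l Hb) (ord_in ord_l Hc)) as [H|[->|H]].
    - exists c; split; auto; split; [apply (proj1 (ord_in ord_l Hc) b H) | intros x; auto].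
    - exists c; repeat split; auto; intros x; auto.
    - exists b; split; auto; split; [intros x; auto | apply (proj1 (ord_in ord_l Hb) c H)]. }
  destruct Hm as (m & Hm & Hbm & Hcm).
  assert (VXY : V (prod X Y)) by (apply (DefF_closed HV); defn HV).
  assert (Sm := small_Pow (small_Pow (small_ord Hm))).
  apply small_le with (Pow V (Pow V m)); auto.
  assert (Vm := zf_trans HV V_l Hm).
  apply (card_le_elim HV) in K, L; destruct K as (F & DF & HF & IF), L as (F' & DF' & HF' & IF').
  apply (card_le_rel HV) with
    (R := fun z w => exists x y, z = op x y /\ w = op (F x) (F' y)); auto.
  - apply Sm.
  - defn HV; first [apply (DefF_app1 F DF) | apply (DefF_app1 F' DF')]; defn HV.
  - intros z Hz; apply mem_prod in Hz; destruct Hz as (x & y & Hx & Hy & ->).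
    exists (op (F x) (F' y)); split; eauto.
    assert (A : F x ∈ m) by auto; assert (B : F' y ∈ m) by auto.
    assert (VA := zf_trans HV Vm A); assert (VB := zf_trans HV Vm B).
    apply mem_Pow; split; [in_model HV|]; intros w Hw; apply mem_Pow.
    apply mem_pair in Hw; destruct Hw as [-> | ->]; (split; [in_model HV|]);
      intros v Hv; apply mem_pair in Hv; destruct Hv as [-> | ->]; auto.
  - intros z w w' _ _ _ (x & y & -> & ->) (x' & y' & E & ->).
    apply op_inj in E; destruct E; subst; auto.
  - intros z z' w Hz Hz' _ (x & y & -> & ->) (x' & y' & -> & E).
    apply mem_prod in Hz, Hz'; destruct Hz as (? & ? & Hx & Hy & E1), Hz' as (? & ? & Hx' & Hy' & E2).
    apply op_inj in E, E1, E2; destruct E as [Ex Ey], E1, E2; subst.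
    apply IF in Ex; auto; apply IF' in Ey; auto; subst; auto.
Qed.

Lemma small_bounded X R : small X -> Def V (fun e => R (e 0) (e 1)) ->
  (forall x a a', x ∈ X -> a ∈ l -> a' ∈ l -> R x a -> R x a' -> a = a') ->
  exists c, c ∈ l /\ forall x a, x ∈ X -> a ∈ l -> R x a -> a ∈ c.
Proof.
  intros (VX & b & Hb & K) DR Fun; assert (Vl := V_l); assert (Vb := zf_trans HV Vl Hb).
  apply (card_le_elim HV) in K; destruct K as (F & DF & HF & IF).
  pose (Q := fun y a => exists x, x ∈ X /\ F x = y /\ R x a).
  (* Points of [b] without a value in [l] are sent to [empty], an element of [l]. *)
  pose (h := rel b l (fun y a => Q y a \/ (~ (exists a', a' ∈ l /\ Q y a') /\ a = empty))).
  assert (Vh : V h).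
  { unfold h, Q; assert (VE := M_empty HV); apply (DefF_closed HV); defn HV;
      first [apply (DefF_app1 F DF) | apply (Def_app2 R DR)]; defn HV. }
  assert (Mh : maps h b l).
  { split.
    - intros z Hz; apply mem_rel in Hz; destruct Hz as (x & y & Hx & Hy & _ & ->).
      exists x, y; auto.
    - intros y Hy; destruct (classic (exists a', a' ∈ l /\ Q y a')) as [(a & Ha & HQ)|N].
      + exists a; split; [apply op_rel; auto|]; intros a' Ha'; apply op_rel in Ha'.
        destruct Ha' as (_ & Ha' & [HQ'|[N _]]); [|elim N; eauto].
        destruct HQ as (x & Hx & E & A), HQ' as (x' & Hx' & E' & A').
        assert (x = x') by (apply IF; congruence); subst x'; eauto.
      + exists empty; split.
        * apply op_rel; split; auto; split; auto.
          exact (ord_trans ord_l (proj2 (mem_omega _) (ex_intro _ 0 eq_refl)) (proj1 Hl)).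
        * intros a' Ha'; apply op_rel in Ha'; destruct Ha' as (_ & Ha' & [HQ'|[_ E]]); auto.
          elim N; eauto. }
  assert (NC : exists c, c ∈ l /\ ~ exists x y, op x y ∈ h /\ c ⊆ y).
  { apply NNPP; intros N; apply (proj2 (proj2 (proj2 (proj2 (proj2 (proj1 (proj2 Hl)))))) b Hb).
    exists h; split; auto; split; auto; intros a Ha; apply NNPP; intros N'; apply N; eauto. }
  destruct NC as (c & Hc & N); exists c; split; auto; intros x a Hx Ha HR.
  apply NNPP; intros N'; apply N; exists (F x), a; split.
  - apply op_rel; split; auto; split; auto; left; exists x; auto.
  - apply (ord_leq (ord_in ord_l Ha) (ord_in ord_l Hc) N').
Qed.

Variables (P : poset) (G : set).
Hypotheses (HP : is_poset P) (VP : V (code P)) (HG : generic V P G) (SP : small (car P)).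

(** A value depends on the filter, but below a suitable condition each pair of an argument and a
    condition forces at most one value. Indexing by such pairs moves the relation into [V], where
    the index set is still small. *)
Lemma small_bounded_ext X r : small X -> gen_ext V G r ->
  (forall x a a', op x a ∈ r -> op x a' ∈ r -> a = a') ->
  exists c, c ∈ l /\ forall x a, x ∈ X -> a ∈ l -> op x a ∈ r -> a ∈ c.
Proof.
  intros SX Nr Fun; assert (HN := zf_gen_ext HV HP VP HG).
  assert (Dr : Def (gen_ext V G) (fun e => op (e 0) (e 1) ∈ r)) by defn HN.
  destruct (forcing_Def HV HP VP HG Dr) as (Phi & DPhi & Mono & HPhi).
  assert (Vleq := V_leq P HV VP); assert (Vcar := V_car P HV VP); assert (Vl := V_l).
  pose (T := fun x a p => Phi (fun n => match n with O => check P x | _ => check P a end) p).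
  assert (DT : Def V (fun e => T (e 0) (e 1) (e 2))).
  { assert (DC := DefF_check P HV VP).
    apply (Def_app3 (fun x a p => Phi (fun n => match n with O => x | _ => a end) p)
      (F1 := fun e => check P (e 0)) (F2 := fun e => check P (e 1)) (F3 := fun e => e 2)).
    - apply (DPhi (fun e n => match n with O => e 0 | _ => e 1 end)); [|defn HV].
      intros [|n]; [left; exists 0; auto | left; exists 1; auto].
    - apply (DefF_app1 (check P) DC); defn HV.
    - apply (DefF_app1 (check P) DC); defn HV.
    - defn HV. }
  assert (HT : forall x a, V x -> V a -> (op x a ∈ r <-> exists p, p ∈ G /\ T x a p)).
  { intros x a Vx Va; unfold T; rewrite <- HPhi.
    - rewrite !(val_check HG); tauto.
    - intros [|n]; apply V_check; auto. }
  assert (VX : V X) by apply SX.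
  pose (conflict := fun p => exists x a a', x ∈ X /\ a ∈ l /\ a' ∈ l /\ a <> a' /\
    T x a p /\ T x a' p).
  assert (Dc : Def V (fun e => conflict (e 0))).
  { unfold conflict; defn HV; apply (Def_app3 T DT); defn HV. }
  (* Genericity yields [p0] below which [T] is functional, as a conflict forced in [G]
     would contradict [Fun]. *)
  destruct (generic_meets HV HP VP HG
    (fun p => conflict p \/ ~ exists q, le P q p /\ conflict q)) as (p0 & Gp0 & K0).
  { unfold le; defn HV; apply (Def_app1 conflict Dc); defn HV. }
  { intros p Hp; destruct (classic (exists q, le P q p /\ conflict q)) as [(q & Hq & C)|N].
    - exists q; auto.
    - exists p; split; auto; apply (po_refl HP Hp). }
  destruct K0 as [(x & a & a' & Hx & Ha & Ha' & Na & T1 & T2)|K0].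
  { elim Na; assert (Vx := zf_trans HV VX Hx).
    assert (Va := zf_trans HV Vl Ha); assert (Va' := zf_trans HV Vl Ha').
    apply (Fun x); apply HT; eauto. }
  assert (Vp0 := V_cond P HV VP (G_car HG Gp0)).
  destruct (@small_bounded (prod X (car P))
    (fun z a => exists x p, z = op x p /\ le P p p0 /\ T x a p)) as (c & Hc & B).
  - apply small_prod; auto.
  - unfold le; defn HV; apply (Def_app3 T DT); defn HV.
  - intros z a a' Hz Ha Ha' (x & p & -> & Hp & A) (x' & p' & E & _ & A').
    apply op_inj in E; destruct E; subst x' p'; apply NNPP; intros Na; apply K0.
    exists p; split; auto; apply mem_prod in Hz; destruct Hz as (x' & p' & Hx & _ & E).
    apply op_inj in E; destruct E; subst x' p'; exists x, a, a'; auto 7.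
  - exists c; split; auto; intros x a Hx Ha Hr.
    assert (Vx := zf_trans HV VX Hx); assert (Va := zf_trans HV Vl Ha).
    apply HT in Hr; auto; destruct Hr as (p & Gp & Tp).
    (* A common extension of [p0] and a condition that forces the value [a] supplies the index at
       which [a] is counted. *)
    destruct (fi_dir (proj1 HG) Gp Gp0) as (q & Gq & A & A').
    apply (B (op x q)); auto.
    + apply mem_prod; exists x, q; repeat split; auto; apply (G_car HG Gq).
    + exists x, q; split; auto; split; auto; exact (Mono _ _ _ Tp A).
Qed.

(** A bound [c] of the values would itself be a value, giving [c ∈ c]. *)
Lemma small_surjection_ext X r : small X -> gen_ext V G r ->
  (forall x a a', op x a ∈ r -> op x a' ∈ r -> a = a') ->
  ~ forall a, a ∈ l -> exists x, x ∈ X /\ op x a ∈ r.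
Proof.
  intros SX Nr Fun Sur; destruct (small_bounded_ext SX Nr Fun) as (c & Hc & B).
  destruct (Sur c Hc) as (x & Hx & K); exact (mem_irrefl (B x c Hx Hc K)).
Qed.

(** Beyond what is inherited from [V], each clause denies that [W] has a certain map. Such a map
    would lie in [V[G]] and give either a partial map of a small set onto [l] or a cofinal map into
    [l] from a smaller ordinal. *)
Lemma inaccessible_intermediate (W : set -> Prop) : (forall x, V x -> W x) ->
  (forall x, W x -> gen_ext V G x) -> inaccessible W l.
Proof.
  intros VW WN; assert (HN := zf_gen_ext HV HP VP HG); assert (Vl := V_l).
  assert (VN : forall x, V x -> gen_ext V G x) by auto.
  assert (Wl := VW l Vl); assert (Nl := VN l Vl); assert (Ol := ord_l).
  assert (NG := N_filter HV VP HG).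
  assert (Card : cardinal W l).
  { split; auto; split; auto; intros a Ha (f & Wf & Hm & Inj).
    assert (Nf := WN f Wf); assert (Na := zf_trans HN Nl Ha).
    (* The inverse of an injection of [l] into [a] is a partial map of the small set [a] onto
       [l]. *)
    apply (@small_surjection_ext a (rel a l (fun y x => op x y ∈ f))).
    - apply small_ord; auto.
    - apply (DefF_closed HN); defn HN.
    - intros y x x' H H'; apply op_rel in H, H'; apply (Inj x x' y); tauto.
    - intros x Hx; exists (app f x); destruct (maps_app Hm Hx) as (H1 & H2 & _); split; auto.
      apply op_rel; auto. }
  assert (Hom : omega ⊆ l) by exact (proj1 (proj2 (proj1 (proj2 Hl)))).
  split; [exact (proj1 Hl)|]; split; [split; [exact Card|split; [exact Hom|]]|split; [exact Card|]].
  - split; auto; split; auto; split.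
    + exists (graph l (fun x => x)); split; [|split].
      * apply VW, (DefF_closed HV); defn HV.
      * apply maps_graph; auto.
      * intros a Ha; exists a, a; split; [apply op_graph; auto | intros x; auto].
    + intros b Hb (f & Wf & Hm & Hc); assert (Nf := WN f Wf).
      destruct (@small_bounded_ext b f) as (c & Hcl & B); auto using small_ord.
      * intros x a a' H H'; destruct (maps_op Hm H) as [Hx _].
        destruct (maps_app Hm Hx) as (_ & _ & U); rewrite (U _ H), (U _ H'); auto.
      * destruct (Hc c Hcl) as (x & y & Hxy & K); destruct (maps_op Hm Hxy) as [Hx Hy].
        apply (mem_irrefl (x := y)), K, (B x y); auto.
  - intros a Ha (f & Wf & Hm & Inj); assert (Nf := WN f Wf).
    assert (Va := zf_trans HV Vl Ha); assert (Na := VN a Va).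
    assert (Vcar := V_car P HV VP).
    (* This decodes nice names, with the elements of [a] stored as themselves in place of their
       check names. Sending a name to the argument at which [f] takes the decoded value is a partial
       map of a small set onto [l]. *)
    pose (dec := fun n => sep a (fun y => exists p, p ∈ G /\ op y p ∈ n)).
    assert (SN : small (Pow V (prod a (car P)))) by auto using small_Pow, small_prod, small_ord.
    assert (NS := VN _ (proj1 SN)).
    apply (@small_surjection_ext (Pow V (prod a (car P)))
      (rel (Pow V (prod a (car P))) l (fun n x => op x (dec n) ∈ f))); auto.
    + unfold dec; apply (DefF_closed HN); defn HN.
    + intros n x x' H H'; apply op_rel in H, H'; apply (Inj x x' (dec n)); tauto.
    + intros x Hx; destruct (maps_app Hm Hx) as (H1 & H2 & _).
      set (X := app f x) in *; apply mem_Pow in H2; destruct H2 as [WX HX].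
      assert (NX := WN X WX).
      destruct (@forcing_Def V P HV HP VP G HG (fun e => e 0 ∈ X)) as (Phi & DPhi & Mono & HPhi).
      { defn HN. }
      pose (n := rel a (car P) (fun y p => Phi (fun _ => check P y) p)).
      assert (Hn : n ∈ Pow V (prod a (car P))).
      { apply mem_Pow; split.
        - unfold n; apply (DefF_closed HV); defn HV.
          apply (Def_app2 (fun y p => Phi (fun _ => y) p) (F1 := fun e => check P (e 1))).
          + apply (DPhi (fun e _ => e 0)); [intros k; left; exists 0; auto | defn HV].
          + apply (DefF_app1 (check P) (DefF_check P HV VP)); defn HV.
          + defn HV.
        - intros z Hz; apply mem_rel in Hz; apply mem_prod.
          destruct Hz as (y & p & Hy & Hp & _ & ->); exists y, p; auto. }
      exists n; split; auto; apply op_rel; split; auto; split; auto.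
      replace (dec n) with X; auto; apply set_ext; intros y; unfold dec; rewrite mem_sep.
      assert (K : forall y, y ∈ a -> (y ∈ X <-> exists p, p ∈ G /\ Phi (fun _ => check P y) p)).
      { intros y' Hy'; rewrite <- (HPhi (fun _ => check P y')).
        - rewrite (val_check HG); tauto.
        - intros _; apply V_check; auto; apply (zf_trans HV Va Hy'). }
      split.
      * intros Hy; assert (Hya := HX y Hy); split; auto; apply K in Hy; auto; destruct Hy as (p & Gp & H); exists p.
        split; auto; apply op_rel; split; auto; split; auto; apply (G_car HG Gp).
      * intros (Hy & p & Gp & H); apply op_rel in H; apply K; auto; exists p; tauto.
Qed.

End SmallForcing.

(** * Capturing the cofinality *)

(** The strict left-to-right maxima of [f]. Only the values are kept, not the times, so the result
    is a subset of [k]. *)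
Definition records (k f : set) : set := sep k (fun b => exists n, n ∈ omega /\ op n b ∈ f /\
  forall m c, m ∈ n -> op m c ∈ f -> c ∈ b).

Section Cofinality.
Variables (M N : set -> Prop) (k f : set).
Hypotheses (HM : zf_model M) (HN : zf_model N) (MN : forall x, M x -> N x).
Hypotheses (Nk : N k) (Ok : ordinal k).
Hypotheses (Nf : N f) (Hf : maps f omega k).
Hypothesis Cf : forall a, a ∈ k -> exists x y, op x y ∈ f /\ a ⊆ y.
Hypothesis Fin : forall b, b ∈ omega -> ~ cofinal_map N b k.

Lemma N_records : N (records k f).
Proof. unfold records; apply (DefF_closed HN); defn HN. Qed.

(** If [k] were the successor of [a], the map sending 0 to [a] would be cofinal, against [Fin] at
    1. *)
Lemma limit_of_cofinality a : a ∈ k -> succ a ∈ k.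
Proof.
  intros Ha; assert (Oa := ord_in Ok Ha).
  destruct (ord_subset (ord_succ Oa) Ok) as [|E]; auto.
  - intros x Hx; apply mem_succ in Hx; destruct Hx as [Hx | ->]; auto; exact (ord_trans Ok Hx Ha).
  - elim (Fin (b := num 1)); [apply mem_omega; eauto|].
    assert (Na := zf_trans HN Nk Ha); assert (N1 := M_num HN 1).
    exists (graph (num 1) (fun _ => a)); split; [apply (DefF_closed HN); defn HN|].
    split; [apply maps_graph; auto|]; intros b Hb; exists (num 0), a; split.
    + apply op_graph; split; auto; apply mem_num; eauto.
    + rewrite <- E in Hb; apply mem_succ in Hb; destruct Hb as [Hb | ->]; [|intros x; auto].
      exact (proj1 Oa b Hb).
Qed.

(** Cofinality is phrased with [⊆], so it is applied to [succ a] to get a value strictly above [a].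
    The first such value is a record, because all earlier ones are at most [a]. *)
Lemma records_unbounded a : a ∈ k -> exists b, b ∈ records k f /\ a ∈ b.
Proof.
  intros Ha; destruct (Cf (limit_of_cofinality Ha)) as (n0 & b0 & H0 & K0).
  destruct (maps_op Hf H0) as [Hn0 _].
  destruct (@least_ord (fun n => exists b, op n b ∈ f /\ a ∈ b) n0) as (n & On & (b & Hb & Hab) & L).
  - exact (ord_in ord_omega Hn0).
  - exists b0; split; auto; apply K0, mem_succ; auto.
  - destruct (maps_op Hf Hb) as [Hn Hbk]; exists b; split; auto; apply mem_sep; split; auto.
    exists n; split; auto; split; auto; intros m c Hm Hc.
    destruct (maps_op Hf Hc) as [_ Hck]; assert (Oc := ord_in Ok Hck).
    assert (Oa := ord_in Ok Ha).
    destruct (ord_total Oc Oa) as [H|[->|H]]; auto.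
    + exact (ord_trans (ord_in Ok Hbk) H Hab).
    + elim (L m Hm); eauto.
Qed.

(** A record is preceded by finitely many records only, hence the records have
    order type [omega] and their increasing enumeration is the same in [M] and [N]. *)
Lemma cofinality_from_records : M omega -> M k -> M (records k f) -> cofinality M k omega.
Proof.
  intros Mo Mk My; set (y := records k f) in *.
  split; auto; split; [apply ord_omega|]; split.
  2: { intros b Hb (g & Mg & K); apply (Fin Hb); exists g; auto. }
  destruct (collapse HM (X := y) (a := k)) as (o & F & MO & Oo & DF & H1 & H2 & H3); auto.
  { intros z Hz; apply mem_sep in Hz; tauto. }
  (* Stated up to equality with [o], this also settles the case [o = omega] directly. *)
  assert (Cof : forall x, x = o -> cofinal_map M x k).
  { intros x ->; exists (graph o F); split; [apply (DefF_closed HM); defn HM|]; split.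
    - apply maps_graph; intros a Ha; assert (K := H1 a Ha); apply mem_sep in K; tauto.
    - intros a Ha; destruct (records_unbounded Ha) as (b & Hb & Hab).
      destruct (H3 b Hb) as (c & Hc & ->); exists c, (F c); split; [apply op_graph; auto|].
      assert (Hk := H1 c Hc); apply mem_sep in Hk; destruct Hk as [Hk _].
      exact (proj1 (ord_in Ok Hk) a Hab). }
  destruct (ord_total Oo ord_omega) as [Ho|[Ho|Ho]]; auto.
  (* If [o] were finite, this map would be cofinal of finite length in [N] too. *)
  - elim (Fin Ho); destruct (Cof o eq_refl) as (g & Mg & K); exists g; auto.
  (* Here [F omega] occurs at some time [n]. A smaller record is reached earlier, so record number
     [n] is reached before time [n]; but record number [i] cannot occur before time [i]. *)
  - exfalso; assert (Hn : forall i, num i ∈ o).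
    { intros i; refine (ord_trans Oo _ Ho); apply mem_omega; eauto. }
    assert (Rec : forall a, a ∈ o -> exists n, op (num n) (F a) ∈ f /\
              forall m c, m < n -> op (num m) c ∈ f -> c ∈ F a).
    { intros a Ha; assert (K := H1 a Ha); apply mem_sep in K; destruct K as (_ & n & Hn' & K1 & K2).
      apply mem_omega in Hn'; destruct Hn' as [n' ->]; exists n'; split; auto.
      intros m c Hm Hc; apply (K2 (num m) c); auto; apply mem_num; eauto. }
    destruct (Rec omega Ho) as (n & Hnf & _).
    assert (Lt : forall a b p q, a ∈ o -> b ∈ a -> op (num p) (F a) ∈ f ->
      op (num q) (F b) ∈ f -> (forall m c, m < q -> op (num m) c ∈ f -> c ∈ F b) -> q < p).
    { intros a b p q Ha Hb Hp Hq Hr; assert (K := H2 a b Ha Hb).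
      destruct (Nat.lt_trichotomy p q) as [L|[->|L]]; auto.
      - elim (mem_asym K (Hr p _ L Hp)).
      - destruct (maps_op Hf Hp) as [Hin _]; destruct (maps_app Hf Hin) as (_ & _ & U).
        rewrite (U _ Hp), (U _ Hq) in K; elim (mem_irrefl K). }
    assert (Large : forall i q, op (num q) (F (num i)) ∈ f -> i <= q).
    { induction i as [|i IH]; intros q Hq; [lia|].
      destruct (Rec (num i) (Hn i)) as (p & Hp & Hr); assert (K := IH p Hp).
      enough (p < q) by lia; apply (Lt (num (S i)) (num i) q p); auto.
      apply mem_succ; auto. }
    destruct (Rec (num n) (Hn n)) as (q & Hq & Hr); assert (K := Large n q Hq).
    enough (q < n) by lia; apply (Lt omega (num n) n q); auto; apply mem_omega; eauto.
Qed.

End Cofinality.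

(** * Generic filters along a weak system *)

Section WeakSystem.
Variables (V : set -> Prop) (S : weak_system).
Hypotheses (HV : zf_model V) (HS : is_weak_system V S).

Lemma V_po d : d ∈ ob S -> V (code (po S d)).
Proof.
  intros Hd; assert (K := in_po (ws_in HS)).
  assert (H : op d (code (po S d)) ∈ graph (ob S) (fun d => code (po S d))) by (apply op_graph; auto).
  exact (M_op_r HV K H).
Qed.

Lemma V_pr_inf d : d ∈ ob S -> V (graph (car (po_inf S)) (pr_inf S d)).
Proof.
  intros Hd; assert (K := in_pr_inf (ws_in HS)).
  refine (M_op_r HV K (x := d) _); apply op_graph; auto.
Qed.

Lemma V_pr d e : arr S d e -> V (graph (car (po S d)) (pr S d e)).
Proof.
  intros Hde; assert (K := in_pr (ws_in HS)).
  refine (M_op_r HV K (x := op d e) _).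
  (* Membership in [setof] can be unfolded only for a class known to be a set; this one is a partial
     image of the product of [ob S] with itself. *)
  apply (mem_setof (fun z => exists d e,
    arr S d e /\ z = op (op d e) (graph (car (po S d)) (pr S d e)))); [|eauto].
  exists (setof (fun z => exists w, w ∈ prod (ob S) (ob S) /\ exists d e, w = op d e /\
    arr S d e /\ z = op (op d e) (graph (car (po S d)) (pr S d e)))); intros z.
  rewrite (mem_setof_image (fun w z => exists d e, w = op d e /\
    arr S d e /\ z = op (op d e) (graph (car (po S d)) (pr S d e)))).
  - split.
    + intros (w & _ & d' & e' & _ & A & E); eauto.
    + intros (d' & e' & A & E); exists (op d' e'); split; eauto.
      apply mem_prod; exists d', e'; destruct (cat_ob (ws_cat HS) _ _ A); auto.
  - intros x z1 z2 _ (d1 & e1 & -> & _ & ->) (d2 & e2 & E & _ & ->).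
    apply op_inj in E; destruct E; subst; auto.
Qed.

(** Since the projections commute, the filter at [d] can be computed from the filter at [e]; this
    puts the extension at [d] inside the one at [e]. *)
Lemma push_comp d e G : arr S e d -> G ⊆ car (po_inf S) ->
  push (po S d) (pr_inf S d) G = push (po S d) (pr S e d) (push (po S e) (pr_inf S e) G).
Proof.
  intros A HG; destruct (cat_ob (ws_cat HS) _ _ A) as [He Hd].
  assert (HPd := ws_po HS Hd); assert (HPe := ws_po HS He).
  destruct (ws_pr_inf HS He) as (Ce & _ & _); destruct (ws_pr HS _ _ A) as (_ & Mon & _).
  apply set_ext; intros q; rewrite !mem_push; split; intros (Hq & p & Hp & K); split; auto.
  - exists (pr_inf S e p); split.
    + apply mem_push; split; auto; exists p; split; auto; apply (po_refl HPe); auto.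
    + rewrite (ws_pr_inf_comp HS _ _ A); auto.
  - apply mem_push in Hp; destruct Hp as (_ & p' & Hp' & L); exists p'; split; auto.
    rewrite <- (ws_pr_inf_comp HS _ _ A) by auto; exact (po_trans HPd (Mon _ _ L) K).
Qed.

End WeakSystem.

Theorem theorem5p3 (V : set -> Prop) (ks : nat -> set) (kappa lambda : set)
    (S : weak_system) (G : set) :
  transitive_model V ->
  Sigma_sequence V ks kappa ->
  inaccessible V lambda ->
  kappa ∈ lambda ->
  weak_Sigma_system V ks kappa S ->
  pt_inf S = one (po_inf S) ->
  nice V kappa lambda S ->
  generic V (po_inf S) G ->
  kappa_Solovay V ks kappa (gen_ext V G).
Proof.
  intros TV Hks Hl Hkl (HS & HSP & HSPd) _ (Hcap & Hbd & Ham) HG.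
  assert (HV := zf_of_transitive_model TV).
  assert (AC : choice V) by (intros a; apply (tm_choice TV)).
  assert (HPi := ws_po_inf HS); assert (VPi := in_po_inf (ws_in HS)).
  assert (TN := generic_model TV HPi VPi HG); assert (HN := zf_of_transitive_model TN).
  assert (VN : forall z, V z -> gen_ext V G z) by (intros; apply (N_ground HV VPi HG); auto).
  assert (NG := N_filter HV VPi HG).
  assert (GG := fi_sub (proj1 HG)).
  destruct (Ham G HG) as [Hsucc Hcof].
  pose (g := fun d => push (po S d) (pr_inf S d) G).
  assert (Gg : forall d, d ∈ ob S -> generic V (po S d) (g d)).
  { intros d Hd; apply push_generic with (po_inf S); auto;
      [apply (ws_po HS Hd) | apply (V_po HV HS Hd) | apply (V_pr_inf HV HS Hd) |
       apply (ws_pr_inf HS Hd)]. }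
  assert (Tg : forall d, d ∈ ob S -> transitive_model (gen_ext V (g d))).
  { intros d Hd; apply generic_model with (po S d); auto;
      [apply (ws_po HS Hd) | apply (V_po HV HS Hd)]. }
  assert (Vg : forall d, d ∈ ob S -> forall z, V z -> gen_ext V (g d) z).
  { intros d Hd z Vz; apply (N_ground HV (V_po HV HS Hd) (Gg d Hd)); auto. }
  assert (gN : forall d, d ∈ ob S -> forall z, gen_ext V (g d) z -> gen_ext V G z).
  { intros d Hd; apply gen_ext_least; auto.
    apply M_push with (P := po_inf S); auto; apply VN; [apply (V_po HV HS Hd) | apply (V_pr_inf HV HS Hd)]. }
  (* The extension at [d] is one of the models intersected in [adjoin V x]. *)
  assert (Adj : forall d x, d ∈ ob S -> gen_ext V (g d) x ->
    forall y, adjoin V x y -> gen_ext V (g d) y).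
  { intros d x Hd Hx y Hy; apply Hy; auto. }
  (* Boundedness speaks of the transitive closure of the code of the poset, and all conditions
     belong to that closure. *)
  assert (Sm : forall d, d ∈ ob S -> small V lambda (car (po S d))).
  { intros d Hd; assert (VP := V_po HV HS Hd); assert (VC := V_car (po S d) HV VP).
    apply small_of_lt; auto; intros K; apply (proj2 (Hbd d Hd)).
    apply (card_le_trans HV) with (2 := K); [apply (V_l Hl)|].
    apply (card_le_sub HV); auto; intros p Hp; apply mem_trcl.
    apply t_trans with (car (po S d)); [apply t_step; auto | apply op_l_tc]. }
  split; auto; split; auto; split; auto; split.
  - exists lambda; split; auto; intros x Nx Hx.
    destruct (cat_inhabited (ws_cat HS)) as [d Hd].
    destruct (Hcap G HG x Nx Hx d Hd) as (e & A & Kx).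
    destruct (cat_ob (ws_cat HS) _ _ A) as [He _].
    apply (inaccessible_intermediate HV AC Hl (ws_po HS He) (V_po HV HS He) (Gg e He) (Sm e He)).
    + intros z Vz W TW VW _; auto.
    + apply Adj; auto.
  - intros x Nx Hx.
    destruct Hcof as (_ & _ & (f & Nf & Mf & Cf) & Fin).
    assert (Vk := zf_trans HV (V_l Hl) Hkl); assert (Ok := ord_in (ord_l Hl) Hkl).
    assert (Ny : gen_ext V G (records kappa f)) by (apply N_records; auto).
    destruct (cat_inhabited (ws_cat HS)) as [d0 Hd0].
    (* The records are captured first, then [x] at some [e] with an arrow to the object [d] already
       found, so the model at [e] contains both. *)
    destruct (Hcap G HG _ Ny) with (d := d0) as (d & A & Ky); auto.
    { intros z Hz; apply mem_sep in Hz; tauto. }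
    destruct (cat_ob (ws_cat HS) _ _ A) as [Hd _].
    destruct (Hcap G HG x Nx Hx d Hd) as (e & A' & Kx).
    destruct (cat_ob (ws_cat HS) _ _ A') as [He _].
    assert (He' := zf_of_transitive_model (Tg e He)).
    exists (po S e), (g e); split; [auto|]; split; [|split; [|split; [auto|split; [apply Adj; auto|]]]].
    + destruct (Sm e He) as (VC & b & Hb & K); destruct Hsucc as (_ & _ & _ & _ & Hs).
      apply (card_le_trans HN) with (3 := Hs b Hb); auto.
      apply (card_le_weaken (M := V)); auto.
    + apply M_push with (P := po_inf S); auto; apply VN; [apply (V_po HV HS He) | apply (V_pr_inf HV HS He)].
    + apply cofinality_from_records with (N := gen_ext V G) (f := f); auto.
      * intros z; apply gN; auto.
      * apply Vg; auto; apply HV.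
      * revert Ky; apply (gen_ext_least He'); auto.
        rewrite (push_comp HS _ _ A' GG); apply (@M_push (gen_ext V (g e))) with (P := po S e); auto.
        -- apply Vg; auto; apply (V_po HV HS Hd).
        -- apply Vg; auto; apply (V_pr HV HS _ _ A').
        -- apply (N_filter HV (V_po HV HS He) (Gg e He)).
        -- apply (fi_sub (proj1 (Gg e He))).
Qed.
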